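(* Let $\lambda\in(0,\infty)$ and $\kappa\in\mathbb N$. In both models, ALOHA and CSMA, the sequence $(A_i,\sigma_i)_{i\in\mathbb N}$ is a $(\kappa-1)$-Markov chain with kernel $W_{\mathrm{ALOHA}}$ and $W_{\mathrm{CSMA}}$, respectively, from $[\mathbb N\times(0,\infty)]^{\kappa-1}$ to $\mathbb N\times(0,\infty)$ defined by $$W_{\mathrm{CSMA}}\big((a,t),(k,\mathrm ds)\big)=\frac{\gamma^{k-1}}{(k-1)!}\,\lambda^k e^{-\lambda s}\,\mathbf 1_{[\gamma,\infty)}(s)\,\mathrm ds,$$ $$W_{\mathrm{ALOHA}}\big((a,t),(k,\mathrm ds)\big)=\frac{\big(\gamma+\frac{B(s)}\kappa\big)^{k-1}}{(k-1)!}\Big(1-\frac{\beta(s)}\kappa\Big)\lambda^k e^{-\lambda s}\,\mathbf 1_{[\gamma,\infty)}(s)\,\mathrm ds,$$ for $(a,t)=\big((a_1,t_1),\dots,(a_{\kappa-1},t_{\kappa-1})\big)$ and $k\in\mathbb N$, where $\gamma:=\big[1-\sum_{i=1}^{\kappa-1}t_i\big]_+$ and, for the ALOHA case, $$\beta(s):=\mathbf 1_{[\gamma,\infty)}(s)\,\max\Big\{m\in\{1,\dots,\kappa\}\colon s+\sum_{j=0}^{m-2}t_{\kappa-1-j}\le 1\Big\}\in\{0,1,\dots,\kappa\},\qquad B(s)=\int_0^s\beta(r)\,\mathrm dr$$ (with $\max\emptyset=0$). Both $(\kappa-1)$-Markov chains are uniformly ergodic in the sense that the Markov chain of vectors $R_i=\big((A_i,\sigma_i),\dots,(A_{i+\kappa-2},\sigma_{i+\kappa-2})\big)$,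 $i\in\mathbb N$, on the state space $[\mathbb N\times(0,\infty)]^{\kappa-1}$ satisfies the following condition (U): writing $P$ for its transition kernel and $P^i$ for the $i$-step kernel, there exist $\ell,N\in\mathbb N$ with $\ell\le N$ and a constant $M\in[1,\infty)$ such that $$P^\ell(x,\cdot)\le\frac MN\sum_{i=1}^N P^i(y,\cdot)\qquad\text{for all states }x,y.$$
   Context: Model. There are $\kappa$ channels. Messages arrive at the points $0<T_1<T_2<\dots$ of a standard Poisson point process on $(0,\infty)$ with intensity $\lambda$. Every transmission has a duration (service time) of exactly one time unit. CSMA: an arriving message is admitted to the system if and only if some channel is idle at its arrival time; if admitted, it occupies an idle channel for one time unit and is then successfully delivered. Otherwise it is discarded. ALOHA: each arriving message picks one of the $\kappa$ channels uniformly at random, independently over all messages. If the chosen channel is busy, both the new message and the message currently in the channel are cancelled: the new message is rejected immediately and does not occupy the channel, while the old one stays in the channel (keeping it busy) until one time unit after its own admittance and then leaves without having been successfully delivered. If the chosen channel is idle, the new message is admitted and occupies the channel for one time unit. In both models $0<\widetilde T_1<\widetilde T_2<\dots$ are all the arrival times $T_j$ at which the arriving message is admitted to a channel (in ALOHA: picks an idle channel). Put $\widetilde T_0=0$, regarded as the time of the 0-th admittance: at time $0$ one message is admitted to the otherwise idle system. For $i\in\mathbb N$, $$\sigma_i=\widetilde T_i-\widetilde T_{i-1},\qquad A_i=\#\{j\in\mathbb N\colon T_j\in(\widetilde T_{i-1},\widetilde T_i]\}.$$ A sequence $(X_i)_{i\in\mathbb N}$ in a space $\Sigma$ is a (time-homogeneous)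 $(\kappa-1)$-Markov chain with kernel $W$ from $\Sigma^{\kappa-1}$ to $\Sigma$ if for every $i\ge\kappa-1$ the conditional distribution of $X_{i+1}$ given $(X_j)_{j\le i}$ is $W\big((X_{i-\kappa+2},\dots,X_i),\cdot\big)$ (arguments ordered from oldest to most recent). Equivalently, the vectors $R_i=(X_i,\dots,X_{i+\kappa-2})$ form a Markov chain on $\Sigma^{\kappa-1}$ with kernel $P\big((x_1,\dots,x_{\kappa-1}),\mathrm d(y_1,\dots,y_{\kappa-1})\big)=\bigotimes_{i=1}^{\kappa-2}\delta_{x_{i+1}}(\mathrm dy_i)\otimes W\big((x_1,\dots,x_{\kappa-1}),\mathrm dy_{\kappa-1}\big)$. Conventions: $[x]_+=\max\{x,0\}$, $0^0=1$. *)

(* Defs.v *)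
From HB Require Import structures.
From mathcomp Require Import all_boot all_order all_algebra finmap.
From mathcomp Require Import all_classical all_reals all_analysis.

Set Implicit Arguments.
Unset Strict Implicit.
Unset Printing Implicit Defensive.

Import Order.TTheory GRing.Theory Num.Theory.
Import numFieldNormedType.Exports.

Local Open Scope classical_set_scope.
Local Open Scope ring_scope.

(** Messages are numbered by [nat]. Message [0] is the one admitted at time 0
    to the empty system; it is not a point of the Poisson process. The points of
    the process are [T 1 w < T 2 w < ...]. *)

Section arrivals.
Context d (Omega : measurableType d) (R : realType) (P : probability Omega R).

Definition has_points (T : nat -> Omega -> R) (B : set R) (n : nat) :
    set Omega :=
  [set w | ([set j | (0 < j)%N /\ B (T j w)] #= `I_n)%card].

(** [arrival_counts] gives both the Poisson law of the number of points of a
    Borel set ([m = 1]) and the independence of these numbers over pairwise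
    disjoint Borel sets. It is not stated with [poisson_pmf], whose value at
    rate [0] is not that of the Dirac mass at [0]. *)
Record poisson_arrivals (lambda : R) (T : nat -> {RV P >-> R}) : Prop := {
  arrival0 : forall w, T 0%N w = 0 ;
  arrival_lt : forall w j, T j w < T j.+1 w ;
  arrival_cvg : forall w, T j w @[j --> \oo] --> +oo ;
  arrival_counts : forall (m : nat) (B : 'I_m -> set R) (n : 'I_m -> nat),
    (forall i, measurable (B i)) ->
    (forall i, B i `<=` `]0, +oo[) ->
    (forall i, (lebesgue_measure (B i) < +oo)%E) ->
    trivIset [set: 'I_m] B ->
    P (\bigcap_(i in [set: 'I_m]) has_points T (B i) (n i)) =
    (\prod_(i < m)
       (let r := lambda * fine (lebesgue_measure (B i)) in
        r ^+ n i / (n i)`!%:R * expR (- r)))%:E }.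

(** The channels picked by the messages are i.i.d. uniform and independent of
    the arrival times. *)
Record uniform_choices (kappa : nat) (T : nat -> {RV P >-> R})
    (C : nat -> Omega -> 'I_kappa) : Prop := {
  choice_measurable : forall j c, measurable [set w | C j w = c] ;
  choice_uniform : forall j c, P [set w | C j w = c] = (kappa%:R^-1)%:E ;
  choice_indep : forall (E : set Omega) (m : nat) (c : 'I_m -> 'I_kappa),
    <<s \bigcup_j g_sigma_algebra_preimage (T j) >> E ->
    P (E `&` \bigcap_(j in [set: 'I_m]) [set w | C j w = c j]) =
    (P E * \prod_(j < m) P [set w | C j w = c j])%E }.

End arrivals.

(** Deterministic dynamics of the channels along one realisation: [t] lists the
    arrival times and [c] the channels addressed by the messages. The rule
    [accepts I x] tells whether a message addressing channel [x] is admitted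
    (to [x]) when [I] is the set of idle channels. *)
Section channels.
Context (R : realType) (kappa : nat).
Variable accepts : {set 'I_kappa} -> 'I_kappa -> bool.
Variables (t : nat -> R) (c : nat -> 'I_kappa).

(** [release j x] is the end of the last service in channel [x] among messages
    [0, ..., j - 1]. The initial value [0] makes every channel idle for
    message [0]. *)
Fixpoint release (j : nat) : 'I_kappa -> R :=
  if j is i.+1 then fun x =>
    if accepts (finset (fun y => release i y <= t i)) (c i) && (x == c i)
    then t i + 1 else release i x
  else fun=> 0.

Definition idle (j : nat) : {set 'I_kappa} :=
  finset (fun x => release j x <= t j).

Definition admitted (j : nat) : bool := accepts (idle j) (c j).

Definition next_admitted (m : nat) : nat :=
  xget 0%N [set j | [/\ (m < j)%N, admitted j &
                        forall i, (m < i < j)%N -> ~~ admitted i]].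

Definition admitted_index (i : nat) : nat := iter i next_admitted 0%N.

Definition admission_time (i : nat) : R := t (admitted_index i).

(** [(A_(i+1), sigma_(i+1))]: the sequence is numbered from [0]. *)
Definition admission_data (i : nat) : nat * R :=
  (#|` fset_set [set j | (0 < j)%N /\
        admission_time i < t j <= admission_time i.+1]|,
   admission_time i.+1 - admission_time i).

End channels.

(** In ALOHA a collision also spoils the message already in the channel, but
    that message keeps the channel busy until its scheduled end; hence
    collisions do not enter the occupancy of the channels. *)
Definition aloha_rule (kappa : nat) (I : {set 'I_kappa}) (x : 'I_kappa) : bool :=
  x \in I.

(** In CSMA the choice of the idle channel is left open: [c] is any assignment
    that addresses an idle channel whenever there is one. *)
Definition csma_rule (kappa : nat) (I : {set 'I_kappa}) (x : 'I_kappa) : bool :=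
  I != finset.set0.

Definition csma_choices (R : realType) (kappa : nat) (t : nat -> R)
    (c : nat -> 'I_kappa) : Prop :=
  forall j, idle (@csma_rule kappa) t c j != finset.set0 ->
    c j \in idle (@csma_rule kappa) t c j.

(** The space [{1, 2, ...} * (0, +oo)] with the trace of the product
    sigma-algebra of [nat * R]. *)
Definition state (R : realType) : Type :=
  {x : nat * R | (0 < x.1)%N && (0 < x.2)}.

Section state.
Context (R : realType).

HB.instance Definition _ := Choice.on (state R).

Let one : nat * R := (1%N, 1%R).

Fact one_in_state : (0 < one.1)%N && (0 < one.2).
Proof. by rewrite /= ltr01. Qed.

HB.instance Definition _ := isPointed.Build (state R) (exist _ one one_in_state).

Definition state_val (x : state R) : nat * R := sval x.

HB.instance Definition _ :=
  Measurable.copy (state R) (g_sigma_algebra_preimageType state_val).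

End state.

Section markov.
Context d (S : measurableType d) (R : realType) (n : nat).
Variable W : R.-pker (n.-tuple S) ~> S.

(** [X 0, X 1, ...] is an [n]-Markov chain with kernel [W]: for [n <= i],
    [W (X (i - n), ..., X (i - 1))] is a regular conditional distribution of
    [X i] given [X 0, ..., X (i - 1)]. *)
Definition markov_chain d' (Omega : measurableType d')
    (P : probability Omega R) (X : nat -> Omega -> S) : Prop :=
  (forall i, measurable_fun [set: Omega] (X i)) /\
  forall i, (n <= i)%N ->
  forall (D : set Omega) (U : set S),
    <<s \bigcup_(j < i) g_sigma_algebra_preimage (X j) >> D -> measurable U ->
    P (D `&` X i @^-1` U) =
    (\int[P]_(w in D) W [tuple X (i - n + j)%N w | j < n] U)%E.

(** Drop the oldest entry and append the newest one; for [n = 0] the result is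
    the empty tuple. *)
Definition slide (xy : n.-tuple S * S) : n.-tuple S :=
  behead_tuple (rcons_tuple xy.1 xy.2).

Lemma measurable_slide : measurable_fun [set: n.-tuple S * S] slide.
Proof.
apply/measurable_fun_tnthP => i.
have [lt_i|ge_i] := boolP (i.+1 < n)%N.
  rewrite (_ : _ \o _ = (fun x : n.-tuple S => tnth x (Ordinal lt_i)) \o fst).
    by apply: measurableT_comp => //; exact: measurable_tnth.
  apply/funext => -[x y] /=; rewrite !(tnth_nth y) /=.
  by rewrite nth_behead nth_rcons size_tuple lt_i.
rewrite (_ : _ \o _ = snd); first exact: measurable_snd.
apply/funext => -[x y] /=; rewrite !(tnth_nth y) /= nth_behead nth_rcons.
by rewrite size_tuple (negbTE ge_i); case: ifP.
Qed.

(** The kernel of the chain of vectors [(X i, ..., X (i + n - 1))]. *)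
Definition vector_kernel : n.-tuple S -> {measure set (n.-tuple S) -> \bar R} :=
  (W \; kdirac measurable_slide)%E.

End markov.

Section uniform_ergodicity.
Context d (S : measurableType d) (R : realType).
Variable P : S -> {measure set S -> \bar R}.

Fixpoint step_kernel (i : nat) (x : S) (U : set S) : \bar R :=
  if i is j.+1 then (\int[P x]_y step_kernel j y U)%E else \d_x U.

Definition condition_U : Prop :=
  exists l N : nat, exists M : R,
    [/\ (0 < l)%N, (l <= N)%N, 1 <= M &
      forall (x y : S) (U : set S), measurable U ->
        (step_kernel l x U <=
         (M / N%:R)%:E * \sum_(1 <= i < N.+1) step_kernel i y U)%E].

End uniform_ergodicity.

Section kernels.
Context (R : realType) (lambda : R) (kappa : nat).
Implicit Types (x : kappa.-1.-tuple (state R)) (k : nat) (s : R).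

Definition gaps x : seq R := [seq (state_val z).2 | z <- x].

Definition gamma x : R := Num.max (1 - \sum_(u <- gaps x) u) 0.

(** [t_(kappa - 1 - j)], counted from [1], is entry [kappa - 1 - (j + 1)] of
    [gaps x], counted from [0]. *)
Definition beta x s : R :=
  \1_(`[gamma x, +oo[) s *
  (\max_(1 <= m < kappa.+1 |
         s + \sum_(0 <= j < m.-1) (gaps x)`_(kappa.-1 - j.+1) <= 1) m)%:R.

Definition beta_int x s : R := \int[lebesgue_measure]_(r in `[0, s]) beta x r.

Definition csma_density x k s : R :=
  gamma x ^+ k.-1 / k.-1`!%:R * lambda ^+ k * expR (- lambda * s) *
  \1_(`[gamma x, +oo[) s.

Definition aloha_density x k s : R :=
  (gamma x + beta_int x s / kappa%:R) ^+ k.-1 / k.-1`!%:R *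
  (1 - beta x s / kappa%:R) * lambda ^+ k * expR (- lambda * s) *
  \1_(`[gamma x, +oo[) s.

(** The measure [f k s ds] on [{1, 2, ...} * (0, +oo)]. *)
Definition density_measure (f : nat -> R -> R) (U : set (state R)) : \bar R :=
  (\sum_(1 <= k <oo)
     \int[lebesgue_measure]_(s in [set s | (@state_val R @` U) (k, s)])
       (f k s)%:E)%E.

End kernels.

(** The data [(A_i, sigma_i)] take values in [{1, 2, ...} * (0, +oo)] and form
    a chain with kernel [W]. *)
Definition admission_chain (R : realType) (kappa : nat)
    (accepts : {set 'I_kappa} -> 'I_kappa -> bool)
    (W : R.-pker (kappa.-1.-tuple (state R)) ~> state R)
    d (Omega : measurableType d) (P : probability Omega R)
    (T : nat -> {RV P >-> R}) (C : nat -> Omega -> 'I_kappa) : Prop :=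
  exists2 X : nat -> Omega -> state R,
    forall i w, state_val (X i w) =
      admission_data accepts (fun j => T j w) (fun j => C j w) i &
    markov_chain W P X.

(* Main.v *)
(** A message arriving a time s after the last admittance is rejected with a
    probability p(s) given by thresholds: it picks a uniform mark c and is rejected
    iff s < r_c. In ALOHA, c is the channel and r_c its residual service time at the
    last admittance; in CSMA there is one threshold, the time until some channel
    falls idle. A channel busy at an admittance is occupied by one of the last kappa
    admitted messages, so the multiset of thresholds is a function of the last
    kappa - 1 gaps.

    Conditioning on the index J of the i-th admitted message, the history is
    determined by the messages 0, ..., J, while the following interarrival times are
    independent of them and exponential. Summing over the rejected messages one at a
    time gives the density lambda^(k+1) e^(-lambda s) (1 - p(s)) (int_0^s p)^k / k! of
    the next admittance preceded by k rejections, the power coming from an iterated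
    integral over the simplex. In ALOHA, p = 1_(s < gamma) + beta / kappa almost
    everywhere, which gives the kernels of the statement.

    For condition (U), the kernel depends on the gaps only, and the law of the next
    gap is at most e^lambda times the exponential law, and at least a constant times
    its restriction to [g, +oo[, where g <= 1, and g <= 0 as soon as one of the last
    kappa - 1 gaps is at least 1. Starting from any state, force one gap larger than 1:
    the next kappa - 1 gaps then dominate i.i.d. exponential ones, and replace the
    whole window. Hence P^(2 kappa - 1)(x, .) <= M P^(2 kappa - 1)(y, .). *)

Require Import Defs.
From HB Require Import structures.
From mathcomp Require Import all_boot all_order all_algebra finmap.
From mathcomp Require Import all_classical all_reals all_analysis.
From mathcomp Require Import measurable_realfun ring lra zify.

Set Implicit Arguments.
Unset Strict Implicit.
Unset Printing Implicit Defensive.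

Import Order.TTheory GRing.Theory Num.Theory.
Import numFieldNormedType.Exports.

Local Open Scope classical_set_scope.
Local Open Scope ring_scope.

(** * Measures with densities and the exponential law *)

(** The hypotheses on the arrivals bear on counts of points, whereas the argument needs each
    interarrival time to be independent of the past. This is recovered from void probabilities, the
    random time [T J] being discretised on a grid. Admittances are indexed by random message
    numbers, so all conditioning takes place on the events [idx i w = J], where the history is
    measurable with respect to the messages up to [J]. Residual service times by channel are not
    functions of the gaps, which do not reveal the labels of the channels. Only [reject_prob] enters
    the law, and it sees the thresholds up to permutation: thresholds by channel may be traded for
    thresholds by age. The rejection probability jumps at the thresholds, so the iterated integral
    is computed by Tonelli's theorem rather than by differentiation. In the exponent [2 kappa - 1],
    one step forces the long gap, [kappa - 1] steps replace the gaps, and [kappa - 1] more replace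
    the counts, which the kernel ignores but the window remembers. *)

Section density.
Context d (S : measurableType d) (R : realType).
Variable mu : {measure set S -> \bar R}.
Local Open Scope ereal_scope.

(** The proofs [mh] and [h0] are arguments so that the measure structure can be inferred from the
    term itself; [image_measure] does the same. *)
Definition mdensity (h : S -> R) (mh : measurable_fun [set: S] h)
  (h0 : forall x, (0 <= h x)%R) (A : set S) : \bar R := \int[mu]_(x in A) (h x)%:E.

Section is_measure.
Variables (h : S -> R) (mh : measurable_fun [set: S] h).
Variable h0 : forall x, (0 <= h x)%R.
Let emh : measurable_fun [set: S] (EFin \o h). Proof. exact/measurable_EFinP. Qed.
Let eh0 x : 0 <= (h x)%:E. Proof. by rewrite lee_fin. Qed.
Local Notation nu := (mdensity mh h0).

Let nu0 : nu set0 = 0. Proof. exact: integral_set0. Qed.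

Let nu_ge0 A : 0 <= nu A. Proof. exact: integral_ge0. Qed.

Let nu_sigma_additive : semi_sigma_additive nu.
Proof.
move=> F mF tF mUF; rewrite /mdensity; apply: cvg_toP.
  apply: ereal_nondecreasing_is_cvgn => m n mn.
  by apply: lee_sum_nneg_natr => // k _ _; exact: integral_ge0.
by rewrite ge0_integral_bigcup//; exact: measurable_funTS.
Qed.

HB.instance Definition _ := isMeasure.Build _ _ _ nu nu0 nu_ge0 nu_sigma_additive.

Import HBNNSimple.

Let integral_mdensity_nnsfun (f : {nnsfun S >-> R}) :
  \int[nu]_x (f x)%:E = \int[mu]_x ((f x)%:E * (h x)%:E).
Proof.
rewrite integralT_nnsfun sintegralE.
transitivity (\sum_(r \in range f)
    \int[mu]_x ((r * \1_(f @^-1` [set r]) x)%:E * (h x)%:E)); last first.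
  rewrite -ge0_integral_fsum//.
  - apply: eq_integral => x _; rewrite -ge0_mule_fsuml; last first.
      by move=> n; rewrite EFinM nnfun_muleindic_ge0.
    by rewrite fsumEFin// -fimfunE.
  - move=> r; apply: emeasurable_funM => //.
    by exact/measurable_EFinP/measurableT_comp.
  - by move=> n x _; rewrite mule_ge0// EFinM nnfun_muleindic_ge0.
apply: eq_fsbigr => r _; rewrite /=.
under [RHS]eq_integral do rewrite EFinM -muleA.
have [r0|r0] := ltP r 0%R.
  rewrite preimage_nnfun0// measure0 mule0 integral0_eq// => x _.
  by rewrite indicE in_set0 mul0e mule0.
rewrite ge0_integralZl_EFin//; last 2 first.
- by move=> x _; rewrite mule_ge0// lee_fin.
- by apply: emeasurable_funM => //; exact/measurable_EFinP.
congr (_ * _); rewrite /mdensity integral_mkcond; apply: eq_integral => x _.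
by rewrite patchE indicE; case: ifP => _; rewrite ?mul1e ?mul0e.
Qed.

Lemma integral_mdensity (f : S -> \bar R) :
  measurable_fun [set: S] f -> (forall x, 0 <= f x) ->
  \int[nu]_x f x = \int[mu]_x (f x * (h x)%:E).
Proof.
move=> mf f0; pose f_ := nnsfun_approx measurableT mf.
have cvf x : (f_ n x)%:E @[n --> \oo] --> f x by exact: cvg_nnsfun_approx.
transitivity (lim (\int[nu]_x (f_ n x)%:E @[n --> \oo])).
  rewrite -monotone_convergence//=.
  - by apply: eq_integral => x _; apply/esym/cvg_lim.
  - by move=> n; exact/measurable_EFinP/measurable_funTS.
  - by move=> n x _; rewrite lee_fin.
  - by move=> x _ m n mn; rewrite lee_fin; exact/lefP/nd_nnsfun_approx.
under eq_fun do rewrite integral_mdensity_nnsfun.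
rewrite -monotone_convergence//=.
- apply: eq_integral => x _; apply/cvg_lim => //.
  exact: cvgeZr.
- move=> n; apply: emeasurable_funM => //.
  exact/measurable_EFinP/measurable_funTS.
- by move=> n x _; rewrite mule_ge0// lee_fin.
- move=> x _ m n mn; rewrite lee_wpmul2r// lee_fin; exact/lefP/nd_nnsfun_approx.
Qed.

End is_measure.
End density.

Section measure_comparison.
Context d (S : measurableType d) (R : realType).
Local Open Scope ereal_scope.
Import HBNNSimple.

Lemma le_measure_integral (m1 m2 : {measure set S -> \bar R}) (f : S -> \bar R) :
  (forall A, measurable A -> m1 A <= m2 A) ->
  measurable_fun [set: S] f -> (forall x, 0 <= f x) ->
  \int[m1]_x f x <= \int[m2]_x f x.
Proof.
move=> m12 mf f0; rewrite !ge0_integralTE//.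
apply: ge_ereal_sup => _ [h hf <-]; apply: le_trans; last first.
  by apply: ereal_sup_ubound; exists h.
rewrite !sintegralE; apply: lee_fsum => // r [x _ <-].
by apply: lee_wpmul2l; [rewrite lee_fin|exact: m12].
Qed.

End measure_comparison.

Section image_measure.
Context d d' (S : measurableType d) (S' : measurableType d') (R : realType).
Variables (m : {measure set S -> \bar R}) (f : S -> S').

Definition image_measure (mf : measurable_fun [set: S] f) : set S' -> \bar R :=
  pushforward m f.

Variable mf : measurable_fun [set: S] f.

HB.instance Definition _ := Measure.copy (image_measure mf)
  (measure_function_pushforward__canonical__measure_function_Measure m mf).

Lemma integral_image_measure (g : S' -> \bar R) :
  measurable_fun [set: S'] g -> (forall x, 0 <= g x)%E ->
  (\int[image_measure mf]_x g x = \int[m]_x g (f x))%E.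
Proof. by move=> mg g0; rewrite ge0_integral_pushforward. Qed.

End image_measure.

Section finite_image_measure.
Context d d' (S : measurableType d) (S' : measurableType d') (R : realType).
Variables (m : {finite_measure set S -> \bar R}) (f : S -> S').
Variable mf : measurable_fun [set: S] f.

Let image_finite : fin_num_fun (image_measure m mf).
Proof.
move=> A mA; rewrite /image_measure /pushforward fin_num_measure//.
by rewrite -[X in measurable X]setTI; exact: mf.
Qed.

HB.instance Definition _ :=
  Measure_isFinite.Build _ _ _ (image_measure m mf) image_finite.

End finite_image_measure.

Lemma measurable_set_bool d (S : measurableType d) (b : S -> bool) :
  measurable_fun [set: S] b -> measurable [set x | b x].
Proof. by move=> mb; rewrite -[X in measurable X]setTI; exact: (mb measurableT [set true]). Qed.

Lemma measurable_natb d (S : measurableType d) (R : realType) (b : S -> bool) :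
  measurable_fun [set: S] b -> measurable_fun [set: S] (fun x => (b x)%:R : R).
Proof.
move=> mb; rewrite (_ : (fun _ => _) = fun x => if b x then 1 else 0 : R).
  exact: measurable_fun_ifT.
by apply/funext => x; case: (b x).
Qed.

Section translation.
Context (R : realType).
Local Notation mu := (@lebesgue_measure R).
Let shift (a : R) (x : measurableTypeR R) : measurableTypeR R := (x : R) + a.

Let measurable_shift a : measurable_fun [set: measurableTypeR R] (shift a).
Proof. exact: measurable_funD. Qed.

Let lebesgue_shift a A : measurable A -> mu A = image_measure mu (measurable_shift a) A.
Proof.
apply: lebesgue_measure_unique => _ [[x y]] _ <-.
transitivity (mu `](x - a), (y - a)]).
  rewrite !lebesgue_measure_itv/= !lte_fin ltrD2r; case: ifP => // _.
  by rewrite -!EFinB; congr EFin; lra.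
congr (mu _); apply/seteqP; split=> z /=;
  by rewrite !in_itv /= /shift ltrBlDr lerBrDr.
Qed.

Lemma ge0_integral_shift (a : R) (f : R -> \bar R) :
  measurable_fun [set: R] f -> (forall x, (0 <= f x)%E) ->
  (\int[mu]_x f (x + a)%R = \int[mu]_x f x)%E.
Proof.
move=> mf f0; transitivity (\int[image_measure mu (measurable_shift a)]_x f x)%E.
  by rewrite integral_image_measure.
by apply: eq_measure_integral => A mA _; exact/esym/lebesgue_shift.
Qed.

End translation.

Section exponential.
Context (R : realType) (lambda : R).
Hypothesis lambda_gt0 : 0 < lambda.
Local Notation mu := (@lebesgue_measure R).

Definition expo : set (measurableTypeR R) -> \bar R := mdensity mu
  (measurable_exponential_pdf lambda) (exponential_pdf_ge0 (ltW lambda_gt0)).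

HB.instance Definition _ := Measure.on expo.

Let expoT : expo setT = 1%E.
Proof. by rewrite /expo /mdensity integral_exponential_pdf. Qed.

HB.instance Definition _ := Measure_isProbability.Build _ _ _ expo expoT.

Let expo_lt0 : expo `]-oo, 0[ = 0%E.
Proof.
rewrite /expo /mdensity integral0_eq// => x /=; rewrite in_itv /= => x0.
by rewrite lt0_exponential_pdf.
Qed.

Lemma expo_gt s : 0 <= s -> expo `]s, +oo[ = (expR (- (lambda * s)))%:E.
Proof.
move=> s0.
have -> : `]s, +oo[%classic = ~` (`]-oo, 0%R[ `|` `[0%R, s]) :> set R.
  apply/seteqP; split=> x /=; rewrite !in_itv /= andbT.
    by move=> sx [|]; rewrite ?(leNgt x) ?sx ?andbF// ltNge (le_trans s0)// ltW.
  move=> /not_orP[/negP]; rewrite -leNgt => -> /negP.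
  by rewrite -ltNge.
rewrite probability_setC; last exact: measurableU.
rewrite measureU//; last first.
  apply/seteqP; split=> // x [] /=; rewrite !in_itv /= => x0 /andP[].
  by rewrite leNgt x0.
rewrite [X in (_ - (X + _))%E]expo_lt0 add0e.
have [->|s_neq0] := eqVneq s 0.
  rewrite set_itv1 /= /expo /mdensity integral_set1 mulr0 oppr0 expR0.
  by rewrite sube0.
have s_gt0 : 0 < s by rewrite lt_neqAle eq_sym s_neq0.
rewrite [X in (_ - X)%E](_ : _ = exponential_prob lambda `[0, s])//.
by rewrite exponential_prob_itv0c// -[1%E]/(1%:E) -!EFinB subKr mulNr.
Qed.

Lemma integral_expo (f : R -> \bar R) :
  measurable_fun [set: R] f -> (forall x, (0 <= f x)%E) ->
  (\int[expo]_x f x = \int[mu]_x (f x * (exponential_pdf lambda x)%:E))%E.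
Proof. by move=> mf f0; exact: integral_mdensity. Qed.

Lemma eq_integral_expo (f g : R -> \bar R) :
  measurable_fun [set: R] f -> measurable_fun [set: R] g ->
  (forall x, (0 <= f x)%E) -> (forall x, (0 <= g x)%E) ->
  (forall x, 0 <= x -> f x = g x) ->
  (\int[expo]_x f x = \int[expo]_x g x)%E.
Proof.
move=> mf mg f0 g0 fg; rewrite !integral_expo//; apply: eq_integral => x _.
have [x0|x0] := leP 0 x; first by rewrite fg.
by rewrite lt0_exponential_pdf// !mule0.
Qed.

Lemma le_integral_expo (f g : R -> \bar R) :
  measurable_fun [set: R] f -> measurable_fun [set: R] g ->
  (forall x, (0 <= f x)%E) -> (forall x, (0 <= g x)%E) ->
  (forall x, 0 <= x -> (f x <= g x)%E) ->
  (\int[expo]_x f x <= \int[expo]_x g x)%E.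
Proof.
have mpdf := measurable_exponential_pdf lambda.
move=> mf mg f0 g0 fg; rewrite !integral_expo//; apply: ge0_le_integral => //.
- by move=> x _; rewrite mule_ge0// lee_fin exponential_pdf_ge0// ltW.
- by apply: emeasurable_funM => //; exact/measurable_EFinP.
- by apply: emeasurable_funM => //; exact/measurable_EFinP.
move=> x _; have [x0|x0] := leP 0 x; last by rewrite lt0_exponential_pdf// !mule0.
by rewrite lee_wpmul2r ?fg// lee_fin exponential_pdf_ge0// ltW.
Qed.

(** Open right half-lines form a pi-system that generates the Borel sets. The mass [r] is left free
    for the law of an interarrival time restricted to an event [H], where it is [P H]. *)
Lemma expo_unique (nu : {measure set (measurableTypeR R) -> \bar R}) (r : {nonneg R}) :
  (forall s : R, 0 <= s -> nu `]s, +oo[%classic = (r%:num * expR (- (lambda * s)))%:E) ->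
  nu `]-oo, 0%R]%classic = 0%E ->
  forall A, measurable A -> nu A = (r%:num%:E * expo A)%E.
Proof.
move=> nuE nu0 A mA.
have nuT : nu setT = r%:num%:E.
  have -> : [set: R] = `]-oo, 0] `|` `]0, +oo[.
    apply/seteqP; split=> // x _ /=; rewrite !in_itv /= andbT.
    by have [|] := leP x 0; [left|right].
  rewrite measureU//; last first.
    apply/seteqP; split=> // x [] /=; rewrite !in_itv /= andbT => x0.
    by rewrite ltNge x0.
  rewrite [X in (X + _)%E]nu0 add0e [LHS]nuE//.
  by rewrite mulr0 oppr0 expR0 mulr1.
(* The tails are prescribed for [s >= 0] only; below 0 the tail is the whole mass. *)
have nu_lt0 (s : R) : s < 0 -> nu `]s, +oo[%classic = r%:num%:E.
  move=> s0; apply/eqP; rewrite eq_le; apply/andP; split.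
    by rewrite -nuT le_measure// inE.
  have <- : nu `]0, +oo[%classic = r%:num%:E.
    by rewrite nuE// mulr0 oppr0 expR0 mulr1.
  rewrite le_measure ?inE// => x /=; rewrite !in_itv /= !andbT.
  exact: lt_trans.
rewrite -[RHS]/(mscale r expo A).
apply: (@measure_unique _ _ (measurableTypeR R) (@RGenOInfty.G R)
  (fun n => `](- n%:R), +oo[%classic)) => //.
- exact: RGenOInfty.measurableE.
- move=> _ _ [x ->] [y ->]; exists (Num.max x y).
  by apply/seteqP; split=> z /=; rewrite !in_itv /= !andbT gt_max => /andP.
- by move=> n; exists (- n%:R).
- apply/seteqP; split=> // x _; exists (Num.truncn `|x|).+1 => //=.
  rewrite in_itv /= andbT ltrNl (le_lt_trans (ler_norm _))// normrN.
  by rewrite truncnS_gt.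
- move=> _ [x ->]; rewrite /= /mscale /=.
  have [x0|x0] := ltP x 0; last by rewrite nuE// EFinM expo_gt.
  rewrite nu_lt0// -[LHS]mule1; congr (_ * _)%E; apply/esym/eqP.
  rewrite eq_le probability_le1//=.
  have <- : expo `]0, +oo[%classic = 1%E by rewrite expo_gt// mulr0 oppr0 expR0.
  by rewrite le_measure ?inE// => y /=; rewrite !in_itv /= !andbT; exact: lt_trans.
- move=> n; rewrite (@le_lt_trans _ _ (nu setT))//; last by rewrite nuT ltry.
  by rewrite le_measure ?inE.
Qed.

End exponential.

(** * Deterministic paths *)

Section path.
Context (R : realType) (kappa : nat).
Variable accepts : {set 'I_kappa} -> 'I_kappa -> bool.
Variables (t : nat -> R) (c : nat -> 'I_kappa).

Local Notation release := (release accepts t c).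
Local Notation idle := (idle accepts t c).
Local Notation admitted := (admitted accepts t c).
Local Notation next_admitted := (next_admitted accepts t c).
Local Notation idx := (admitted_index accepts t c).

Hypothesis t0 : t 0%N = 0.
Hypothesis t_lt : forall j, t j < t j.+1.
Hypothesis t_cvg : t j @[j --> \oo] --> +oo.
Hypothesis admitted_idle : forall j, admitted j -> c j \in idle j.
Hypothesis idle_admitted : forall j, idle j = [set: 'I_kappa]%SET -> admitted j.

Let t_mono : {mono t : i j / (i <= j)%N >-> i <= j}.
Proof. exact: Order.NatMonotonyTheory.incnP. Qed.

Let t_monolt : {mono t : i j / (i < j)%N >-> i < j}.
Proof. exact: leW_mono. Qed.

Lemma releaseS j x : release j.+1 x =
  if admitted j && (x == c j) then t j + 1 else release j x.
Proof. by []. Qed.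

Lemma admitted0 : admitted 0.
Proof. by apply: idle_admitted; apply/setP => x; rewrite !inE /= t0 lexx. Qed.

Lemma release_le j x : release j.+1 x <= t j + 1.
Proof.
elim: j => [|j IH]; rewrite releaseS; case: ifP => // _.
  by rewrite /= t0 add0r ler01.
by rewrite (le_trans IH)// lerD2r ltW.
Qed.

Lemma release_between m j x : (m < j)%N ->
  (forall i, (m < i < j)%N -> ~~ admitted i) -> release j x = release m.+1 x.
Proof.
elim: j => // j IH; rewrite ltnS leq_eqVlt => /predU1P[->//|mj] na.
rewrite releaseS (negbTE (na j _)) ?mj ?ltnSn//= IH// => i /andP[mi ij].
by rewrite na// mi ltnW.
Qed.

Lemma next_admitted_exists m : exists j, [/\ (m < j)%N, admitted j &
  forall i, (m < i < j)%N -> ~~ admitted i].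
Proof.
have [j mj aj] : exists2 j, (m < j)%N & admitted j.
  have [j mj tj] : exists2 j, (m < j)%N & t m + 1 <= t j.
    have /cvgryPge /(_ (t m + 1)) [N _ NP] := t_cvg.
    exists (maxn N m.+1); first by rewrite leq_max ltnSn orbT.
    by apply: NP => /=; rewrite leq_maxl.
  have [[i [mi ij] ai]|na] := pselect (exists2 i, (m < i)%N /\ (i < j)%N & admitted i).
    by exists i.
  exists j => //; apply: idle_admitted; apply/setP => x; rewrite !inE.
  rewrite (@release_between m)// ?(le_trans (release_le _ _))// => i /andP[mi ij].
  by apply/negP => ai; apply: na; exists i.
have ex : exists j, (m < j)%N && admitted j by exists j; rewrite mj.
case: (ex_minnP ex) => k /andP[mk ak] kmin; exists k; split=> // i /andP[mi ik].
by apply/negP => ai; have := kmin i; rewrite mi ai leqNgt ik => /(_ isT).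
Qed.

Lemma next_admittedP m : [/\ (m < next_admitted m)%N, admitted (next_admitted m) &
  forall i, (m < i < next_admitted m)%N -> ~~ admitted i].
Proof.
rewrite /next_admitted; case: xgetP => [y _ []//|abs].
by have [j /abs] := next_admitted_exists m.
Qed.

Lemma next_admittedE m j : (next_admitted m = j) <-> [/\ (m < j)%N, admitted j &
  forall i, (m < i < j)%N -> ~~ admitted i].
Proof.
split=> [<-|[mj aj jmin]]; first exact: next_admittedP.
have [mk ak kmin] := next_admittedP m.
apply/eqP; rewrite eqn_leq; apply/andP; split; rewrite leqNgt; apply/negP => lt.
  by have := kmin j; rewrite mj lt aj => /(_ isT).
by have := jmin _ (introT andP (conj mk lt)); rewrite ak.
Qed.

Lemma admitted_index_lt i : (idx i < idx i.+1)%N.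
Proof. by have [] := next_admittedP (idx i). Qed.

Lemma admitted_admitted_index i : admitted (idx i).
Proof. by case: i => [|i]; [exact: admitted0|have [] := next_admittedP (idx i)]. Qed.

(** Arrival times increase strictly, so the number of arrivals in a half-open interval is a
    difference of indices. *)
Lemma admission_dataE i : admission_data accepts t c i =
  ((idx i.+1 - idx i)%N, t (idx i.+1) - t (idx i)).
Proof.
congr pair; rewrite /admission_time.
set A := [set j | _].
have -> : A = [set` [fset j in iota (idx i).+1 (idx i.+1 - idx i)]%fset].
  apply/seteqP; split=> j /=; rewrite /A /= !inE mem_iota addSn t_monolt t_mono.
    move=> [_ /andP[-> le]] /=; rewrite ltnS subnKC//.
    exact/ltnW/admitted_index_lt.
  rewrite ltnS subnKC; last exact/ltnW/admitted_index_lt.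
  by move=> /andP[lt ->]; rewrite lt; split=> //; case: j lt.
by rewrite set_fsetK card_fseq undup_id ?iota_uniq// size_iota.
Qed.

Lemma card_busy j u : (forall i, (i < j)%N -> t i <= u) -> 0 <= u ->
  #|[set x | u < release j x]%SET| =
  count (fun i => admitted i && (u < t i + 1)) (iota 0 j).
Proof.
move=> + u0; elim: j => [|j IH] tu.
  by rewrite /= eq_card0// => x; rewrite !inE /= ltNge u0.
rewrite -[in iota _ _]addn1 iotaD count_cat [count _ (iota (0 + j) 1)]/= addn0 add0n -IH; last first.
  by move=> i ij; apply: tu; rewrite ltnS ltnW.
have [aj|naj] := boolP (admitted j); last first.
  by rewrite addn0; apply: eq_card => x; rewrite !inE releaseS (negbTE naj).
rewrite (cardsD1 (c j)) addnC; congr addn; last first.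
  by rewrite inE releaseS aj eqxx.
apply: eq_card => x; rewrite !inE releaseS aj /=.
case: eqVneq => [->|]//=; apply/esym/negbTE; rewrite -leNgt.
by have := admitted_idle aj; rewrite inE => /le_trans; apply; apply: tu.
Qed.

Lemma count_admitted i (P : pred nat) :
  count (fun j => admitted j && P j) (iota 0 (idx i).+1) =
  count (fun l => P (idx l)) (iota 0 i.+1).
Proof.
elim: i => [|i IH]; first by rewrite /= admitted0.
have lt := admitted_index_lt i.
have count1 (Q : pred nat) m : count Q [:: m] = Q m by rewrite /= addn0.
have iotaS m : iota 0 m.+1 = iota 0 m ++ [:: m] by rewrite -[m.+1]addn1 iotaD.
rewrite [iota 0 i.+2]iotaS count_cat -IH count1.
rewrite iotaS count_cat count1 admitted_admitted_index.
congr addn; rewrite -{1}(subnKC lt) iotaD count_cat -[RHS]addn0; congr addn.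
have [_ _ na] := next_admittedP (idx i).
apply/eqP; rewrite -leqn0 leqNgt -has_count; apply/hasP => -[j].
by rewrite mem_iota add0n subnKC// => /na /negbTE ->.
Qed.

(** All services last one unit, so they end in the order of admission. Were a message older than the
    last [kappa] still in service, these would be too, and more than [kappa] channels would be
    busy. *)
Lemma card_busy_admitted i s : (kappa.-1 <= i)%N -> (0 < kappa)%N -> 0 <= s ->
  #|[set x | t (idx i) + s < release (idx i).+1 x]%SET| =
  count (fun m => s < 1 - (t (idx i) - t (idx (i - m)))) (iota 0 kappa).
Proof.
move=> ni k0 s0.
have iot : iota 0 i.+1 = iota 0 (i - kappa.-1) ++ iota (i - kappa.-1) kappa.
  rewrite -{2}[(i - _)%N]add0n -iotaD; congr iota.
  by rewrite -{2}(prednK k0) addnS subnK.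
pose Q l := t (idx i) + s < t (idx l) + 1.
have cE : #|[set x | t (idx i) + s < release (idx i).+1 x]%SET| =
    count Q (iota 0 i.+1).
  rewrite card_busy ?count_admitted//.
    move=> j; rewrite ltnS -t_mono => /le_trans; apply.
    by rewrite lerDl.
  by rewrite addr_ge0// -t0 t_mono.
have idx_mono : {homo idx : l m / (l <= m)%N}.
  by apply: homo_leq => // [x|l]; [exact: leq_trans|exact/ltnW/admitted_index_lt].
have Qmono l m : (l <= m)%N -> Q l -> Q m.
  by move=> lm /lt_le_trans; apply; rewrite lerD2r t_mono; apply: idx_mono.
have c0 : count Q (iota 0 (i - kappa.-1)) = 0%N.
  apply/eqP; rewrite -leqn0 leqNgt -has_count; apply/hasP => -[l].
  rewrite mem_iota add0n => li Ql.
  have : (count Q (iota 0 i.+1) <= kappa)%N.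
    by rewrite -cE (leq_trans (max_card _))// card_ord.
  rewrite iot count_cat.
  have -> : count Q (iota (i - kappa.-1) kappa) = kappa.
    rewrite -[RHS](size_iota (i - kappa.-1)); apply/eqP; rewrite -all_count.
    apply/allP => m; rewrite mem_iota => /andP[m1 _]; apply: Qmono Ql.
    by rewrite (leq_trans _ m1)// ltnW.
  rewrite -[X in (_ <= X)%N]add0n leq_add2r leqn0 => /eqP/eqP.
  rewrite -leqn0 leqNgt -has_count => /hasP; apply; exists l => //.
  by rewrite mem_iota add0n.
rewrite cE iot count_cat c0 add0n.
transitivity (count (Q \o (fun m => i - m)%N) (iota 0 kappa)); last first.
  by apply: eq_count => m; rewrite /Q /=; apply/idP/idP => ?; lra.
rewrite -[RHS]count_map.
suff /permP/(_ Q) : perm_eq (iota (i - kappa.-1) kappa)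
  [seq (i - m)%N | m <- iota 0 kappa] by [].
apply: uniq_perm; rewrite ?iota_uniq//.
  rewrite map_inj_in_uniq ?iota_uniq// => x y; rewrite !mem_iota.
  by clear -ni k0; lia.
move=> l; rewrite mem_iota; apply/idP/mapP => [ll|[m]].
  by exists (i - l)%N; rewrite ?mem_iota; clear -ni k0 ll; lia.
by rewrite mem_iota => mn ->; clear -ni k0 mn; lia.
Qed.

End path.

(** * Interarrival times of the Poisson process *)

(** Reduces the measurability of traces on [D] to generators, where [D] will be an event that bounds
    an arrival time or fixes an index. *)
Lemma sigma_algebra_setI d (T : measurableType d) (D : set T) : measurable D ->
  sigma_algebra setT [set H | measurable (D `&` H)].
Proof.
move=> mD; split => /= [|A mA|A mA].
- by rewrite setI0.
- have -> : D `&` (setT `\` A) = D `\` (D `&` A).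
    by rewrite setTD setDE setCI setIUr setICr set0U.
  exact: measurableD.
- by rewrite setI_bigcupr; exact: bigcupT_measurable.
Qed.

Section poisson.
Context d (Omega : measurableType d) (R : realType) (P : probability Omega R).
Variables (lambda : R) (T : nat -> {RV P >-> R}).
Hypothesis lambda_gt0 : 0 < lambda.
Hypothesis HT : poisson_arrivals lambda T.

Definition void (B : set R) : set Omega :=
  [set w | forall j, (0 < j)%N -> ~ B (T j w)].

Lemma arrivals_mono w : {mono (fun j => T j w) : i j / (i <= j)%N >-> i <= j}.
Proof. by apply: Order.NatMonotonyTheory.incnP => j; exact: (arrival_lt HT). Qed.

Lemma arrivals_monolt w : {mono (fun j => T j w) : i j / (i < j)%N >-> i < j}.
Proof. exact/leW_mono/arrivals_mono. Qed.

Lemma arrivals_ge0 w j : 0 <= T j w.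
Proof. by rewrite -(arrival0 HT w) arrivals_mono. Qed.

Lemma measurable_void (B : set R) : measurable B -> measurable (void B).
Proof.
move=> mB.
have -> : void B = \bigcap_(j in [set j | (0 < j)%N]) (~` (T j @^-1` B)) by [].
apply: bigcap_measurable => //; first by exists 1%N.
by move=> j _; apply: measurableC; rewrite -[X in measurable X]setTI; exact: measurable_funPT.
Qed.

Lemma voidU (A B : set R) : void A `&` void B = void (A `|` B).
Proof.
apply/seteqP; split=> w /=; first by move=> [a b] j j0 [/a|/b]; apply.
by move=> h; split=> j j0 ?; apply: (h j j0); [left|right].
Qed.

Lemma prob_void (B : set R) : measurable B -> B `<=` `]0, +oo[ ->
  (lebesgue_measure B < +oo)%E ->
  P (void B) = (expR (- (lambda * fine (lebesgue_measure B))))%:E.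
Proof.
move=> mB B0 Boo.
have := @arrival_counts _ _ _ _ _ _ HT 1 (fun=> B) (fun=> 0%N) (fun=> mB)
  (fun=> B0) (fun=> Boo).
rewrite big_ord1 /= expr0 fact0 invr1 !mul1r => <-.
  congr (P _); apply/seteqP; split=> w /=.
    move=> v i _; rewrite /has_points /= II0 card_eq0; apply/eqP/seteqP; split=> // j.
    by move=> [/v].
  move=> /(_ ord0 I); rewrite /has_points /= II0 card_eq0 => /eqP v j j0 Bj.
  by have : set0 j by rewrite -v.
by move=> i j _ _ _; rewrite !ord1.
Qed.

(* Since a family of void events is stable under intersection, the counting laws
   of void events alone determine the joint law of past and future arrivals. *)
Definition voids q : set (set Omega) :=
  [set void B | B in [set B : set R | measurable B /\ B `<=` `]0, q]]].

Lemma voids_measurable q : voids q `<=` measurable.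
Proof. by move=> _ [B [mB _] <-]; exact: measurable_void. Qed.

(** On the generators, two void events intersect in the void event of a disjoint union; Lebesgue
    measures add, so the exponential factorises. Both sides are finite measures in [G], and the
    pi-system carries the identity over to the generated sigma-algebra. *)
Lemma voids_indep q s G : 0 <= q -> 0 <= s -> <<s voids q >> G ->
  P (G `&` void `]q, q + s]) = (P G * (expR (- (lambda * s)))%:E)%E.
Proof.
move=> q0 s0 sG.
have mv : measurable (void `]q, q + s]) by apply: measurable_void.
have e0 : 0 <= expR (- (lambda * s)) by exact: expR_ge0.
rewrite muleC; have := @g_sigma_algebra_measure_unique _ _ _ (voids q)
  (@voids_measurable q) (fun=> setT) _ _ (mrestr P mv)
  (mscale (NngNum e0) P) _ _ _ G sG.
apply.
- move=> _; exists set0; first by split => // x.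
  by apply/seteqP; split=> w _ // j _ [].
- by rewrite bigcup_const.
- move=> _ _ [A [mA Aq] <-] [B [mB Bq] <-]; rewrite voidU; exists (A `|` B) => //.
  by split; [exact: measurableU|rewrite subUset].
- move=> _ [B [mB Bq] <-]; rewrite /= /mrestr /mscale /= voidU.
  have Boo : (lebesgue_measure B < +oo)%E.
    apply: (@le_lt_trans _ _ (lebesgue_measure (`]0%R, q]%classic : set R))).
      by apply: le_measure => //; rewrite inE.
    by rewrite lebesgue_measure_itv /=; case: ifP => _; rewrite -?EFinB ltry.
  have leb : lebesgue_measure `]q, q + s] = s%:E.
    rewrite lebesgue_measure_itv /= lte_fin ltrDl; case: ltP => [_|s0'].
      by rewrite -EFinB addrAC subrr add0r.
    by congr EFin; apply/eqP; rewrite eq_le s0 s0'.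
  have LU : lebesgue_measure (B `|` `]q, q + s]) = (lebesgue_measure B + s%:E)%E.
    rewrite -leb measureU//; apply/seteqP; split=> // x [/Bq].
    by rewrite /= !in_itv /= => /andP[_ xq] /andP[/(le_lt_trans xq)]; rewrite ltxx.
  rewrite prob_void ?LU//; last 3 first.
  - exact: measurableU.
  - rewrite subUset; split=> x.
      by move=> /Bq; rewrite /= !in_itv /= => /andP[->].
    by rewrite /= !in_itv /= => /andP[/(le_lt_trans q0) ->].
  - by rewrite lte_add_pinfty// ltry.
  have PB : P (void B) = (expR (- (lambda * fine (lebesgue_measure B))))%:E.
    by rewrite prob_void// => x /Bq; rewrite /= !in_itv /= => /andP[->].
  rewrite [RHS](_ : _ = (expR (- (lambda * s)))%:E * P (void B))%E// PB fineD//.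
    by rewrite -EFinM -expRD mulrDr opprD addrC.
  by rewrite ge0_fin_numE.
- by move=> _; rewrite /= /mrestr (le_lt_trans (probability_le1 _ _)) ?ltry//; exact: measurableI.
Qed.

Definition past_times J : set (set Omega) :=
  \bigcup_(j in [set j | (j <= J)%N]) g_sigma_algebra_preimage (T j).

(** [T j.+1 <= a] holds iff for some rational [r], [T j <= r] and []r, a]] contains a point. The
    test in [F] keeps [r] below [q], where the induction hypothesis applies. *)
Lemma voids_le q j a : 0 <= q -> a <= q -> <<s voids q >> [set w | T j w <= a].
Proof.
move=> q0; elim: j a => [|j IH] a aq.
  pose V : measurableType _ := g_sigma_algebraType (voids q).
  have [a0|a0] := leP 0 a.
    rewrite (_ : [set _ | _] = setT); first exact: (@measurableT _ V).
    by apply/seteqP; split=> // w _ /=; rewrite (arrival0 HT).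
  rewrite (_ : [set _ | _] = set0); first exact: (@measurable0 _ V).
  by apply/seteqP; split=> // w /=; rewrite (arrival0 HT) leNgt a0.
pose V : measurableType _ := g_sigma_algebraType (voids q).
pose F (r : rat) : set Omega := if (ratr r : R) <= q then
  [set w | T j w <= ratr r] `&` ~` void (`]0, +oo[ `&` `]ratr r, a]) else set0.
have -> : [set w | T j.+1 w <= a] = \bigcup_r F r.
  apply/seteqP; split=> w /=.
    move=> Ta.
    have /rat_in_itvoo[r] := arrival_lt HT w j; rewrite in_itv /= => /andP[jr rj].
    exists r => //; rewrite /F ifT; last by rewrite (le_trans _ aq)// (le_trans (ltW rj)).
    split; first by rewrite /= ltW.
    move=> /(_ j.+1 isT); apply; rewrite /= !in_itv /= andbT rj Ta.
    by split=> //; rewrite (le_lt_trans _ rj)// (le_trans _ (ltW jr))// arrivals_ge0.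
  move=> [r _]; rewrite /F; case: ifP => // rq [/= Tr].
  move=> /existsNP[l] /not_implyP[l0] /contrapT [_]; rewrite /= in_itv /= => /andP[rl la].
  by rewrite (le_trans _ la)// arrivals_mono -(arrivals_monolt w) (le_lt_trans Tr rl).
apply: (@bigcupT_measurable_rat _ V) => r; rewrite /F; case: ifPn => rq; last exact: (@measurable0 _ V).
apply: (@measurableI _ V); first exact: IH.
apply: (@measurableC _ V); apply: sub_sigma_algebra.
exists (`]0, +oo[ `&` `]ratr r, a]) => //; split; first exact: measurableI.
by move=> x []; rewrite /= !in_itv /= andbT => -> /andP[_ /le_trans]; apply.
Qed.

Lemma past_times_measurable J : <<s past_times J >> `<=` measurable.
Proof.
apply: smallest_sub; first exact: sigma_algebra_measurable.
by move=> _ [j _ [B mB <-]]; exact: measurable_funPT.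
Qed.

Lemma past_times_voids J q H : 0 <= q -> <<s past_times J >> H ->
  <<s voids q >> ([set w | T J w <= q] `&` H).
Proof.
move=> q0; pose V : measurableType _ := g_sigma_algebraType (voids q).
have mJ : measurable ([set w | T J w <= q] : set V) by exact: voids_le.
move: H; apply: (@smallest_sub _ (sigma_algebra setT) (past_times J)
  [set H | <<s voids q >> ([set w | T J w <= q] `&` H)]).
  exact: (@sigma_algebra_setI _ V).
move=> _ [j /= jJ [B mB <-]].
suff : measurable_fun ([set w | T J w <= q] : set V) (T j : V -> R).
  by move=> /(_ mJ B mB); rewrite setTI.
apply: (measurability _ (RGenOInfty.measurableE R)).
move=> _ [_ [x ->] <-].
(* On the event [T J w <= q] also [T j w <= q], so the bound [x] may be lowered to [Num.min x q],
   within reach of [voids_le]. *)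
have -> : [set w | T J w <= q] `&` T j @^-1` `]x, +oo[ =
   [set w | T J w <= q] `\` [set w | T j w <= Num.min x q].
  apply/seteqP; split=> w /=; rewrite in_itv /= andbT.
    by move=> [-> xT]; split=> //; rewrite le_min leNgt xT.
  move=> [Tq /negP]; rewrite le_min negb_and -!ltNge => /orP[->//|].
  by move=> /(le_lt_trans Tq); rewrite arrivals_monolt ltnNge jJ.
by apply: (@measurableD _ V) => //; apply: voids_le => //; rewrite ge_min lexx orbT.
Qed.

End poisson.

Section interarrival.
Context d (Omega : measurableType d) (R : realType) (P : probability Omega R).
Variables (lambda : R) (T : nat -> {RV P >-> R}).
Hypothesis lambda_gt0 : 0 < lambda.
Hypothesis HT : poisson_arrivals lambda T.
Variable J : nat.

Let E w : R := T J.+1 w - T J w.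
Let delta n : R := n.+1%:R^-1.
(* The interval (T_J, T_J + s] is approximated from the cell of a grid of
   mesh [delta n] that contains T_J. *)
Let cell n k : set Omega := [set w | k%:R * delta n <= T J w < k.+1%:R * delta n].

Let delta_gt0 n : 0 < delta n. Proof. by rewrite invr_gt0. Qed.

Let measurable_E : measurable_fun setT E.
Proof. by apply: measurable_funB; exact: measurable_funPT. Qed.

Let measurable_Eo x : measurable [set w | x < E w].
Proof.
rewrite (_ : [set _ | _] = setT `&` E @^-1` `]x, +oo[); first exact: measurable_E.
by rewrite setTI; apply/seteqP; split=> w /=; rewrite in_itv /= andbT.
Qed.

Let past_cell n k : <<s past_times T J >> (cell n k).
Proof.
apply: sub_sigma_algebra; exists J => //=.
exists `[k%:R * delta n, k.+1%:R * delta n[%classic => //.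
by rewrite setTI; apply/seteqP; split=> w /=; rewrite in_itv.
Qed.

Let cell_cover n w : exists k, cell n k w.
Proof.
exists (Num.truncn (T J w / delta n)).
rewrite /cell /= -ler_pdivlMr// -ltr_pdivrMr//; apply: truncn_itv.
by rewrite divr_ge0 ?(arrivals_ge0 HT)// ltW.
Qed.

Let prob_cell n A : measurable A -> P A = (\sum_(k <oo) P (A `&` cell n k))%E.
Proof.
move=> mA; rewrite -measure_semi_bigcup//=.
- rewrite -setI_bigcupr (_ : \bigcup_k _ = setT) ?setIT//.
  by apply/seteqP; split=> // w _; have [k ?] := cell_cover n w; exists k.
- by move=> k; apply: measurableI => //; exact: past_times_measurable.
- apply/trivIsetP => i j _ _ ij; apply/seteqP; split=> // w [[_ wi] [_ wj]].
  move/eqP: ij; apply; move: wi wj => /= /andP[i1 i2] /andP[j1 j2].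
  have := le_lt_trans i1 j2; have := le_lt_trans j1 i2.
  by rewrite !ltr_pM2r// !ltr_nat !ltnS => ji ij; apply/eqP; rewrite eqn_leq ij.
- by apply: bigcupT_measurable => k; apply: measurableI => //; exact: past_times_measurable.
Qed.

Let prob_cell_void n k H s : 0 <= s -> <<s past_times T J >> H ->
  let q := k.+1%:R * delta n in
  P (H `&` cell n k `&` void T `]q, q + s]) =
  (P (H `&` cell n k) * (expR (- (lambda * s)))%:E)%E.
Proof.
move=> s0 sH q; have q0 : 0 <= q by rewrite mulr_ge0// ltW.
apply: (voids_indep HT) => //.
have -> : H `&` cell n k = [set w | T J w <= q] `&` (H `&` cell n k).
  by apply/seteqP; split=> w /= [] // Hw /[dup] c /andP[_ /ltW].
apply: (past_times_voids HT) => //.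
pose F : measurableType _ := g_sigma_algebraType (past_times T J).
by apply: (@measurableI _ F) => //; exact: past_cell.
Qed.

Let prob_discrete n H s : 0 <= s -> <<s past_times T J >> H ->
  (P H * (expR (- (lambda * s)))%:E)%E = (\sum_(k <oo)
    P (H `&` cell n k `&` void T `](k.+1%:R * delta n)%R, (k.+1%:R * delta n + s)%R]))%E.
Proof.
move=> s0 sH; rewrite (prob_cell n (past_times_measurable sH)) muleC -nneseriesZl//.
by apply: eq_eseriesr => k _; rewrite muleC prob_cell_void.
Qed.

(** The right end of the cell is at most [delta n] after [T J]: a gap exceeding [s + delta n] leaves
    the interval of length [s] after the cell void. *)
Let prob_gt_le n H s : 0 <= s -> <<s past_times T J >> H ->
  (P (H `&` [set w | (s + delta n < E w)%R]) <= P H * (expR (- (lambda * s)))%:E)%E.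
Proof.
move=> s0 sH; have mH := past_times_measurable sH; rewrite (prob_discrete n)//.
rewrite (prob_cell n (measurableI _ _ mH (measurable_Eo _))).
apply: lee_nneseries => // k _; apply: le_measure; rewrite ?inE.
- by apply: measurableI; [exact: measurableI|exact: past_times_measurable].
- by apply: measurableI; [apply: measurableI => //; exact: past_times_measurable|exact: measurable_void].
move=> w /= [[Hw Ew] /[dup] cw /andP[k1 k2]]; split=> // j j0.
rewrite /= in_itv /= => /andP[q1 q2].
have Jj : (J < j)%N by rewrite -(arrivals_monolt HT w) (lt_trans k2 q1).
have Jj1 : T J.+1 w <= T j w by rewrite (arrivals_mono HT).
move: Ew k1 q2; rewrite /E -[in k.+1]addn1 natrD mulrDl mul1r => *; lra.
Qed.

(** Conversely, a void interval after the cell forces a gap exceeding [s], unless the next point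
    falls into the cell itself; then the gap is at most [delta n]. *)
Let prob_le_gt n H s : 0 <= s -> <<s past_times T J >> H ->
  (P H * (expR (- (lambda * s)))%:E <=
   P (H `&` [set w | (s < E w)%R]) + P (~` [set w | (delta n < E w)%R]))%E.
Proof.
move=> s0 sH; have mH := past_times_measurable sH; rewrite (prob_discrete n)//.
have mA : measurable (H `&` [set w | (s < E w)%R]) by apply: measurableI.
have mB : measurable (~` [set w | (delta n < E w)%R]) by exact: measurableC.
apply: le_trans (measureU2 P mA mB : P _ <= P _ + P _)%E.
rewrite (prob_cell n (measurableU _ _ mA mB)).
apply: lee_nneseries => // k _; apply: le_measure; rewrite ?inE.
- by apply: measurableI; [apply: measurableI => //; exact: past_times_measurable|exact: measurable_void].
- by apply: measurableI; [exact: measurableU|exact: past_times_measurable].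
move=> w /= [[Hw /[dup] cw /andP[k1 k2]]] vw; split=> //.
have [dE|Ed] := ltP (delta n) (E w); [left|by right].
split=> //; rewrite ltNge; apply/negP => Es; apply: (vw J.+1 isT).
rewrite /= in_itv /=; apply/andP; split.
  by move: dE k1; rewrite /E -[in k.+1]addn1 natrD mulrDl mul1r => *; lra.
by move: Es k2; rewrite /E => *; lra.
Qed.

(** The memoryless property at the random time [T J], obtained as the mesh tends to 0. The error
    term vanishes because arrival times increase strictly: the events [E <= delta n] decrease to the
    empty set. *)
Lemma interarrival_gt H s : 0 <= s -> <<s past_times T J >> H ->
  P (H `&` [set w | s < E w]) = (P H * (expR (- (lambda * s)))%:E)%E.
Proof.
move=> s0 sH; have mH := past_times_measurable sH.
have dlt x : 0 < x -> exists n, delta n < x.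
  move=> x0; have := near_infty_natSinv_lt (PosNum x0) => -[N _ /(_ N (leqnn N))].
  by exists N.
have dmono n m : (n <= m)%N -> delta m <= delta n.
  by move=> nm; rewrite lef_pV2 ?posrE// ler_nat.
apply/eqP; rewrite eq_le; apply/andP; split.
  have cv : P (H `&` [set w | s + delta n < E w]) @[n --> \oo] -->
      P (H `&` [set w | s < E w]).
    have -> : H `&` [set w | s < E w] = \bigcup_n (H `&` [set w | s + delta n < E w]).
      rewrite -setI_bigcupr; congr (_ `&` _); apply/seteqP; split=> w /=.
        rewrite -subr_gt0 => /dlt[n nd]; exists n => //=; lra.
      by move=> [n _] /=; apply: le_lt_trans; rewrite lerDl ltW.
    apply: nondecreasing_cvg_mu.
    - by move=> n; exact: measurableI.
    - by apply: bigcupT_measurable => n; exact: measurableI.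
    - move=> n m nm; apply/subsetPset => w /= [Hw]; split=> //.
      by have := dmono _ _ nm; lra.
  rewrite -(cvg_lim _ cv)//; apply: lime_le; first by apply/cvg_ex; eexists; exact: cv.
  by apply: nearW => n; exact: prob_gt_le.
have cv : P (~` [set w | delta n < E w]) @[n --> \oo] --> 0%E.
  have -> : 0%E = P (\bigcap_n ~` [set w | delta n < E w]).
    rewrite (_ : \bigcap_n _ = set0) ?measure0//; apply/seteqP; split=> // w h.
    have : 0 < E w by rewrite subr_gt0 (arrival_lt HT).
    by move=> /dlt[n nE]; exact: (h n I).
  apply: nonincreasing_cvg_mu.
  - by rewrite (le_lt_trans (probability_le1 _ _)) ?ltry//; exact: measurableC.
  - by move=> n; exact: measurableC.
  - by apply: bigcapT_measurable => n; exact: measurableC.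
  - move=> n m nm; apply/subsetPset => w /=; apply: contra_not.
    by apply: le_lt_trans; exact: dmono.
have cv2 := cvgeD _ (cvg_cst (P (H `&` [set w | s < E w]))) cv.
rewrite -[leRHS]adde0 -(cvg_lim _ (cv2 _ _ _))//; last first.
  by rewrite adde_defC fin_num_adde_defr.
apply: lime_ge.
  by apply/cvg_ex; eexists; apply: cv2; rewrite adde_defC fin_num_adde_defr.
by apply: nearW => n; exact: prob_le_gt.
Qed.

End interarrival.

(** * The past with marks, and its independence of the next message *)

Section marks.
Context d (Omega : measurableType d) (R : realType) (P : probability Omega R).
Variables (lambda : R) (T : nat -> {RV P >-> R}).
Hypothesis lambda_gt0 : 0 < lambda.
Hypothesis HT : poisson_arrivals lambda T.
Variables (q : nat) (M : nat -> Omega -> 'I_q).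
Hypothesis HM : uniform_choices T M.

Definition past J : set (set Omega) := past_times T J `|`
  [set A | exists2 j, (j <= J)%N & exists c, A = [set w | M j w = c]].

Lemma past_measurable J : <<s past J >> `<=` measurable.
Proof.
apply: smallest_sub; first exact: sigma_algebra_measurable.
move=> _ [[j _ [B mB <-]]|[j _ [c ->]]]; first exact: measurable_funPT.
exact: (choice_measurable HM).
Qed.

Lemma sub_past J K : (J <= K)%N -> <<s past J >> `<=` <<s past K >>.
Proof.
move=> JK; apply: smallest_sub; first exact: smallest_sigma_algebra.
move=> A GA; apply: sub_sigma_algebra; case: GA => [[j jJ [B mB <-]]|[j jJ [c]]]; first last.
  by move=> ->; right; exists j; [exact: leq_trans JK|exists c].
by left; exists j; [exact: leq_trans JK|exists B].
Qed.

Lemma past_time J j : (j <= J)%N ->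
  measurable_fun [set: g_sigma_algebraType (past J)] (T j : _ -> R).
Proof.
by move=> jJ _ B mB; apply: sub_sigma_algebra; left; exists j => //; exists B.
Qed.

Lemma past_mark J j c : (j <= J)%N -> <<s past J >> [set w | M j w = c].
Proof. by move=> jJ; apply: sub_sigma_algebra; right; exists j => //; exists c. Qed.

Section one_step.
Variable J : nat.
Let E w : R := T J.+1 w - T J w.

Let measurable_E : measurable_fun [set: Omega] (E : Omega -> measurableTypeR R).
Proof. by apply: measurable_funB; exact: measurable_funPT. Qed.

Lemma interarrival_law H (B : set R) : <<s past_times T J >> H -> measurable B ->
  P (H `&` E @^-1` B) = (P H * expo lambda_gt0 B)%E.
Proof.
move=> sH mB; have mH := past_times_measurable sH.
have PH0 : 0 <= fine (P H) by rewrite fine_ge0.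
pose nu : {measure set (measurableTypeR R) -> \bar R} :=
  image_measure (mrestr P mH) measurable_E.
have PHE : P H = (fine (P H))%:E by rewrite fineK// fin_num_measure.
rewrite setIC PHE -[LHS]/(nu B).
apply: (@expo_unique _ _ lambda_gt0 nu (NngNum PH0)) => //.
- move=> s s0; rewrite EFinM -PHE -(interarrival_gt HT s0 sH) setIC.
  rewrite -[LHS]/(P (E @^-1` `]s, +oo[ `&` H)).
  by congr (P (_ `&` _)); apply/seteqP; split=> w /=; rewrite in_itv /= andbT.
- rewrite -[LHS]/(P (E @^-1` `]-oo, 0] `&` H)) (_ : _ @^-1` _ = set0).
    by rewrite set0I measure0.
  apply/seteqP; split=> // w /=; rewrite in_itv /= leNgt /E subr_gt0.
  by rewrite (arrival_lt HT).
Qed.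

Let marks (c : {ffun 'I_J.+1 -> 'I_q}) : set Omega :=
  \bigcap_(j in [set: 'I_J.+1]) [set w | M j w = c j].

Let prob_marks H (B : set R) c c' : <<s past_times T J >> H -> measurable B ->
  P (H `&` marks c `&` (E @^-1` B `&` [set w | M J.+1 w = c'])) =
  (P (H `&` marks c) * (q%:R^-1%:E * expo lambda_gt0 B))%E.
Proof.
move=> sH mB.
have sall : <<s past_times T J >> `<=` <<s \bigcup_j g_sigma_algebra_preimage (T j) >>.
  apply: smallest_sub; first exact: smallest_sigma_algebra.
  by move=> A [j _ HA]; apply: sub_sigma_algebra; exists j.
have Mc := @choice_indep _ _ _ _ _ _ _ HM H J.+1 c (sall _ sH).
pose A : measurableType _ := g_sigma_algebraType (\bigcup_j g_sigma_algebra_preimage (T j)).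
have mT j : measurable_fun [set: A] (T j : A -> R).
  by move=> _ U mU; apply: sub_sigma_algebra; exists j => //; exists U.
have sHE : <<s \bigcup_j g_sigma_algebra_preimage (T j) >> (H `&` E @^-1` B).
  apply: (@measurableI _ A); first exact: sall.
  rewrite -[X in _ X]setTI.
  have mE : measurable_fun [set: A] E by apply: measurable_funB.
  exact: mE.
(* [c2] appends [c'] to the prescribed marks: [choice_indep] is used once for [J.+1] marks and once
   for [J.+2]. *)
pose c2 (j : 'I_J.+2) := if unlift ord_max j is Some i then c i else c'.
have Mc2 := @choice_indep _ _ _ _ _ _ _ HM _ J.+2 c2 sHE.
have -> : H `&` marks c `&` (E @^-1` B `&` [set w | M J.+1 w = c']) =
    H `&` E @^-1` B `&` \bigcap_(j in [set: 'I_J.+2]) [set w | M j w = c2 j].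
  rewrite setIACA; congr (_ `&` _); apply/seteqP; split=> w /=.
    move=> [mc mc'] j _ /=; rewrite /c2; case: unliftP => [i ->|->] //=.
    by rewrite /bump leqNgt ltn_ord; apply: mc.
  move=> h; split=> [i _|] /=.
    have := h (lift ord_max i) I; rewrite /c2 liftK /= /bump leqNgt ltn_ord.
    by [].
  by have := h ord_max I; rewrite /c2 unlift_none.
rewrite [LHS]Mc2 (Mc : P (H `&` marks c) = _) interarrival_law//.
under eq_bigr do rewrite (choice_uniform HM).
under [in RHS]eq_bigr do rewrite (choice_uniform HM).
rewrite big_ord_recr /= muleACA; congr (_ * _)%E; exact: muleC.
Qed.

(** Rectangles that prescribe all the marks up to [J]. Two of them prescribe the same marks or are
    disjoint, whence a pi-system, on which independence is [prob_marks]. They generate the past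
    because finitely many mark vectors cover [Omega]. *)
Let G0 : set (set Omega) :=
  [set A | exists H c, <<s past_times T J >> H /\ A = H `&` marks c].

Let sub_past_G0 : <<s past J >> `<=` <<s G0 >>.
Proof.
pose Y : measurableType _ := g_sigma_algebraType G0.
have all_marks w : exists c, marks c w.
  by exists [ffun j : 'I_J.+1 => M j w] => j _ /=; rewrite ffunE.
have union (A : set Omega) : (forall c, <<s G0 >> (A `&` marks c)) -> <<s G0 >> A.
  move=> Ac; rewrite (_ : A = \bigcup_(c in [set: {ffun 'I_J.+1 -> 'I_q}]) (A `&` marks c)).
    by apply: (@fin_bigcup_measurable _ Y) => // c _; exact: Ac.
  apply/seteqP; split=> [w Aw|w [c _ []]//].
  by have [c mc] := all_marks w; exists c.
apply: smallest_sub; first exact: smallest_sigma_algebra.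
move=> A [GA|[j jJ [c ->]]]; apply: union => c'.
  by apply: sub_sigma_algebra; exists A, c'; split; [exact: sub_sigma_algebra|].
have -> : [set w | M j w = c] `&` marks c' =
    (if c' (inord j) == c then setT else set0) `&` marks c'.
  apply/seteqP; split=> w /= [] + mc; have := mc (inord j) I; rewrite /= inordK//.
    by move=> -> ->; rewrite eqxx.
  by move=> ->; case: eqP.
apply: sub_sigma_algebra.
exists (if c' (inord j) == c then setT else set0), c'; split=> //.
pose F : measurableType _ := g_sigma_algebraType (past_times T J).
by case: ifP => _; [exact: (@measurableT _ F)|exact: (@measurable0 _ F)].
Qed.

Lemma past_indep G (B : set R) c : <<s past J >> G -> measurable B ->
  P (G `&` (E @^-1` B `&` [set w | M J.+1 w = c])) =
  (P G * (q%:R^-1%:E * expo lambda_gt0 B))%E.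
Proof.
move=> /sub_past_G0 sG mB.
have mD : measurable (E @^-1` B `&` [set w | M J.+1 w = c]).
  apply: measurableI; last exact: (choice_measurable HM).
  by rewrite -[X in measurable X]setTI; apply: measurable_E.
have mmarks c' : measurable (marks c').
  by apply: fin_bigcap_measurable => // j _; exact: (choice_measurable HM).
have r0 : 0 <= q%:R^-1 * fine (expo lambda_gt0 B).
  by rewrite mulr_ge0// fine_ge0.
have rE : (q%:R^-1%:E * expo lambda_gt0 B)%E = (q%:R^-1 * fine (expo lambda_gt0 B))%:E.
  by rewrite EFinM fineK// fin_num_measure.
rewrite muleC rE.
(* A countable cover of [Omega] by generators, as uniqueness of measures requires: the finitely many
   mark vectors, enumerated by [pickle] and padded with the empty set. *)
pose g n := if (choice.unpickle n : option {ffun 'I_J.+1 -> 'I_q}) is Some c' then marks c' else set0.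
have G0m : G0 `<=` measurable.
  by move=> _ [H [c' [sH ->]]]; apply: measurableI => //; exact: past_times_measurable sH.
pose F : measurableType _ := g_sigma_algebraType (past_times T J).
apply: (@g_sigma_algebra_measure_unique _ _ _ G0 G0m g _ _
   (mrestr P mD) (mscale (NngNum r0) P)) => //.
- move=> n; rewrite /g; case: choice.unpickle => [c'|].
    by exists setT, c'; rewrite setTI; split => //; exact: (@measurableT _ F).
  exists set0, [ffun => c]; rewrite set0I; split => //; exact: (@measurable0 _ F).
- apply/seteqP; split=> // w _; pose c' := [ffun j : 'I_J.+1 => M j w].
  by exists (choice.pickle c') => //; rewrite /g choice.pickleK => j _ /=; rewrite ffunE.
- move=> _ _ [H [a [sH ->]]] [K [b [sK ->]]].
  have [<-|ab] := eqVneq a b.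
    exists (H `&` K), a; rewrite setIACA setIid; split=> //.
    exact: (@measurableI _ F).
  exists set0, a; rewrite set0I; split; first exact: (@measurable0 _ F).
  apply/seteqP; split=> // w /= [[_ ma] [_ mb]]; move/eqP: ab; apply.
  by apply/ffunP => j; rewrite -(ma j I) -(mb j I).
- move=> _ [H [a [sH ->]]].
  rewrite -[RHS]/((q%:R^-1 * fine (expo lambda_gt0 B))%:E * P (H `&` marks a))%E.
  by rewrite -rE muleC; exact: prob_marks.
- move=> n; rewrite /mrestr (le_lt_trans (probability_le1 _ _)) ?ltry//.
  apply: measurableI => //; rewrite /g; case: choice.unpickle => [c'|] //.
Qed.

Let Y : measurableType _ := g_sigma_algebraType (past J).

(** Integral form of [past_indep]: on the event that the next mark is [c], the past and the
    interarrival time have a product law, to which Tonelli's theorem applies. *)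
Lemma one_step (h : Y * measurableTypeR R -> \bar R) c :
  measurable_fun [set: Y * measurableTypeR R] h -> (forall z, 0 <= h z)%E ->
  (\int[P]_w (h (w, E w) * (\1_[set w | M J.+1 w = c] w)%:E) =
   q%:R^-1%:E * \int[P]_w \int[expo lambda_gt0]_u h (w, u))%E.
Proof.
move=> mh h0.
(* The identity only changes the sigma-algebra, from that of [Omega] to that of the past;
   conditioning on the past is expressed in this way. *)
have mid : measurable_fun [set: Omega] (id : Omega -> Y).
  by move=> _ A mA; rewrite setTI; exact: (past_measurable mA).
have mYE : measurable_fun [set: Omega] (fun w => (w : Y, E w : measurableTypeR R)).
  by apply/measurable_fun_pairP; split.
have q0 : 0 <= q%:R^-1 :> R by [].
have mD : measurable [set w | M J.+1 w = c] by exact: (choice_measurable HM).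
have mI : measurable_fun [set: Omega] (\1_[set w | M J.+1 w = c] : Omega -> R).
  exact: measurable_indic.
have I0 w : 0 <= \1_[set w | M J.+1 w = c] w :> R by [].
pose mu1 : {measure set _ -> \bar R} := image_measure (mdensity P mI I0) mYE.
pose mu2 : {finite_measure set _ -> \bar R} := mscale (NngNum q0) (image_measure P mid).
transitivity (\int[mu1]_z h z)%E.
  rewrite integral_image_measure// integral_mdensity//.
  exact: measurableT_comp.
transitivity (\int[mu2 \x expo lambda_gt0]_z h z)%E.
  apply: eq_measure_integral => A mA _; apply/esym.
  apply: product_measure_unique A mA => A B mA mB.
  have -> : mu1 (A `*` B) = P (A `&` (E @^-1` B `&` [set w | M J.+1 w = c])).
    transitivity (\int[P]_(w in (fun w => (w : Y, E w)) @^-1` (A `*` B))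
        (\1_[set w | M J.+1 w = c] w)%:E)%E; first by [].
    rewrite integral_indic//; first by rewrite setIC setIA.
    by rewrite -[X in measurable X]setTI; apply: (mYE measurableT); exact: measurableX.
  rewrite past_indep// muleCA.
  by rewrite -[RHS]muleA; congr (_ * _)%E.
have mF := @measurable_fun_fubini_tonelli_F _ _ _ _ _ (expo lambda_gt0) h mh h0.
rewrite fubini_tonelli1// ge0_integral_mscale//; last first.
  by move=> w _; exact: integral_ge0.
by rewrite integral_image_measure// => w; exact: integral_ge0.
Qed.

End one_step.
End marks.

(** * Thinning with a time-dependent rejection probability *)

Section thinning.
Context (R : realType) (lambda : R).
Hypothesis lambda_gt0 : 0 < lambda.
Variables p P : R -> R.
Hypothesis mp : measurable_fun [set: R] p.
Hypothesis mP : measurable_fun [set: R] P.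
Hypothesis p_ge0 : forall u, 0 <= p u.
Hypothesis p_le1 : forall u, p u <= 1.
Local Notation mu := (@lebesgue_measure R).
(** [P] is a primitive of [p] in the integral sense, as suits the step functions [reject_prob],
    which jump at the thresholds. *)
Hypothesis PE : forall a b : R, a <= b ->
  (\int[mu]_u (p u * (a <= u <= b)%R%:R)%:E = (P b - P a)%:E)%E.

Lemma P_mono a b : a <= b -> P a <= P b.
Proof.
move=> ab; rewrite -subr_ge0 -lee_fin -PE//.
by apply: integral_ge0 => u _; rewrite lee_fin mulr_ge0.
Qed.

Let g s k u : R := (P s - P u) ^+ k / k`!%:R.

Let mg s k : measurable_fun [set: R] (g s k).
Proof.
by apply: measurable_funM => //; apply: measurable_funX; apply: measurable_funB.
Qed.

Let mind (a b : R) : measurable_fun [set: R] (fun u => (a <= u <= b)%R%:R : R).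
Proof.
by apply: measurable_natb; apply: measurable_and; exact: measurable_fun_ler.
Qed.

Let mpi a b : measurable_fun [set: R] (fun v => p v * (a <= v <= b)%R%:R : R).
Proof. exact: measurable_funM. Qed.

Let mpgi s k a b :
  measurable_fun [set: R] (fun v => p v * g s k v * (a <= v <= b)%R%:R : R).
Proof. by apply: measurable_funM => //; exact: measurable_funM. Qed.

(** The power rule for a merely measurable [p]. Let [X] be the integral for [k.+1]. Expanding its
    inner factor by the induction hypothesis and exchanging the integrals gives [p v * g s k v] with
    the weight [P v - P a]. Reducing [g s k.+1] to [g s k] instead gives [k.+1] times [X] with the
    weight [P s - P v]. The weights add up to the constant [P s - P a], which determines [k.+2]
    times [X]. *)
Lemma iterated_integral k a s : a <= s ->
  (\int[mu]_u (p u * g s k u * (a <= u <= s)%R%:R)%:E = (g s k.+1 a)%:E)%E.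
Proof.
elim: k a => [|k IH] a as_.
  rewrite /g expr1 divr1 -PE//; apply: eq_integral => u _.
  by rewrite expr0 fact0 divr1 mulr1.
have gk v j : v <= s -> 0 <= g s j v.
  by move=> vs; rewrite /g divr_ge0// exprn_ge0// subr_ge0 P_mono.
have gS v : g s k.+1 v * k.+1%:R = g s k v * (P s - P v).
  rewrite /g exprS factS natrM invfM.
  have := mulVf (_ : k.+1%:R != 0 :> R); rewrite pnatr_eq0 => /(_ isT) k1.
  transitivity ((P s - P v) ^+ k * k`!%:R^-1 * (P s - P v) * (k.+1%:R^-1 * k.+1%:R)).
    by ring.
  by rewrite k1 mulr1.
set X := (\int[mu]_u _)%E.
pose F (z : measurableTypeR R * measurableTypeR R) : \bar R :=
  (p z.1 * (a <= z.1 <= s)%R%:R * (p z.2 * g s k z.2 * (z.1 <= z.2 <= s)%R%:R))%:E.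
have mF : measurable_fun setT F.
  apply/measurable_EFinP.
  have m1 : measurable_fun [set: measurableTypeR R * measurableTypeR R] (fst : _ -> R).
    exact: measurable_fst.
  have m2 : measurable_fun [set: measurableTypeR R * measurableTypeR R] (snd : _ -> R).
    exact: measurable_snd.
  apply: measurable_funM.
    apply: measurable_funM; first exact: (measurableT_comp mp m1).
    exact: (measurableT_comp (mind a s) m1).
  apply: measurable_funM.
    apply: measurable_funM; first exact: (measurableT_comp mp m2).
    exact: (measurableT_comp (mg s k) m2).
  by apply: measurable_natb; apply: measurable_and; exact: measurable_fun_ler.
have F0 z : (0 <= F z)%E.
  rewrite lee_fin /F; case: (boolP (a <= z.1 <= s)) => [/andP[az zs]|_]; last first.
    by rewrite mulr0 mul0r.
  case: (boolP (z.1 <= z.2 <= s)) => [/andP[zz z2]|_]; last by rewrite !mulr0.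
  rewrite !mulr1; apply: mulr_ge0 => //; apply: mulr_ge0 => //.
  exact: gk.
have X1 : X = (\int[mu]_v (p v * g s k v * (a <= v <= s)%R%:R * (P v - P a))%:E)%E.
  transitivity (\int[mu]_u \int[mu]_v F (u, v))%E.
    apply: eq_integral => u _; case: (boolP (a <= u <= s)) => [/andP[au us]|nau]; last first.
      rewrite mulr0 integral0_eq// => v _.
      by rewrite /F /= (negbTE nau) mulr0 mul0r.
    transitivity (\int[mu]_v ((p u)%:E * (p v * g s k v * (u <= v <= s)%R%:R)%:E))%E.
      rewrite ge0_integralZl_EFin//.
      - by rewrite IH// mulr1.
      - move=> v _; rewrite lee_fin; case: (boolP (u <= v <= s)) => [/andP[uv vs]|_]; last first.
          by rewrite mulr0.
        by rewrite mulr1 mulr_ge0// gk.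
      - by apply/measurable_EFinP; exact: mpgi.
    by apply: eq_integral => v _; rewrite /F /= au us /= mulr1 EFinM.
  rewrite (fubini_tonelli F)//; apply: eq_integral => v _.
  transitivity (\int[mu]_u ((p v * g s k v * (a <= v <= s)%R%:R)%:E *
      (p u * (a <= u <= v)%R%:R)%:E))%E.
    apply: eq_integral => u _; rewrite /F /= -EFinM; congr EFin.
    have -> : (a <= v <= s)%R%:R = (a <= v)%R%:R * (v <= s)%R%:R :> R by rewrite -natrM mulnb.
    have -> : (a <= u <= v)%R%:R = (a <= u)%R%:R * (u <= v)%R%:R :> R by rewrite -natrM mulnb.
    have -> : (a <= u <= s)%R%:R = (a <= u)%R%:R * (u <= s)%R%:R :> R by rewrite -natrM mulnb.
    have -> : (u <= v <= s)%R%:R = (u <= v)%R%:R * (v <= s)%R%:R :> R by rewrite -natrM mulnb.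
    have [au|] := leP a u; last by rewrite !(mul0r, mulr0).
    have [uv|] := leP u v; last by rewrite !(mul0r, mulr0).
    have [vs|] := leP v s; last by rewrite !(mul0r, mulr0).
    by rewrite (le_trans au uv) (le_trans uv vs); ring.
  case: (boolP (a <= v <= s)) => [/andP[av vs]|_]; last first.
    by rewrite mulr0 mul0r integral0_eq// => u _; rewrite mul0e.
  rewrite ge0_integralZl_EFin// ?PE//.
  - by move=> u _; rewrite lee_fin mulr_ge0.
  - by apply/measurable_EFinP; exact: mpi.
  - by rewrite mulr1 mulr_ge0// gk.
have X2 : (X + k.+1%:R%:E * X = ((P s - P a) * g s k.+1 a)%:E)%E.
  rewrite [X in (X + _)%E]X1 /X -ge0_integralZl_EFin//; first last.
  - by apply/measurable_EFinP; exact: mpgi.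
  - move=> v _; rewrite lee_fin; case: (boolP (a <= v <= s)) => [/andP[av vs]|_]; last first.
      by rewrite mulr0.
    by rewrite mulr1 mulr_ge0// gk.
  rewrite -ge0_integralD//; first last.
  - by apply: emeasurable_funM => //; apply/measurable_EFinP; exact: mpgi.
  - move=> v _; rewrite mule_ge0// lee_fin; case: (boolP (a <= v <= s)) => [/andP[av vs]|_]; last first.
      by rewrite mulr0.
    by rewrite mulr1 mulr_ge0// gk.
  - apply/measurable_EFinP; apply: measurable_funM; last exact: measurable_funB.
    exact: mpgi.
  - move=> v _; rewrite lee_fin; case: (boolP (a <= v <= s)) => [/andP[av vs]|_]; last first.
      by rewrite mulr0 mul0r.
    rewrite mulr1; apply: mulr_ge0; last by rewrite subr_ge0 P_mono.
    by apply: mulr_ge0 => //; apply: gk => //.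
  rewrite EFinM -IH// -ge0_integralZl_EFin//.
  - apply: eq_integral => v _; rewrite -!EFinM -EFinD; congr EFin.
    transitivity (p v * (a <= v <= s)%R%:R * (g s k v * (P v - P a) + g s k.+1 v * k.+1%:R)).
      by ring.
    by rewrite gS; ring.
  - move=> v _; rewrite lee_fin; case: (boolP (a <= v <= s)) => [/andP[av vs]|_]; last first.
      by rewrite mulr0.
    by rewrite mulr1 mulr_ge0// gk.
  - by apply/measurable_EFinP; exact: mpgi.
  - by rewrite subr_ge0 P_mono.
move: X2; rewrite -[X in (X + _)%E]mul1e -ge0_muleDl// -EFinD.
have k2 : 1 + k.+1%:R = k.+2%:R :> R by rewrite addrC natr1.
rewrite k2 => /(congr1 (fun x => (k.+2%:R^-1)%:E * x)%E).
rewrite muleA -EFinM mulVf ?pnatr_eq0// mul1e => ->.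
rewrite -EFinM; congr EFin.
by rewrite /g [in RHS]exprS [in RHS]factS natrM invfM mulrCA [X in _ * X]mulrCA mulrA.
Qed.


Local Notation pdf := (exponential_pdf lambda).

(* A message arriving a time [s] after the last admittance is rejected with
   probability [p s], and [P] is a primitive of [p]. Given that a time [a] has
   elapsed since the last admittance, this is the density of the time of the next
   one when exactly [k] messages are rejected before it. *)
Definition accept_density k a s : R :=
  lambda ^+ k * pdf (s - a) * (1 - p s) * ((P s - P a) ^+ k / k`!%:R).

Definition accept_prob k (D : set R) a : \bar R :=
  (\int[mu]_(s in D) (accept_density k a s)%:E)%E.

Let pdf_ge0 x : 0 <= pdf x. Proof. exact/exponential_pdf_ge0/ltW. Qed.

Let pdfE x : pdf x = (0 <= x)%R%:R * (lambda * expR (- lambda * x)).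
Proof.
have [x0|x0] := leP 0 x; first by rewrite exponential_pdfE// mul1r.
by rewrite lt0_exponential_pdf// mul0r.
Qed.

Let mshift a : measurable_fun [set: R] (fun u => a + u : R).
Proof. exact: measurable_funD. Qed.

Let mpdf a : measurable_fun [set: R] (fun s => pdf (s - a)).
Proof.
apply: measurableT_comp; first exact: measurable_exponential_pdf.
exact: measurable_funB.
Qed.

Lemma accept_density_ge0 k a s : 0 <= accept_density k a s.
Proof.
have [as_|sa] := leP a s; last first.
  by rewrite /accept_density lt0_exponential_pdf ?subr_lt0// mulr0 !mul0r.
rewrite /accept_density !mulr_ge0 ?exprn_ge0 ?subr_ge0 ?P_mono//.
by rewrite ltW.
Qed.

Lemma measurable_accept_density k :
  measurable_fun [set: measurableTypeR R * measurableTypeR R]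
    (fun z => accept_density k z.1 z.2).
Proof.
have m1 : measurable_fun [set: measurableTypeR R * measurableTypeR R] (fst : _ -> R).
  exact: measurable_fst.
have m2 : measurable_fun [set: measurableTypeR R * measurableTypeR R] (snd : _ -> R).
  exact: measurable_snd.
apply: measurable_funM.
  apply: measurable_funM.
    apply: measurable_funM => //.
    apply: measurableT_comp; first exact: measurable_exponential_pdf.
    exact: measurable_funB.
  by apply: measurable_funB => //; exact: (measurableT_comp mp m2).
apply: measurable_funM => //; apply: measurable_funX; apply: measurable_funB.
  exact: (measurableT_comp mP m2).
exact: (measurableT_comp mP m1).
Qed.

Let mdens k a : measurable_fun [set: R] (accept_density k a).
Proof.
apply: measurable_funM.
  apply: measurable_funM; last exact: measurable_funB.
  by apply: measurable_funM => //; exact: mpdf.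
by apply: measurable_funM => //; apply: measurable_funX; exact: measurable_funB.
Qed.

Let accept_prob_indic k D a : measurable D -> accept_prob k D a =
  (\int[mu]_s (accept_density k a s * \1_D s)%:E)%E.
Proof.
move=> mD; rewrite /accept_prob integral_mkcond; apply: eq_integral => s _.
by rewrite patchE indicE; case: ifP => _; rewrite ?mulr1 ?mulr0.
Qed.

Let mF k (D : set R) : measurable D ->
  measurable_fun [set: measurableTypeR R * measurableTypeR R]
    (fun z => (accept_density k z.1 z.2 * \1_D z.2)%:E).
Proof.
move=> mD; apply/measurable_EFinP; apply: measurable_funM.
  exact: measurable_accept_density.
by apply: measurableT_comp; [exact: measurable_indic|exact: measurable_snd].
Qed.

Lemma measurable_accept_prob k (D : set R) : measurable D ->
  measurable_fun [set: R] (accept_prob k D).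
Proof.
move=> mD; rewrite (_ : accept_prob k D = fubini_F mu
    (fun z => (accept_density k z.1 z.2 * \1_D z.2)%:E)).
  apply: measurable_fun_fubini_tonelli_F; first exact: mF.
  by move=> z; rewrite lee_fin mulr_ge0// accept_density_ge0.
by apply/funext => a; rewrite accept_prob_indic.
Qed.

Lemma accept_prob_ge0 k D a : (0 <= accept_prob k D a)%E.
Proof. by apply: integral_ge0 => s _; rewrite lee_fin accept_density_ge0. Qed.

Lemma accept_prob0 (D : set R) a : measurable D ->
  accept_prob 0 D a =
  (\int[expo lambda_gt0]_u ((1 - p (a + u)) * \1_D (a + u))%:E)%E.
Proof.
move=> mD; have mI : measurable_fun [set: R] (\1_D : R -> R) by exact: measurable_indic.
have m0 : measurable_fun [set: R] (fun u => ((1 - p (a + u)) * \1_D (a + u))%:E).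
  apply/measurable_EFinP; apply: measurable_funM.
    by apply: measurable_funB => //; exact: (measurableT_comp mp (mshift a)).
  exact: (measurableT_comp mI (mshift a)).
rewrite integral_expo//; first last.
- by move=> u; rewrite lee_fin mulr_ge0// subr_ge0.
(* Passes from the waiting time [u] to the elapsed time [s = a + u]. *)
rewrite -[RHS](@ge0_integral_shift _ (- a)); first last.
- by move=> u; rewrite -EFinM lee_fin !mulr_ge0// subr_ge0.
- apply: emeasurable_funM; last by apply/measurable_EFinP; exact: measurable_exponential_pdf.
  exact: m0.
rewrite accept_prob_indic//; apply: eq_integral => s _.
have asK : a + (s - a) = s by rewrite addrC subrK.
by rewrite -EFinM asK /accept_density !expr0 fact0 divr1; congr EFin; ring.
Qed.

(** Conditions on the first message, rejected at the elapsed time [a + u]. By memorylessness only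
    [p] and the power depend on this intermediate time, and [iterated_integral] integrates them. *)
Lemma accept_probS k (D : set R) a : measurable D ->
  accept_prob k.+1 D a =
  (\int[expo lambda_gt0]_u ((p (a + u))%:E * accept_prob k D (a + u)))%E.
Proof.
move=> mD; have mI : measurable_fun [set: R] (\1_D : R -> R) by exact: measurable_indic.
have mA := measurable_accept_prob k mD.
have mpA : measurable_fun [set: R]
    (fun u => ((p u)%:E * accept_prob k D u)%E).
  by apply: emeasurable_funM => //; exact/measurable_EFinP.
rewrite integral_expo//; first last.
- by move=> u; rewrite mule_ge0 ?accept_prob_ge0// lee_fin.
- exact: (measurableT_comp mpA (mshift a)).
rewrite -[RHS](@ge0_integral_shift _ (- a)); first last.
- by move=> u; rewrite !mule_ge0 ?accept_prob_ge0// lee_fin.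
- apply: emeasurable_funM; last by apply/measurable_EFinP; exact: measurable_exponential_pdf.
  exact: (measurableT_comp mpA (mshift a)).
pose F (z : measurableTypeR R * measurableTypeR R) : \bar R :=
  (p z.1 * pdf (z.1 - a) * (accept_density k z.1 z.2 * \1_D z.2))%:E.
have F0 z : (0 <= F z)%E.
  rewrite lee_fin; apply: mulr_ge0; first exact: mulr_ge0.
  by apply: mulr_ge0 => //; exact: accept_density_ge0.
have mpp : measurable_fun [set: R] (fun u => p u * pdf (u - a)).
  exact: measurable_funM.
have mFF : measurable_fun setT F.
  apply/measurable_EFinP; apply: measurable_funM; last by apply/measurable_EFinP; exact: mF.
  by apply: (measurableT_comp mpp); exact: measurable_fst.
transitivity (\int[mu]_u \int[mu]_s F (u, s))%E; last first.
  apply: eq_integral => u _.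
  have auK : a + (u - a) = u by rewrite addrC subrK.
  rewrite auK muleAC -EFinM.
  rewrite accept_prob_indic// -ge0_integralZl_EFin//.
  - by move=> s _; rewrite lee_fin mulr_ge0// accept_density_ge0.
  - by apply/measurable_EFinP; apply: measurable_funM => //; exact: mdens.
  - exact: mulr_ge0.
rewrite (fubini_tonelli F)// accept_prob_indic//.
apply: eq_integral => s _; rewrite /F /=.
transitivity (\int[mu]_u ((lambda ^+ k.+1 * pdf (s - a) * (1 - p s) * \1_D s)%:E *
   (p u * ((P s - P u) ^+ k / k`!%:R) * (a <= u <= s)%R%:R)%:E))%E; last first.
  apply: eq_integral => u _; rewrite -EFinM; congr EFin.
  (* The exponents add up to that of [s - a], and the signs of the two arguments yield the indicator
     of [a <= u <= s]. *)
  have : pdf (u - a) * pdf (s - u) = lambda * pdf (s - a) * (a <= u <= s)%R%:R.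
    rewrite !pdfE !subr_ge0; have [au|] := leP a u; last by rewrite !(mul0r,mulr0).
    have [us|] := leP u s; last by rewrite !(mul0r,mulr0).
    rewrite (le_trans au us) !mul1r mulr1 mulrACA -expRD -mulrA.
    by congr (_ * (_ * expR _)); ring.
  move=> /(congr1 (fun x => x * (p u * lambda ^+ k * (1 - p s) * ((P s - P u) ^+ k / k`!%:R) * \1_D s))) E.
  rewrite /accept_density exprS; move: E; set f := _ / _; set i := \1_D s => E.
  by transitivity (pdf (u - a) * pdf (s - u) * (p u * lambda ^+ k * (1 - p s) * f * i));
    [rewrite E|]; ring.
rewrite ge0_integralZl_EFin//.
- have [as_|sa] := leP a s; last first.
    by rewrite /accept_density lt0_exponential_pdf ?subr_lt0// !(mulr0,mul0r) mul0e.
  rewrite iterated_integral// -EFinM /accept_density /g; congr EFin.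
  exact: mulrAC.
- move=> u _; rewrite lee_fin; case: (boolP (a <= u <= s)) => [/andP[au us]|_]; last first.
    by rewrite mulr0.
  by rewrite mulr1 !mulr_ge0// exprn_ge0// subr_ge0 P_mono.
- by apply/measurable_EFinP; exact: (mpgi s k a s).
- by rewrite !mulr_ge0// ?exprn_ge0 ?subr_ge0// ltW.
Qed.

Section total_mass.
Hypothesis p_ge1 : forall u, 1 <= u -> p u = 0.
(** The probability of an admission preceded by fewer than [K] rejections. It obeys the first-step
    recursion [SS], from which both bounds follow by induction. *)
Let S K a : \bar R := (\sum_(k < K) accept_prob k setT a)%E.
Let theta : R := 1 - expR (- lambda).

Let theta_ge0 : 0 <= theta.
Proof. by rewrite subr_ge0 expR_le1 oppr_le0 ltW. Qed.

Let theta_le1 : theta <= 1.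
Proof. by rewrite gerBl expR_ge0. Qed.

Let S_ge0 K a : (0 <= S K a)%E.
Proof. by apply: sume_ge0 => k _; exact: accept_prob_ge0. Qed.

Let mS K : measurable_fun [set: R] (S K).
Proof. by apply: emeasurable_sum => k; exact: measurable_accept_prob. Qed.

Let mSS K a : measurable_fun [set: R]
  (fun u => ((1 - p (a + u))%:E + (p (a + u))%:E * S K (a + u))%E).
Proof.
have h : measurable_fun [set: R] (fun u => ((1 - p u)%:E + (p u)%:E * S K u)%E).
  apply: emeasurable_funD; first by apply/measurable_EFinP; exact: measurable_funB.
  by apply: emeasurable_funM => //; exact/measurable_EFinP.
exact: (measurableT_comp h (mshift a)).
Qed.

Let SS K a : S K.+1 a = (\int[expo lambda_gt0]_u
  ((1 - p (a + u))%:E + (p (a + u))%:E * S K (a + u)))%E.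
Proof.
have m1 : measurable_fun [set: R] (fun u => (1 - p (a + u))%:E).
  have h : measurable_fun [set: R] (fun u => (1 - p u)%:E).
    by apply/measurable_EFinP; exact: measurable_funB.
  exact: (measurableT_comp h (mshift a)).
have m2 k : measurable_fun [set: R] (fun u => (p (a + u))%:E * accept_prob k setT (a + u))%E.
  have h : measurable_fun [set: R] (fun u => (p u)%:E * accept_prob k setT u)%E.
    apply: emeasurable_funM; first exact/measurable_EFinP.
    exact: measurable_accept_prob.
  exact: (measurableT_comp h (mshift a)).
transitivity (\int[expo lambda_gt0]_u ((1 - p (a + u))%:E +
    \sum_(k < K) (p (a + u))%:E * accept_prob k setT (a + u)))%E; last first.
  apply: eq_integral => u _; rewrite /S ge0_sume_distrr// => k _.
  exact: accept_prob_ge0.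
rewrite ge0_integralD//; first last.
- by apply: emeasurable_sum => k; exact: m2.
- by move=> u _; apply: sume_ge0 => k _; rewrite mule_ge0 ?accept_prob_ge0// lee_fin.
- by move=> u _; rewrite lee_fin subr_ge0.
rewrite ge0_integral_sum//; first last.
- by move=> k u _; rewrite mule_ge0 ?accept_prob_ge0// lee_fin.
- by move=> k; exact: m2.
rewrite /S big_ord_recl accept_prob0//; congr (_ + _)%E.
  by apply: eq_integral => u _; rewrite indicT mulr1.
by apply: eq_bigr => k _; rewrite lift0 accept_probS.
Qed.

Let S_le1 K a : (S K a <= 1)%E.
Proof.
elim: K a => [|K IH] a; first by rewrite /S big_ord0 lee_fin.
rewrite SS -[leRHS](@probability_setT _ _ _ (expo lambda_gt0)).
rewrite -[leRHS]mul1e -integral_cst//; apply: ge0_le_integral => //.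
- by move=> u _; rewrite adde_ge0// ?mule_ge0// lee_fin// subr_ge0.
- exact: mSS.
- move=> u _; apply: (@le_trans _ _ ((1 - p (a + u))%:E + (p (a + u))%:E)%E).
    by rewrite leeD2l// -[leRHS]mule1 lee_wpmul2l// lee_fin.
  by rewrite -EFinD subrK.
Qed.

(* Each new message is admitted at once if its interarrival time exceeds 1; hence
   more than [K] rejections have probability at most [theta ^+ K]. *)
Let S_ge K a : 0 <= a -> ((1 - theta ^+ K)%:E <= S K a)%E.
Proof.
elim: K a => [|K IH] a a0; first by rewrite expr0 subrr S_ge0.
have tK : 0 <= theta ^+ K <= 1.
  by rewrite exprn_ge0//= exprn_ile1.
have mI : measurable_fun [set: R] (fun u => (1 - theta ^+ K)%:E + (theta ^+ K)%:E * (\1_(`]1, +oo[%classic : set R) u)%:E)%E.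
  apply: emeasurable_funD => //; apply: emeasurable_funM => //.
  by apply/measurable_EFinP.
rewrite SS (@le_trans _ _ (\int[expo lambda_gt0]_u
    ((1 - theta ^+ K)%:E + (theta ^+ K)%:E * (\1_(`]1, +oo[%classic : set R) u)%:E))%E)//.
  rewrite ge0_integralD//; first last.
  - by apply: emeasurable_funM => //; apply/measurable_EFinP.
  - by move=> u _; rewrite mule_ge0// lee_fin; case/andP: tK.
  - by move=> u _; rewrite lee_fin subr_ge0; case/andP: tK.
  rewrite integral_cst// [X in (_ * X)%E]probability_setT mule1.
  rewrite ge0_integralZl_EFin//; first last.
  - by case/andP: tK.
  - by apply/measurable_EFinP.
  rewrite integral_indic// setIT [X in (_ + _ * X)%E](expo_gt lambda_gt0 ler01).
  rewrite mulr1 -EFinM -EFinD lee_fin.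
  by rewrite exprSr /theta; lra.
apply: le_integral_expo => //.
- by move=> u; rewrite adde_ge0// ?mule_ge0// lee_fin ?subr_ge0; case/andP: tK.
- by move=> u; rewrite adde_ge0// ?mule_ge0// lee_fin// subr_ge0.
move=> u u0; rewrite indicE; have [u1|u1] := boolP (u \in _).
  have /p_ge1 -> : 1 <= a + u.
    by move: u1; rewrite inE /= in_itv /= andbT => u1; lra.
  by rewrite mul0e adde0 mule1 -EFinD subr0 subrK.
rewrite mule0 adde0; apply: le_trans (leeD2l _ (lee_wpmul2l _ (IH (a + u) _))).
- rewrite -EFinM -EFinD lee_fin.
  have := p_ge0 (a + u); have := p_le1 (a + u); nra.
- by rewrite lee_fin.
- by rewrite addr_ge0.
Qed.

Lemma accept_prob_total a : 0 <= a ->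
  (\sum_(0 <= k <oo) accept_prob k setT a = 1)%E.
Proof.
move=> a0; apply/cvg_lim => //.
rewrite (_ : (fun _ => _) = S ^~ a); last by apply/funext => K; rewrite /S big_mkord.
apply: (@squeeze_cvge _ _ _ _ (fun K => (1 - theta ^+ K)%:E) _ (cst 1%E)).
- by apply: nearW => K; rewrite S_ge//=.
- rewrite -[X in _ --> X]/(1%:E) -[X in _ --> X%:E](subr0 1).
  apply: cvg_EFin; first by apply: nearW.
  apply: cvgB; first exact: cvg_cst.
  apply: cvg_expr; rewrite ger0_norm//.
  by rewrite /theta gtrBl expR_gt0.
- exact: cvg_cst.
Qed.

End total_mass.
End thinning.

(** * Thresholds and the waiting kernel *)

Section thresholds.
Context (R : realType) (q : nat).
Implicit Types (r : 'I_q -> R) (s : R).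
Hypothesis q_gt0 : (0 < q)%N.
Local Notation mu := (@lebesgue_measure R).

(* For a uniform mark [c], the probability that [s < r c]; the truncation at [0] is
   invisible at the elapsed times [s >= 0]. *)
Definition reject_prob r s : R := q%:R^-1 * \sum_(c < q) (s < Num.max (r c) 0)%R%:R.

(** The primitive on [[0, +oo[] that vanishes at 0: for [m >= 0] the indicator of [s < m] integrates
    to [Num.min m s]. *)
Definition reject_int r s : R := q%:R^-1 * \sum_(c < q) Num.min (Num.max (r c) 0) s.

Lemma reject_prob_ge0 r s : 0 <= reject_prob r s.
Proof. by rewrite mulr_ge0// sumr_ge0. Qed.

Lemma reject_prob_le1 r s : reject_prob r s <= 1.
Proof.
rewrite /reject_prob ler_pdivrMl ?ltr0n// mulr1.
rewrite -[in leRHS](card_ord q) -sumr_const ler_sum// => c _.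
by case: (_ < _).
Qed.

Lemma reject_prob_ge1 r s : (forall c, r c <= 1) -> 1 <= s -> reject_prob r s = 0.
Proof.
move=> r1 s1; rewrite /reject_prob big1 ?mulr0// => c _.
by rewrite ltNge ge_max (le_trans (r1 c) s1) (le_trans ler01 s1).
Qed.

Lemma reject_int0 r : reject_int r 0 = 0.
Proof.
by rewrite /reject_int big1 ?mulr0// => c _; rewrite min_r// le_max lexx orbT.
Qed.

Section parametric.
Context d (S : measurableType d) (r : S -> 'I_q -> R) (f : S -> R).
Hypothesis mr : forall c, measurable_fun [set: S] (fun x => r x c).
Hypothesis mf : measurable_fun [set: S] f.

Lemma measurable_reject_prob : measurable_fun [set: S] (fun x => reject_prob (r x) (f x)).
Proof.
apply: measurable_funM => //; apply: measurable_sum => c.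
apply: measurable_natb; apply: measurable_fun_ltr => //.
exact: measurable_maxr.
Qed.

Lemma measurable_reject_int : measurable_fun [set: S] (fun x => reject_int (r x) (f x)).
Proof.
apply: measurable_funM => //; apply: measurable_sum => c.
by apply: measurable_minr => //; exact: measurable_maxr.
Qed.

End parametric.

Lemma integral_reject_prob r a b : a <= b ->
  (\int[mu]_u (reject_prob r u * (a <= u <= b)%R%:R)%:E =
   (reject_int r b - reject_int r a)%:E)%E.
Proof.
move=> ab.
have mi m : measurable_fun [set: R] (fun u : R => ((u < m)%R%:R * (a <= u <= b)%R%:R)%:E).
  apply/measurable_EFinP; apply: measurable_funM; apply: measurable_natb.
    exact: measurable_fun_ltr.
  by apply: measurable_and; exact: measurable_fun_ler.
have int1 m : (\int[mu]_u ((u < m)%R%:R * (a <= u <= b)%R%:R)%:E =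
    (Num.min m b - Num.min m a)%:E)%E.
  (* The integrand is the indicator of an interval starting at [a], open on the right if it is cut
     at [m] and closed if it reaches [b]; it may be empty. *)
  have -> : (Num.min m b - Num.min m a)%:E =
      mu [set` Interval (BLeft a) (if (m <= b)%R then BLeft m else BRight b)].
    rewrite lebesgue_measure_itv; have [mb|bm] := leP m b; rewrite /= lte_fin.
      by have [am|ma] := ltP a m; rewrite -?EFinB// subrr.
    rewrite (min_r (ltW (le_lt_trans ab bm))); have [?|ba] := ltP a b; first by rewrite -EFinB.
    by rewrite (le_anti (introT andP (conj ab ba))) subrr.
  rewrite -[RHS]mul1e -[1%E]/(1%:E) -integral_cst// integral_mkcond.
  apply: eq_integral => u _; rewrite patchE -natrM mulnb.
  set A := (u \in _); have -> : A = (u < m) && (a <= u <= b).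
    rewrite /A; apply/idP/idP; rewrite inE /= in_itv; case: (leP m b) => mb /=.
    - by move=> /andP[-> um]; rewrite um (ltW (lt_le_trans um mb)).
    - by move=> /andP[-> ub]; rewrite ub (le_lt_trans ub mb).
    - by move=> /and3P[-> -> _].
    - by move=> /and3P[_ -> ->].
  by case: (_ && _).
rewrite /reject_int -mulrBr -sumrB EFinM -sumEFin.
under eq_bigr do rewrite -int1.
rewrite -ge0_integral_sum//; last first.
  by move=> c; exact: mi.
rewrite -ge0_integralZl_EFin//; first last.
- by apply: emeasurable_sum => c; exact: mi.
- by move=> u _; apply: sume_ge0 => c _; rewrite lee_fin mulr_ge0.
apply: eq_integral => u _; rewrite sumEFin -EFinM -mulr_suml mulrA.
by [].
Qed.

End thresholds.

Section states.
Context (R : realType).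

(* The junk value for [s <= 0] is only met on null sets. *)
Definition mk_state (k : nat) (s : R) : state R :=
  if @idP (0 < s) is ReflectT s_gt0 then exist _ (k.+1, s) s_gt0 else point.

Lemma mk_stateE k s : 0 < s -> state_val (mk_state k s) = (k.+1, s).
Proof. by rewrite /mk_state; case: {-}_ / idP. Qed.

Lemma state_val_inj : injective (@state_val R).
Proof.
move=> [x hx] [y hy]; rewrite /state_val /= => xy.
by case: _ / xy hy => hy; congr exist; exact: bool_irrelevance.
Qed.

Lemma measurable_state_val : measurable_fun [set: state R] (@state_val R).
Proof. by move=> _ B mB; exists B. Qed.

Lemma measurable_mk_state k : measurable_fun [set: R] (mk_state k).
Proof.
move=> _ U [B mB <-]; rewrite !setTI.
pose f (s : R) : nat * R := if 0 < s then (k.+1, s) else (1%N, 1).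
have mf : measurable_fun [set: R] f.
  by apply: measurable_fun_ifT => //; exact: measurable_fun_ltr.
suff -> : mk_state k @^-1` (@state_val R @^-1` B) = f @^-1` B.
  by rewrite -[X in measurable X]setTI; exact: mf.
apply/seteqP; split=> s; rewrite /= /f /mk_state;
  by case: {-}_ / idP => [h|/negP/negbTE h]; rewrite h.
Qed.

End states.

Section waiting_kernel.
Context (R : realType) (lambda : R) (q : nat).
Context d (X : measurableType d) (r : X -> 'I_q -> R).
Hypothesis lambda_gt0 : 0 < lambda.
Hypothesis q_gt0 : (0 < q)%N.
Hypothesis mr : forall c, measurable_fun [set: X] (fun x => r x c).
Hypothesis r_le1 : forall x c, r x c <= 1.
Local Notation mu := (@lebesgue_measure R).

Definition waiting_density k x s : R :=
  accept_density lambda (reject_prob (r x)) (reject_int (r x)) k 0 s.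

Lemma measurable_waiting_density2 k :
  measurable_fun [set: X * measurableTypeR R] (fun z => waiting_density k z.1 z.2).
Proof.
have m2 : measurable_fun [set: X * measurableTypeR R] (snd : _ -> R).
  exact: measurable_snd.
have mr1 c : measurable_fun [set: X * measurableTypeR R] (fun z => r z.1 c).
  exact: (measurableT_comp (mr c) measurable_fst).
apply: measurable_funM.
  apply: measurable_funM.
    apply: measurable_funM => //.
    apply: measurableT_comp; first exact: measurable_exponential_pdf.
    exact: measurable_funB.
  by apply: measurable_funB => //; exact: measurable_reject_prob.
apply: measurable_funM => //; apply: measurable_funX; apply: measurable_funB.
  exact: measurable_reject_int.
by apply: measurable_reject_int.
Qed.

Lemma measurable_waiting_density k x :
  measurable_fun [set: measurableTypeR R] (waiting_density k x).
Proof.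
have h : measurable_fun [set: measurableTypeR R] (fun s => (x, s)).
  exact: pair1_measurable.
exact: (measurableT_comp (@measurable_waiting_density2 k) h).
Qed.

Lemma waiting_density_ge0 k x s : 0 <= waiting_density k x s.
Proof.
apply: accept_density_ge0 => //; [exact: reject_prob_ge0|exact: reject_prob_le1|].
by move=> a b; exact: integral_reject_prob.
Qed.

Definition waiting_term k (x : X) : {measure set (state R) -> \bar R} :=
  image_measure (mdensity mu (@measurable_waiting_density k x)
    (@waiting_density_ge0 k x)) (@measurable_mk_state R k).

Lemma waiting_termE k x U : waiting_term k x U =
  (\int[mu]_(s in mk_state k @^-1` U) (waiting_density k x s)%:E)%E.
Proof. by []. Qed.

Let measurable_waiting_term k U : measurable U ->
  measurable_fun [set: X] (waiting_term k ^~ U).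
Proof.
move=> mU.
have mV : measurable (mk_state k @^-1` U).
  by rewrite -[X in measurable X]setTI; exact: measurable_mk_state.
pose F (z : X * measurableTypeR R) : \bar R :=
  (waiting_density k z.1 z.2 * \1_(mk_state k @^-1` U) z.2)%:E.
rewrite (_ : waiting_term k ^~ U = fubini_F mu F).
  apply: measurable_fun_fubini_tonelli_F.
    apply/measurable_EFinP; apply: measurable_funM.
      exact: measurable_waiting_density2.
    by apply: measurableT_comp; [exact: measurable_indic|exact: measurable_snd].
  by move=> z; rewrite lee_fin mulr_ge0// waiting_density_ge0.
apply/funext => x; rewrite waiting_termE integral_mkcond; apply: eq_integral => s _.
by rewrite patchE /F /= indicE; case: ifP => _; rewrite ?mulr1 ?mulr0.
Qed.

HB.instance Definition _ k :=
  isKernel.Build _ _ _ _ _ (waiting_term k) (@measurable_waiting_term k).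

Definition waiting_kernel : X -> {measure set (state R) -> \bar R} :=
  kseries waiting_term.

HB.instance Definition _ := Kernel.on waiting_kernel.

Lemma waiting_kernelE x U : waiting_kernel x U = (\sum_(0 <= k <oo)
  \int[mu]_(s in mk_state k @^-1` U) (waiting_density k x s)%:E)%E.
Proof. by []. Qed.

(** Almost surely finitely many rejections precede an admission: all thresholds are at most 1, so
    nothing is rejected from the elapsed time 1 on. *)
Let waiting_kernelT x : waiting_kernel x [set: state R] = 1%E.
Proof.
rewrite waiting_kernelE.
apply: (@accept_prob_total _ _ lambda_gt0 (reject_prob (r x)) (reject_int (r x))) => //.
- by apply: measurable_reject_prob.
- by apply: measurable_reject_int.
- exact: reject_prob_ge0.
- exact: reject_prob_le1.
- by move=> a b; exact: integral_reject_prob.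
- by move=> u; exact: reject_prob_ge1.
Qed.

HB.instance Definition _ :=
  Kernel_isProbability.Build _ _ _ _ _ waiting_kernel waiting_kernelT.

(* [waiting_kernel] does not mention [r_le1], hence is not by itself recognised
   as a probability kernel outside this section. *)
Definition waiting_pker : R.-pker X ~> state R := waiting_kernel.

End waiting_kernel.

(** * Condition (U) *)

Section uniform.
Context (R : realType) (lambda : R) (n : nat).
Hypothesis lambda_gt0 : 0 < lambda.
Variable W : R.-pker (n.-tuple (state R)) ~> state R.
Local Notation X := (n.-tuple (state R)).
Local Open Scope ereal_scope.

Definition gap (z : state R) : R := (state_val z).2.

Lemma gap_gt0 z : (0 < gap z)%R.
Proof. by case: z => -[k s] h; rewrite /gap /state_val /=; case/andP: h. Qed.

Lemma measurable_gap : measurable_fun [set: state R] (gap : state R -> measurableTypeR R).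
Proof. exact: measurableT_comp measurable_snd (@measurable_state_val R). Qed.

Lemma gap_mk_state k s : (0 < s)%R -> gap (mk_state k s) = s.
Proof. by move=> s0; rewrite /gap mk_stateE. Qed.

Local Notation gapn x i := (gap (nth point (x : X) i)).

Definition kernel_step (F : X -> \bar R) (x : X) : \bar R :=
  \int[W x]_z F (slide (x, z)).

(** One step of the comparison chain, whose gaps are i.i.d. exponential. It is meant for functions
    of the gaps, which do not see the count put into the new state. *)
Definition expo_step (F : X -> \bar R) (x : X) : \bar R :=
  \int[expo lambda_gt0]_s F (slide (x, mk_state 0 s)).

Lemma measurable_kernel_step F : measurable_fun [set: X] F -> (forall x, 0 <= F x) ->
  measurable_fun [set: X] (kernel_step F).
Proof.
move=> mF F0.
apply: (measurable_fun_integral_finite_kernel (fun z => F (slide z))) => //.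
exact: (measurableT_comp mF (@measurable_slide _ _ n)).
Qed.

Lemma measurable_slide_mk_state :
  measurable_fun [set: X * measurableTypeR R] (fun z => slide (z.1, mk_state 0 z.2)).
Proof.
apply: (measurableT_comp (@measurable_slide _ _ n)).
apply: measurable_fun_pair; first exact: measurable_fst.
by apply: measurableT_comp; [exact: measurable_mk_state|exact: measurable_snd].
Qed.

Lemma measurable_slide_mk_state1 (x : X) :
  measurable_fun [set: measurableTypeR R] (fun s => slide (x, mk_state 0 s)).
Proof. exact: (measurable_fun_pair2 x measurable_slide_mk_state). Qed.

Lemma measurable_expo_step F : measurable_fun [set: X] F -> (forall x, 0 <= F x) ->
  measurable_fun [set: X] (expo_step F).
Proof.
move=> mF F0.
pose f (z : X * measurableTypeR R) := F (slide (z.1, mk_state 0 z.2)).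
rewrite (_ : expo_step F = fubini_F (expo lambda_gt0) f)//.
apply: measurable_fun_fubini_tonelli_F; last by move=> z; exact: F0.
exact: (measurableT_comp mF measurable_slide_mk_state).
Qed.

Lemma integral_vector_kernel F x : measurable_fun [set: X] F -> (forall x, 0 <= F x) ->
  \int[vector_kernel W x]_y F y = kernel_step F x.
Proof.
move=> mF F0; rewrite /vector_kernel.
transitivity (\int[W x]_z \int[kdirac (@measurable_slide _ _ n) (x, z)]_y F y).
  exact: integral_kcomp.
by apply: eq_integral => z _; rewrite integral_dirac// diracT mul1e.
Qed.

Lemma step_kernel_ge0_measurable U i : measurable U ->
  measurable_fun [set: X] (step_kernel (vector_kernel W) i ^~ U) /\
  forall x, 0 <= step_kernel (vector_kernel W) i x U.
Proof.
move=> mU; elim: i => [|i [mi i0]] /=.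
  split=> [|x]; last by [].
  exact: measurable_fun_dirac.
split=> [|x]; last exact: integral_ge0.
rewrite (_ : (fun _ => _) = kernel_step (step_kernel (vector_kernel W) i ^~ U)).
  exact: measurable_kernel_step.
by apply/funext => x; rewrite integral_vector_kernel.
Qed.

Lemma step_kernelD U i j : measurable U ->
  step_kernel (vector_kernel W) (j + i) ^~ U =
  iter j kernel_step (step_kernel (vector_kernel W) i ^~ U).
Proof.
move=> mU; elim: j => // j IH; rewrite addSn iterS -IH; apply/funext => x /=.
by have [mi i0] := step_kernel_ge0_measurable (j + i) mU; rewrite integral_vector_kernel.
Qed.

Lemma nth_slide x z i : (i < n)%N ->
  nth point (slide (x, z) : X) i = if (i.+1 < n)%N then nth point (x : X) i.+1 else z.
Proof.
move=> i_n; rewrite /slide /= nth_behead nth_rcons size_tuple.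
case: ltnP => // n_i; rewrite ifT//; apply/eqP/anti_leq.
by rewrite i_n n_i.
Qed.

Definition agree j (x y : X) := forall i, (j <= i < n)%N -> gapn x i = gapn y i.

Lemma agree_slide j x y z z' : agree j.+1 x y -> gap z = gap z' ->
  agree j (slide (x, z)) (slide (y, z')).
Proof.
move=> xy zz i /andP[ji i_n]; rewrite !nth_slide//; case: ifP => // i1.
by apply: xy; rewrite ltnS ji.
Qed.

Definition gap_only (F : X -> \bar R) := forall x y, agree 0 x y -> F x = F y.

(** To be instantiated with [C = e^lambda], [c = 1 / q] and, for [g], the threshold of a fixed mark,
    from which on that mark is accepted. *)
Variables (c C : R) (g : X -> R).
Hypothesis c_gt0 : (0 < c)%R.
Hypothesis C_gt0 : (0 < C)%R.
Hypothesis W_gap : forall x y U, agree 0 x y -> measurable U -> W x U = W y U.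
Hypothesis W_le : forall x (B : set R), measurable B ->
  W x (gap @^-1` B) <= C%:E * expo lambda_gt0 B.
Hypothesis W_ge : forall x (B : set R), measurable B ->
  c%:E * expo lambda_gt0 (B `&` `[g x, +oo[) <= W x (gap @^-1` B).
Hypothesis g_le1 : forall x, (g x <= 1)%R.
Hypothesis g_le0 : forall x i, (i < n)%N -> (1 <= gapn x i)%R -> (g x <= 0)%R.

Let W_integral F x : measurable_fun [set: X] F -> (forall x, 0 <= F x) -> gap_only F ->
  kernel_step F x = \int[image_measure (W x) measurable_gap]_s F (slide (x, mk_state 0 s)).
Proof.
move=> mF F0 gF; rewrite integral_image_measure//; last first.
  exact: (measurableT_comp mF (measurable_slide_mk_state1 x)).
apply: eq_integral => z _; apply: gF; apply: agree_slide => //.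
by rewrite gap_mk_state// gap_gt0.
Qed.

Lemma kernel_step_le F x : measurable_fun [set: X] F -> (forall x, 0 <= F x) ->
  gap_only F -> kernel_step F x <= C%:E * expo_step F x.
Proof.
move=> mF F0 gF; rewrite W_integral//.
have mFx := measurableT_comp mF (measurable_slide_mk_state1 x).
have C0 := ltW C_gt0.
have -> : C%:E * expo_step F x =
    \int[mscale (NngNum C0) (expo lambda_gt0)]_s F (slide (x, mk_state 0 s)).
  by rewrite ge0_integral_mscale.
by apply: le_measure_integral => // A mA; exact: W_le.
Qed.

Lemma kernel_step_ge F x : measurable_fun [set: X] F -> (forall x, 0 <= F x) ->
  gap_only F ->
  c%:E * \int[expo lambda_gt0]_s
    (F (slide (x, mk_state 0 s)) * (\1_(`[g x, +oo[%classic : set R) s)%:E) <=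
  kernel_step F x.
Proof.
move=> mF F0 gF; rewrite W_integral//.
have mFx := measurableT_comp mF (measurable_slide_mk_state1 x).
have c0 := ltW c_gt0.
have mI : measurable_fun [set: measurableTypeR R] (\1_(`[g x, +oo[%classic : set R) : R -> R).
  by [].
have I0 s : (0 <= (\1_(`[g x, +oo[%classic : set R) : R -> R) s)%R by [].
have -> : c%:E * \int[expo lambda_gt0]_s
    (F (slide (x, mk_state 0 s)) * (\1_(`[g x, +oo[%classic : set R) s)%:E) =
    \int[mscale (NngNum c0) (mdensity (expo lambda_gt0) mI I0)]_s
      F (slide (x, mk_state 0 s)).
  rewrite ge0_integral_mscale//; congr (_ * _); apply/esym; exact: integral_mdensity.
apply: le_measure_integral => // A mA; apply: le_trans (W_ge x mA).
rewrite -[leLHS]/(c%:E * \int[expo lambda_gt0]_(s in A)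
  (\1_(`[g x, +oo[%classic : set R) s)%:E).
by rewrite integral_indic// setIC.
Qed.

Let gap_only_kernel_step F : gap_only F -> gap_only (kernel_step F).
Proof.
move=> gF x y xy; rewrite /kernel_step.
have -> : \int[W x]_z F (slide (x, z)) = \int[W x]_z F (slide (y, z)).
  by apply: eq_integral => z _; apply: gF; apply: agree_slide => // i /andP[_ i_n]; exact: xy.
by apply: eq_measure_integral => A mA _; exact: W_gap.
Qed.

(** The new gap has the same law for all windows, so each step removes the dependence on one more of
    the oldest entries. For [j = n] the condition on [x] and [y] is empty and the value is a
    constant. *)
Lemma expo_step_agree F j : gap_only F ->
  forall x y, agree j x y -> iter j expo_step F x = iter j expo_step F y.
Proof.
move=> gF; elim: j => [|j IH] x y xy; first exact: gF.
by rewrite !iterS; apply: eq_integral => s _; apply: IH; exact: agree_slide.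
Qed.

Lemma gap_only_iter F i : gap_only F -> gap_only (iter i kernel_step F).
Proof. by move=> gF; elim: i => //= i; exact: gap_only_kernel_step. Qed.

Lemma iter_measurable_ge0 (op : (X -> \bar R) -> X -> \bar R) F i :
  (forall G, measurable_fun [set: X] G -> (forall x, 0 <= G x) ->
     measurable_fun [set: X] (op G) /\ forall x, 0 <= op G x) ->
  measurable_fun [set: X] F -> (forall x, 0 <= F x) ->
  measurable_fun [set: X] (iter i op F) /\ forall x, 0 <= iter i op F x.
Proof. by move=> opP mF F0; elim: i => //= i [mi i0]; exact: opP. Qed.

Section bounds.
Variable F : X -> \bar R.
Hypothesis mF : measurable_fun [set: X] F.
Hypothesis F0 : forall x, 0 <= F x.
Hypothesis gF : gap_only F.

Let kernel_iter i : measurable_fun [set: X] (iter i kernel_step F) /\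
  forall x, 0 <= iter i kernel_step F x.
Proof.
apply: iter_measurable_ge0 => // G mG G0; split; first exact: measurable_kernel_step.
by move=> x; exact: integral_ge0.
Qed.

Let expo_iter i : measurable_fun [set: X] (iter i expo_step F) /\
  forall x, 0 <= iter i expo_step F x.
Proof.
apply: iter_measurable_ge0 => // G mG G0; split; first exact: measurable_expo_step.
by move=> x; exact: integral_ge0.
Qed.

Let measurable_slide_comp (G : X -> \bar R) (x : X) : measurable_fun [set: X] G ->
  measurable_fun [set: measurableTypeR R] (fun s => G (slide (x, mk_state 0 s))).
Proof. by move=> mG; exact: (measurableT_comp mG (measurable_slide_mk_state1 x)). Qed.

Lemma iter_kernel_step_le i x :
  iter i kernel_step F x <= (C ^+ i)%:E * iter i expo_step F x.
Proof.
elim: i x => [|i IH] x; first by rewrite expr0 mul1e.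
have [mk k0] := kernel_iter i; have [me e0] := expo_iter i.
apply: le_trans (kernel_step_le x mk k0 (gap_only_iter i gF)) _.
rewrite exprS EFinM -muleA; apply: lee_wpmul2l; first by rewrite lee_fin ltW.
have Ci : (0 <= C ^+ i)%R by rewrite exprn_ge0// ltW.
rewrite iterS -ge0_integralZl_EFin//; last exact: measurable_slide_comp.
apply: ge0_le_integral => //; first exact: measurable_slide_comp.
by apply: emeasurable_funM => //; exact: measurable_slide_comp.
Qed.

(* After a gap of length at least 1, every channel is idle, and the lower bound of
   the kernel holds without restriction until that gap leaves the window. *)
Lemma iter_kernel_step_ge i x : i = 0%N \/
  (exists j, [/\ (j < n)%N, (i <= j.+1)%N & (1 <= gapn x j)%R]) ->
  (c ^+ i)%:E * iter i expo_step F x <= iter i kernel_step F x.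
Proof.
elim: i x => [|i IH] x; first by move=> _; rewrite expr0 mul1e.
move=> [//|[j [jn ij xj]]].
have [mk k0] := kernel_iter i; have [me e0] := expo_iter i.
apply: le_trans (kernel_step_ge x mk k0 (gap_only_iter i gF)).
rewrite exprS EFinM -muleA; apply: lee_wpmul2l; first by rewrite lee_fin ltW.
have ci : (0 <= c ^+ i)%R by rewrite exprn_ge0// ltW.
rewrite iterS -ge0_integralZl_EFin//; last exact: measurable_slide_comp.
apply: le_integral_expo.
- by apply: emeasurable_funM => //; exact: measurable_slide_comp.
- by apply: emeasurable_funM; [exact: measurable_slide_comp|exact/measurable_EFinP].
- by move=> s; rewrite mule_ge0.
- by move=> s; rewrite mule_ge0.
move=> s s0; rewrite indicE mem_set; last first.
  by rewrite /= in_itv /= andbT (le_trans _ s0)// (g_le0 jn).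
rewrite mule1; apply: IH.
(* The long gap moves one position towards the old end. From position 0 it leaves the window, but
   then [i = 0]. *)
case: j => [|j] in jn ij xj *; first by left; apply/eqP; rewrite -leqn0 -ltnS.
right; exists j; split=> //; first exact: ltnW.
by rewrite nth_slide ?jn// ltnW.
Qed.

(** Both sides are compared with [K], the mean of [F] over [n] i.i.d. exponential gaps. In the upper
    bound the first of the [n.+1] steps only averages, which leaves [C ^+ n]; in the lower bound it
    costs [c * expR (- lambda)], for a first gap exceeding 1. *)
Lemma iter_kernel_stepS_le x y :
  iter n.+1 kernel_step F x <=
  (C ^+ n / (c ^+ n.+1 * expR (- lambda)))%:E * iter n.+1 kernel_step F y.
Proof.
have [me e0] := expo_iter n; have [mk k0] := kernel_iter n.
pose K := iter n expo_step F y.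
have KE z : iter n expo_step F z = K.
  by apply: expo_step_agree => // i /andP[ni /(leq_ltn_trans ni)]; rewrite ltnn.
have cn : (0 <= c ^+ n)%R by rewrite exprn_ge0// ltW.
have cS : (0 < c ^+ n.+1 * expR (- lambda))%R by rewrite mulr_gt0 ?exprn_gt0 ?expR_gt0.
have K0 : 0 <= K by exact: e0.
have up : iter n.+1 kernel_step F x <= (C ^+ n)%:E * K.
  rewrite iterS /kernel_step -[leRHS]mule1 -(@prob_kernel _ _ _ _ _ W x).
  rewrite -integral_cst// ge0_le_integral//.
  - exact: (measurableT_comp mk (measurable_fun_pair2 x (@measurable_slide _ _ n))).
  - by move=> z _; rewrite -(KE (slide (x, z))) iter_kernel_step_le.
have low : (c ^+ n.+1 * expR (- lambda))%:E * K <= iter n.+1 kernel_step F y.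
  rewrite iterS; apply: le_trans (kernel_step_ge y mk k0 (gap_only_iter n gF)).
  rewrite exprS -mulrA EFinM -muleA; apply: lee_wpmul2l; first by rewrite lee_fin ltW.
  have mI : measurable_fun [set: R] (fun s => (\1_(`]1%R, +oo[%classic : set R) s)%:E : \bar R).
    exact/measurable_EFinP.
  apply: (@le_trans _ _ (\int[expo lambda_gt0]_s
      ((c ^+ n)%:E * K * (\1_(`]1%R, +oo[%classic : set R) s)%:E))).
    rewrite ge0_integralZl//; last by rewrite mule_ge0.
    rewrite integral_indic// setIT [X in _ <= _ * X](expo_gt lambda_gt0 ler01) mulr1.
    by rewrite EFinM muleAC.
  apply: le_integral_expo.
  - exact: emeasurable_funM.
  - by apply: emeasurable_funM; [exact: measurable_slide_comp|exact/measurable_EFinP].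
  - by move=> s; rewrite mule_ge0// mule_ge0.
  - by move=> s; rewrite mule_ge0.
  move=> s s0; rewrite [\1_`]1%R, +oo[ s]indicE; have [s1|_] := boolP (s \in _); last first.
    by rewrite mule0 mule_ge0.
  have {}s1 : (1 < s)%R by move: s1; rewrite inE /= in_itv /= andbT.
  rewrite indicE mem_set; last by rewrite /= in_itv /= andbT (le_trans (g_le1 y))// ltW.
  rewrite !mule1 -(KE (slide (y, mk_state 0 s))); apply: iter_kernel_step_ge.
  (* With a single channel there is no window to hold the long gap, nor any step left. *)
  have [n0|n0] := posnP n; first by left.
  right; exists n.-1; rewrite prednK// leqnn; split=> //.
  by rewrite nth_slide ?prednK// ltnn gap_mk_state ?ltW// (lt_trans ltr01).
apply: le_trans up _; rewrite EFinM -muleA; apply: lee_wpmul2l.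
  by rewrite lee_fin exprn_ge0// ltW.
apply: le_trans (lee_wpmul2l _ low); last by rewrite lee_fin invr_ge0 ltW.
by rewrite muleA -EFinM mulVf ?mul1e// gt_eqF.
Qed.

End bounds.

Lemma condition_U_kernel : condition_U (vector_kernel W).
Proof.
(* The last [n] steps renew the counts in the window, on which [U] may depend; the first [n.+1] are
   those of [iter_kernel_stepS_le]. *)
pose N := (n.+1 + n)%N; pose M0 := (C ^+ n / (c ^+ n.+1 * expR (- lambda)))%R.
have M0_ge0 : (0 <= M0)%R.
  by rewrite divr_ge0 ?exprn_ge0 ?mulr_ge0 ?exprn_ge0 ?expR_ge0// ltW.
(* Only the term of index [N] of the average is kept, whence the factor [N]; the maximum ensures
   [1 <= M]. *)
exists N, N, (Num.max 1 (N%:R * M0))%R; split=> //; first by rewrite le_max lexx.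
move=> x y U mU.
have [mF F0] := step_kernel_ge0_measurable n mU.
have gF : gap_only (step_kernel (vector_kernel W) n ^~ U).
  (* After [i] steps only the entries from position [i] on survive of the initial window, so these
     must coincide, counts included. The other entries act only through their gaps, by way of the
     kernel. *)
  suff h i a b : agree 0 a b -> (forall k, (i <= k < n)%N -> nth point (a : X) k = nth point (b : X) k) ->
      step_kernel (vector_kernel W) i a U = step_kernel (vector_kernel W) i b U.
    move=> a b ab; apply: h => // k /andP[nk /(leq_ltn_trans nk)]; by rewrite ltnn.
  elim: i a b => [|i IH] a b ab ki.
    have -> // : a = b.
    apply: val_inj; apply: (@eq_from_nth _ point); rewrite /= !size_tuple//.
  have [mi i0] := step_kernel_ge0_measurable i mU.
  rewrite /= !integral_vector_kernel// /kernel_step.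
  have -> : \int[W a]_z step_kernel (vector_kernel W) i (slide (a, z)) U =
      \int[W a]_z step_kernel (vector_kernel W) i (slide (b, z)) U.
    apply: eq_integral => z _; apply: IH.
      by apply: agree_slide => // k /andP[_ kn]; exact: ab.
    move=> k /andP[ik kn]; rewrite !nth_slide//; case: ifP => // k1.
    by apply: ki; rewrite ltnS ik.
  by apply: eq_measure_integral => A mA _; exact: W_gap.
have NE z : step_kernel (vector_kernel W) N z U =
    iter n.+1 kernel_step (step_kernel (vector_kernel W) n ^~ U) z.
  by rewrite -step_kernelD.
have bound := iter_kernel_stepS_le mF F0 gF x y.
rewrite -!NE in bound.
apply: le_trans bound _.
have NS : (0 < N)%N by [].
apply: (@le_trans _ _ ((Num.max 1 (N%:R * M0) / N%:R)%R%:E * step_kernel (vector_kernel W) N y U)).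
  apply: lee_wpmul2r; first by have [] := step_kernel_ge0_measurable N mU.
  rewrite lee_fin ler_pdivlMr ?ltr0n// le_max mulrC; apply/orP; right.
  by rewrite mulrC.
apply: lee_wpmul2l.
  by rewrite lee_fin divr_ge0// le_max ler01.
rewrite big_nat_recr//= leeDr// sume_ge0// => i _.
by have [] := step_kernel_ge0_measurable i mU.
Qed.

End uniform.

(** * The Markov property *)

Section measurable_accept_prob.
Context (R : realType) (lambda : R) (q : nat).
Hypothesis lambda_gt0 : 0 < lambda.
Hypothesis q_gt0 : (0 < q)%N.
Context d (S : measurableType d) (r : S -> 'I_q -> R) (a : S -> R).
Hypothesis mr : forall c, measurable_fun [set: S] (fun x => r x c).
Hypothesis ma : measurable_fun [set: S] a.

Lemma measurable_threshold_accept_prob k (D : set R) : measurable D ->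
  measurable_fun [set: S] (fun x =>
    accept_prob lambda (reject_prob (r x)) (reject_int (r x)) k D (a x)).
Proof.
move=> mD.
pose f (z : S * measurableTypeR R) : R :=
  accept_density lambda (reject_prob (r z.1)) (reject_int (r z.1)) k (a z.1) z.2.
have m2 : measurable_fun [set: S * measurableTypeR R] (snd : _ -> R).
  exact: measurable_snd.
have mr1 c : measurable_fun [set: S * measurableTypeR R] (fun z => r z.1 c).
  exact: (measurableT_comp (mr c) measurable_fst).
have ma1 : measurable_fun [set: S * measurableTypeR R] (fun z => a z.1).
  exact: (measurableT_comp ma measurable_fst).
have mf : measurable_fun [set: S * measurableTypeR R] f.
  apply: measurable_funM.
    apply: measurable_funM.
      apply: measurable_funM => //.
      apply: measurableT_comp; first exact: measurable_exponential_pdf.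
      exact: measurable_funB.
    by apply: measurable_funB => //; exact: measurable_reject_prob.
  apply: measurable_funM => //; apply: measurable_funX; apply: measurable_funB.
    exact: measurable_reject_int.
  exact: measurable_reject_int.
pose F (z : S * measurableTypeR R) : \bar R := (f z * \1_D z.2)%:E.
rewrite (_ : (fun _ => _) = fubini_F lebesgue_measure F).
  apply: measurable_fun_fubini_tonelli_F.
    apply/measurable_EFinP; apply: measurable_funM => //.
    by apply: measurableT_comp; [exact: measurable_indic|exact: measurable_snd].
  move=> z; rewrite lee_fin mulr_ge0// accept_density_ge0//.
  - exact: reject_prob_ge0.
  - exact: reject_prob_le1.
  - by move=> x y; exact: integral_reject_prob.
apply/funext => x; rewrite /accept_prob integral_mkcond; apply: eq_integral => s _.
by rewrite patchE /F /f /= indicE; case: ifP => _; rewrite ?mulr1 ?mulr0.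
Qed.

End measurable_accept_prob.

(** * Law of the first accepted message *)

Section first_acceptance.
Context d (Omega : measurableType d) (R : realType) (P : probability Omega R).
Variables (lambda : R) (T : nat -> {RV P >-> R}).
Hypothesis lambda_gt0 : 0 < lambda.
Hypothesis HT : poisson_arrivals lambda T.
Variables (q : nat) (M : nat -> Omega -> 'I_q).
Hypothesis HM : uniform_choices T M.
Hypothesis q_gt0 : (0 < q)%N.

Lemma measurable_past_id J : measurable_fun [set: Omega] (id : Omega -> g_sigma_algebraType (past T M J)).
Proof. by move=> _ A mA; rewrite setTI; exact: (past_measurable HM mA). Qed.

Lemma one_step_sum J (h : 'I_q -> g_sigma_algebraType (past T M J) * measurableTypeR R -> \bar R) :
  (forall c, measurable_fun [set: g_sigma_algebraType (past T M J) * measurableTypeR R] (h c)) ->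
  (forall c z, 0 <= h c z)%E ->
  (\int[P]_w h (M J.+1 w) (w, (T J.+1 w - T J w)%R) =
   \int[P]_w \int[expo lambda_gt0]_u (q%:R^-1%:E * \sum_(c < q) h c (w, u)))%E.
Proof.
move=> mh h0; pose E w : R := T J.+1 w - T J w.
have mE : measurable_fun [set: Omega] (fun w => (w : g_sigma_algebraType (past T M J), E w : measurableTypeR R)).
  apply: measurable_fun_pair; first exact: measurable_past_id.
  by apply: measurable_funB; exact: measurable_funPT.
have mI c : measurable_fun [set: Omega] (fun w => (\1_[set w | M J.+1 w = c] w)%:E : \bar R).
  by apply/measurable_EFinP; apply: measurable_indic; exact: (choice_measurable HM).
have q0 : 0 <= q%:R^-1 :> R by [].
have mF c := @measurable_fun_fubini_tonelli_F _ _ _ _ _ (expo lambda_gt0) (h c) (mh c) (h0 c).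
have mFO c : measurable_fun [set: Omega] (fun w => \int[expo lambda_gt0]_u h c (w, u))%E.
  have H := measurableT_comp (mF c) (@measurable_past_id J); exact: H.
transitivity (\int[P]_w \sum_(c < q) (h c (w, E w) * (\1_[set w | M J.+1 w = c] w)%:E))%E.
  apply: eq_integral => w _; rewrite (bigD1 (M J.+1 w))//= big1 ?adde0.
    by rewrite indicE mem_set// mule1.
  by move=> c /eqP cM; rewrite indicE memNset ?mule0// => /esym.
rewrite ge0_integral_sum//; last 2 first.
- by move=> c; apply: emeasurable_funM => //; exact: (measurableT_comp (mh c) mE).
- by move=> c w _; rewrite mule_ge0// lee_fin.
under eq_bigr => c _ do rewrite (one_step lambda_gt0 HT HM c (mh c) (h0 c)).
rewrite -ge0_sume_distrr; last first.
  by move=> c _; apply: integral_ge0 => w _; exact: integral_ge0.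
rewrite -ge0_integral_sum//; last by move=> c w _; exact: integral_ge0.
rewrite -ge0_integralZl_EFin//; last 2 first.
- by move=> w _; apply: sume_ge0 => c _; exact: integral_ge0.
- exact: emeasurable_sum.
apply: eq_integral => w _.
have mhw c : measurable_fun [set: measurableTypeR R] (fun u => h c (w, u)).
  have H := measurable_fun_pair2 (w : g_sigma_algebraType (past T M J)) (mh c); exact: H.
rewrite ge0_integralZl_EFin//; last 2 first.
- by move=> u _; apply: sume_ge0.
- exact: emeasurable_sum.
by rewrite ge0_integral_sum.
Qed.

Variables (J0 : nat) (r : Omega -> 'I_q -> R).
Hypothesis mr : forall c,
  measurable_fun [set: g_sigma_algebraType (past T M J0)] (fun w => r w c).

Definition elapsed j w : R := T j w - T J0 w.

Definition rejected j w : bool := elapsed j w < r w (M j w).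

Let phi k D (w : Omega) a : \bar R :=
  accept_prob lambda (reject_prob (r w)) (reject_int (r w)) k D a.

Let phi_ge0 k D w a : (0 <= phi k D w a)%E.
Proof.
apply: accept_prob_ge0 => //; [exact: reject_prob_ge0|exact: reject_prob_le1|].
by move=> x y; exact: integral_reject_prob.
Qed.

Let mrJ J c : (J0 <= J)%N ->
  measurable_fun [set: g_sigma_algebraType (past T M J)] (fun w => r w c).
Proof.
by move=> J0J _ B mB; apply: (sub_past J0J); have := mr c measurableT mB.
Qed.

Lemma measurable_elapsed J : (J0 <= J)%N ->
  measurable_fun [set: g_sigma_algebraType (past T M J)] (elapsed J).
Proof. by move=> J0J; apply: measurable_funB; exact: past_time. Qed.

Lemma past_rejected J : (J0 <= J)%N -> <<s past T M J >> [set w | rejected J w].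
Proof.
move=> J0J; pose Y : measurableType _ := g_sigma_algebraType (past T M J).
have -> : [set w | rejected J w] = \bigcup_(c in [set: 'I_q])
    ([set w | M J w = c] `&` [set w | elapsed J w < r w c]).
  apply/seteqP; split=> w /=; first by exists (M J w).
  by move=> [c _ [/= <-]].
apply: (@fin_bigcup_measurable _ Y) => // c _; apply: (@measurableI _ Y).
  exact: past_mark.
apply: (@measurable_set_bool _ Y).
by apply: measurable_fun_ltr; [exact: measurable_elapsed|exact: mrJ].
Qed.

Let reject_probE (p : 'I_q -> R) s : 0 <= s ->
  reject_prob p s = q%:R^-1 * \sum_(c < q) (s < p c)%R%:R.
Proof.
move=> s0; congr (_ * _); apply: eq_bigr => c _; congr (nat_of_bool _)%:R.
by rewrite lt_max [s < 0]ltNge s0 orbF.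
Qed.

Let elapsed_ge0 J w : (J0 <= J)%N -> 0 <= elapsed J w.
Proof. by move=> J0J; rewrite subr_ge0 (arrivals_mono HT). Qed.

Let elapsedS J w : elapsed J.+1 w = elapsed J w + (T J.+1 w - T J w).
Proof. by rewrite /elapsed [RHS]addrC subrKA. Qed.

(** By induction on [k], the base moving from [J] to [J.+1]: the rejection of message [J.+1] is
    known at [J.+1] and is absorbed into [G]. This is why [J] is distinguished from [J0], at which
    the thresholds are fixed. *)
Lemma first_acceptance k J G (D : set R) : (J0 <= J)%N ->
  <<s past T M J >> G -> measurable D ->
  P (G `&` [set w | [/\ forall i, (i < k)%N -> rejected (J.+1 + i) w,
      ~~ rejected (J.+1 + k) w & D (elapsed (J.+1 + k) w)]]) =
  (\int[P]_(w in G) phi k D w (elapsed J w))%E.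
Proof.
move=> J0J sG mD; pose Y i : measurableType _ := g_sigma_algebraType (past T M i).
have mG_ i A : <<s past T M i >> A -> measurable_fun [set: Y i] (\1_A : _ -> R).
  by move=> sA; apply: (@measurable_indic _ (Y i)).
have mind : measurable_fun [set: R] (\1_D : _ -> R) by exact: measurable_indic.
have indic_int A (f : Omega -> \bar R) :
    (\int[P]_(w in A) f w = \int[P]_w ((\1_A w)%:E * f w))%E.
  rewrite integral_mkcond; apply: eq_integral => w _; rewrite patchE indicE.
  by case: ifP => _; rewrite ?mul1e ?mul0e.
have msum i : (J0 <= i)%N -> measurable_fun [set: Y i * measurableTypeR R]
    (fun z => elapsed i z.1 + z.2).
  move=> J0i; apply: measurable_funD; last exact: measurable_snd.
  exact: (measurableT_comp (measurable_elapsed J0i) measurable_fst).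
have mr1 i c : (J0 <= i)%N -> measurable_fun [set: Y i * measurableTypeR R]
    (fun z => r z.1 c).
  by move=> J0i; exact: (measurableT_comp (mrJ c J0i) measurable_fst).
have mr2 i c : (J0 <= i)%N -> measurable_fun [set: Y i * measurableTypeR R]
    (fun z => (elapsed i z.1 + z.2 < r z.1 c)%R%:R : R).
  by move=> J0i; apply: measurable_natb; apply: measurable_fun_ltr; [exact: msum|exact: mr1].
elim: k J G J0J sG => [|k IH] J G J0J sG.
  set A := _ `&` _.
  pose h c (z : Y J * measurableTypeR R) : \bar R :=
    (\1_G z.1 * (1 - (elapsed J z.1 + z.2 < r z.1 c)%R%:R) * \1_D (elapsed J z.1 + z.2))%:E.
  have J0J1 : (J0 <= J.+1)%N by rewrite leqW.
  have AE : A = G `&` ~` [set w | rejected J.+1 w] `&` (elapsed J.+1 @^-1` D).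
    rewrite -setIA; congr (_ `&` _); apply/seteqP; split=> w /=; rewrite addn0.
      by move=> [_ /negP].
    by move=> [/negP].
  have mA : measurable A.
    rewrite AE; apply: measurableI.
      apply: measurableI; first exact: (past_measurable HM sG).
      by apply: measurableC; exact: (past_measurable HM (past_rejected J0J1)).
    by apply: (past_measurable HM (J := J.+1)); have := measurable_elapsed J0J1 measurableT mD; rewrite setTI.
  have h0 c z : (0 <= h c z)%E.
    by rewrite lee_fin !mulr_ge0// subr_ge0; case: (_ < _).
  have mh c : measurable_fun [set: Y J * measurableTypeR R] (h c).
    apply/measurable_EFinP; apply: measurable_funM; last exact: (measurableT_comp mind (msum _ J0J)).
    apply: measurable_funM; first exact: (measurableT_comp (mG_ _ _ sG) measurable_fst).
    by apply: measurable_funB => //; exact: mr2.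
  transitivity (\int[P]_w h (M J.+1 w) (w, (T J.+1 w - T J w)%R))%E.
    transitivity (\int[P]_w (\1_A w)%:E)%E; first by rewrite integral_indic// setIT.
    apply: eq_integral => w _.
    rewrite /h /= -elapsedS AE !indicI indicC; congr EFin.
    have -> : (elapsed J.+1 w < r w (M J.+1 w)) = (w \in [set w0 | rejected J.+1 w0]).
      by apply/idP/idP; rewrite inE.
    rewrite /=; congr (_ * _ * _).
    by case: (w \in _); rewrite /= ?subrr ?subr0.
  rewrite one_step_sum// [RHS]indic_int; apply: eq_integral => w _.
  rewrite [in RHS]indicE; have [wG|wG] := boolP (w \in G); last first.
    rewrite mul0e integral0_eq// => u _; rewrite big1 ?mule0// => c _.
    by rewrite /h /= indicE (negbTE wG) !mul0r.
  have mrej : measurable_fun [set: R] (reject_prob (r w)) by exact: measurable_reject_prob.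
  have p0 := reject_prob_ge0 (r w); have p1 := reject_prob_le1 q_gt0 (r w).
  rewrite mul1e /phi (accept_prob0 lambda_gt0)//.
  have mu1 c : measurable_fun [set: measurableTypeR R] (fun u => h c (w, u)).
    have H := measurable_fun_pair2 (w : Y J) (mh c); exact: H.
  have msh : measurable_fun [set: R] (fun u => elapsed J w + u) by exact: measurable_funD.
  apply: eq_integral_expo.
  - by apply: emeasurable_funM => //; exact: emeasurable_sum.
  - apply/measurable_EFinP; apply: measurable_funM; last exact: (measurableT_comp mind msh).
    by apply: measurable_funB => //; exact: (measurableT_comp mrej msh).
  - by move=> u; rewrite mule_ge0// sume_ge0.
  - by move=> u; rewrite lee_fin mulr_ge0// subr_ge0 reject_prob_le1.
  move=> u u0; have a0 : 0 <= elapsed J w + u by apply: addr_ge0 => //; exact: elapsed_ge0.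
  rewrite (reject_probE _ a0).
  rewrite sumEFin -EFinM; congr EFin; rewrite /h /= indicE wG.
  under eq_bigr do rewrite mul1r.
  rewrite -mulr_suml mulrA; congr (_ * _); rewrite sumrB mulrBr sumr_const card_ord.
  by rewrite mulVf// pnatr_eq0 -lt0n.
pose G' := G `&` [set w | rejected J.+1 w].
have J0J1 : (J0 <= J.+1)%N by rewrite leqW.
have sG' : <<s past T M J.+1 >> G'.
  apply: (@measurableI _ (Y J.+1)); last exact: past_rejected.
  exact: (sub_past (leqnSn J) sG).
have -> : G `&` [set w | [/\ forall i, (i < k.+1)%N -> rejected (J.+1 + i) w,
      ~~ rejected (J.+1 + k.+1) w & D (elapsed (J.+1 + k.+1) w)]] =
    G' `&` [set w | [/\ forall i, (i < k)%N -> rejected (J.+2 + i) w,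
      ~~ rejected (J.+2 + k) w & D (elapsed (J.+2 + k) w)]].
  rewrite -setIA; congr (_ `&` _); apply/seteqP; split=> w /=.
    rewrite -addSnnS => -[rej nrej Dk]; split; first by have := rej 0%N isT; rewrite addn0.
    by split=> // i ik; rewrite addSnnS; apply: rej.
  rewrite -addSnnS => -[rej0 [rej nrej Dk]]; split=> // -[|i] ik; first by rewrite addn0.
  by rewrite -addSnnS; exact: rej.
rewrite (IH _ _ J0J1 sG').
pose h c (z : Y J * measurableTypeR R) : \bar R :=
  ((\1_G z.1 * (elapsed J z.1 + z.2 < r z.1 c)%R%:R)%:E * phi k D z.1 (elapsed J z.1 + z.2))%E.
have h0 c z : (0 <= h c z)%E by rewrite mule_ge0// lee_fin mulr_ge0.
have mh c : measurable_fun [set: Y J * measurableTypeR R] (h c).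
  apply: emeasurable_funM.
    apply/measurable_EFinP; apply: measurable_funM; last exact: mr2.
    exact: (measurableT_comp (mG_ _ _ sG) measurable_fst).
  apply: measurable_threshold_accept_prob => //; first by move=> c'; exact: mr1.
  exact: msum.
transitivity (\int[P]_w h (M J.+1 w) (w, (T J.+1 w - T J w)%R))%E.
  rewrite [LHS]indic_int; apply: eq_integral => w _.
  rewrite /h /= -elapsedS /G' indicI /=; congr (_%:E * _)%E; congr (_ * _).
  rewrite indicE; congr (nat_of_bool _)%:R.
  by apply/idP/idP; rewrite inE.
(* Averaging over the interarrival time and the mark of message [J.+1] yields the recursion
   [accept_probS]. *)
rewrite one_step_sum// [RHS]indic_int; apply: eq_integral => w _.
rewrite [in RHS]indicE; have [wG|wG] := boolP (w \in G); last first.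
  rewrite mul0e integral0_eq// => u _; rewrite big1 ?mule0// => c _.
  by rewrite /h /= indicE (negbTE wG) mul0r mul0e.
have mrej : measurable_fun [set: R] (reject_prob (r w)) by exact: measurable_reject_prob.
have mint : measurable_fun [set: R] (reject_int (r w)) by exact: measurable_reject_int.
have PE a b : a <= b -> (\int[lebesgue_measure]_u (reject_prob (r w) u * (a <= u <= b)%R%:R)%:E =
    (reject_int (r w) b - reject_int (r w) a)%:E)%E.
  exact: integral_reject_prob.
have p0 := reject_prob_ge0 (r w); have p1 := reject_prob_le1 q_gt0 (r w).
rewrite mul1e /phi (accept_probS lambda_gt0)//.
have msh : measurable_fun [set: R] (fun u => elapsed J w + u) by exact: measurable_funD.
have mphi : measurable_fun [set: R] (phi k D w).
  exact: measurable_accept_prob.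
apply: eq_integral_expo.
- apply: emeasurable_funM => //; apply: emeasurable_sum => c.
  have H := measurable_fun_pair2 (w : Y J) (mh c); exact: H.
- apply: emeasurable_funM; last exact: (measurableT_comp mphi msh).
  by apply/measurable_EFinP; exact: (measurableT_comp mrej msh).
- by move=> u; rewrite mule_ge0// sume_ge0.
- by move=> u; apply: mule_ge0; [rewrite lee_fin|exact: phi_ge0].
move=> u u0; have a0 : 0 <= elapsed J w + u by apply: addr_ge0 => //; exact: elapsed_ge0.
rewrite (reject_probE _ a0).
rewrite -ge0_sume_distrl; last by move=> c _; rewrite lee_fin mulr_ge0.
rewrite muleA; congr (_ * _)%E; rewrite sumEFin -EFinM; congr EFin.
by congr (_ * _); apply: eq_bigr => c _; rewrite /= indicE wG mul1r.
Qed.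

Lemma measurable_first_acceptance k J (D : set R) : (J0 <= J)%N -> measurable D ->
  measurable [set w | [/\ forall i, (i < k)%N -> rejected (J.+1 + i) w,
    ~~ rejected (J.+1 + k) w & D (elapsed (J.+1 + k) w)]].
Proof.
move=> J0J mD; have mrej i : measurable [set w | rejected (J.+1 + i) w].
  apply: (past_measurable HM (J := (J.+1 + i)%N)); apply: past_rejected.
  by rewrite (leq_trans J0J)// ltnW// leq_addr.
have -> : [set w | [/\ forall i, (i < k)%N -> rejected (J.+1 + i) w,
    ~~ rejected (J.+1 + k) w & D (elapsed (J.+1 + k) w)]] =
    \bigcap_(i in `I_k) [set w | rejected (J.+1 + i) w] `&`
    (~` [set w | rejected (J.+1 + k) w] `&` (elapsed (J.+1 + k) @^-1` D)).
  apply/seteqP; split=> w /=; first by move=> [rej /negP nrej Dk].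
  by move=> [rej [/negP nrej Dk]].
apply: measurableI; first exact: bigcap_measurableType.
apply: measurableI; first exact: measurableC.
rewrite -[X in measurable X]setTI.
by apply: measurable_funB => //; exact: measurable_funPT.
Qed.

End first_acceptance.

(** * Admittances as stopping times and the transition law *)

Section chain.
Context d (Omega : measurableType d) (R : realType) (P : probability Omega R).
Variables (lambda : R) (T : nat -> {RV P >-> R}).
Hypothesis lambda_gt0 : 0 < lambda.
Hypothesis HT : poisson_arrivals lambda T.
Variables (q : nat) (M : nat -> Omega -> 'I_q).
Hypothesis HM : uniform_choices T M.
Hypothesis q_gt0 : (0 < q)%N.
Variables (kappa : nat) (accepts : {set 'I_kappa} -> 'I_kappa -> bool).
Variable C : nat -> Omega -> 'I_kappa.

Local Notation t w := (fun j => T j w).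
Local Notation c w := (fun j => C j w).
Local Notation adm w := (admitted accepts (t w) (c w)).
Local Notation idx i w := (admitted_index accepts (t w) (c w) i).
Local Notation F J := (g_sigma_algebraType (past T M J)).

Hypothesis idle_admitted : forall w j,
  idle accepts (t w) (c w) j = [set: 'I_kappa]%SET -> adm w j.
Hypothesis past_admitted : forall j, <<s past T M j >> [set w | adm w j].

Let t0 w : T 0%N w = 0. Proof. exact: (arrival0 HT). Qed.
Let t_lt w j : T j w < T j.+1 w. Proof. exact: (arrival_lt HT). Qed.
Let t_cvg w : T j w @[j --> \oo] --> +oo. Proof. exact: (arrival_cvg HT). Qed.

Let idx_lt i w : (idx i w < idx i.+1 w)%N.
Proof. exact: (admitted_index_lt (t0 w) (t_lt w) (t_cvg w) (@idle_admitted w)). Qed.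

Let idx_le i l w : (i <= l)%N -> (idx i w <= idx l w)%N.
Proof.
by apply: (@homo_leq _ (fun i => idx i w) leq leqnn leq_trans) => k; exact/ltnW/idx_lt.
Qed.

Let idxS i w j : idx i.+1 w = j <-> [/\ (idx i w < j)%N, adm w j &
  forall l, (idx i w < l < j)%N -> ~~ adm w l].
Proof. exact: (next_admittedE (t0 w) (t_lt w) (t_cvg w) (@idle_admitted w)). Qed.

Let data i w : admission_data accepts (t w) (c w) i =
  ((idx i.+1 w - idx i w)%N, T (idx i.+1 w) w - T (idx i w) w).
Proof. exact: (admission_dataE (t0 w) (t_lt w) (t_cvg w) (@idle_admitted w)). Qed.

Let data_pos i w : let x := ((idx i.+1 w - idx i w)%N, T (idx i.+1 w) w - T (idx i w) w : R) in
  (0 < x.1)%N && (0 < x.2).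
Proof. by rewrite /= subn_gt0 idx_lt subr_gt0 (arrivals_monolt HT) idx_lt. Qed.

Definition admission_state i w : state R :=
  exist (fun x : nat * R => (0 < x.1)%N && (0 < x.2)) _ (data_pos i w).

Lemma admission_stateE i w : state_val (admission_state i w) =
  admission_data accepts (t w) (c w) i.
Proof. by rewrite data. Qed.

Local Notation X := admission_state.

(** [idx i] is a stopping time, decided by the admissions up to [J]; [past_history] then places the
    history in the past stopped at it. *)
Lemma past_index i J : <<s past T M J >> [set w | idx i w = J].
Proof.
elim: i J => [|i IH] J.
  case: J => [|J].
    rewrite (_ : [set _ | _] = setT); first exact: (@measurableT _ (F 0)).
    by apply/seteqP; split.
  rewrite (_ : [set _ | _] = set0); first exact: (@measurable0 _ (F J.+1)).
  by apply/seteqP; split.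
have -> : [set w | idx i.+1 w = J] = \bigcup_(a in `I_J)
   ([set w | idx i w = a] `&` ([set w | adm w J] `&`
     \bigcap_(l in [set l | (a < l < J)%N]) ~` [set w | adm w l])).
  apply/seteqP; split=> w /=.
    move=> /idxS[iJ aJ na]; exists (idx i w) => //=; do 2 split=> //.
    by move=> l /na /negP.
  move=> [a /= aJ [/= ia [Ja na]]]; apply/idxS; rewrite ia; split=> // l la.
  by apply/negP; exact: na.
apply: (@fin_bigcup_measurable _ (F J)) => // a /= aJ.
apply: (@measurableI _ (F J)); first exact: (sub_past (ltnW aJ) (IH a)).
apply: (@measurableI _ (F J)) ; first exact: past_admitted.
apply: (@bigcap_measurableType _ (F J) (fun l => ~` [set w | adm w l])
  [set l | (a < l < J)%N]) => l /andP[_ /ltnW lJ].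
by apply: (@measurableC _ (F J)); exact: (sub_past lJ (@past_admitted l)).
Qed.

Lemma past_admission_state i l J V : (l < i)%N -> measurable V ->
  <<s past T M J >> ([set w | idx i w = J] `&` X l @^-1` V).
Proof.
move=> li [B mB <-]; rewrite setTI.
have -> : [set w | idx i w = J] `&` X l @^-1` (@state_val R @^-1` B) =
  \bigcup_(a in `I_J.+1) \bigcup_(b in `I_J.+1) ([set w | idx i w = J] `&`
    ([set w | idx l w = a] `&` ([set w | idx l.+1 w = b] `&`
      [set w | B ((b - a)%N, T b w - T a w)]))).
  apply/seteqP; split=> w /=.
    move=> [iJ Bw]; exists (idx l w); first by rewrite /= ltnS -iJ; exact: idx_le (ltnW li).
    by exists (idx l.+1 w); first by rewrite /= ltnS -iJ; exact: idx_le li.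
  by move=> [a _ [b _ [/= -> [/= la [/= lb Bab]]]]]; split=> //; rewrite lb la.
apply: (@fin_bigcup_measurable _ (F J)) => // a /= aJ.
apply: (@fin_bigcup_measurable _ (F J)) => // b /= bJ.
apply: (@measurableI _ (F J)); first exact: (@past_index i J).
apply: (@measurableI _ (F J)); first exact: (sub_past (aJ : (a <= J)%N) (@past_index l a)).
apply: (@measurableI _ (F J)); first exact: (sub_past (bJ : (b <= J)%N) (@past_index l.+1 b)).
have mab : measurable_fun [set: F J] (fun w => ((b - a)%N, T b w - T a w : R)).
  apply: measurable_fun_pair => //.
  by apply: measurable_funB; exact: past_time.
by have := mab (@measurableT _ (F J)) _ mB; rewrite setTI.
Qed.

Lemma measurable_admission_state i : measurable_fun [set: Omega] (X i).
Proof.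
move=> _ V mV; rewrite setTI.
have -> : X i @^-1` V = \bigcup_J ([set w | idx i.+1 w = J] `&` X i @^-1` V).
  by apply/seteqP; split=> [w Vw|w [J _ []]//]; exists (idx i.+1 w).
apply: bigcupT_measurable => J; apply: (past_measurable HM (J := J)).
exact: past_admission_state.
Qed.

Lemma past_history i J D :
  <<s \bigcup_(j < i) g_sigma_algebra_preimage (X j) >> D ->
  <<s past T M J >> ([set w | idx i w = J] `&` D).
Proof.
move: D; apply: (@smallest_sub _ (sigma_algebra setT) _
  [set D | <<s past T M J >> ([set w | idx i w = J] `&` D)]).
  exact: (@sigma_algebra_setI _ (F J) _ (@past_index i J)).
move=> _ [l /= li [V mV <-]] /=; rewrite setTI.
exact: past_admission_state.
Qed.

Section transition.
Local Notation n := kappa.-1.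
Variable rho : n.-tuple (state R) -> 'I_q -> R.
Hypothesis mrho : forall a, measurable_fun [set: n.-tuple (state R)] (fun x => rho x a).

Local Notation hist i w := [tuple X (i - n + j)%N w | j < n].

(** What a model has to provide: thresholds known at message [J] that decide every message up to the
    next admittance. They are matched with [rho] through [reject_prob] only, hence up to order,
    since the gaps do not tell which channel carries which threshold. *)
Hypothesis thresholds : forall i J, (n <= i)%N -> exists r : Omega -> 'I_q -> R,
  (forall a, measurable_fun [set: F J] (fun w => r w a)) /\
  forall w, idx i w = J ->
    (forall j, (J < j)%N -> (forall l, (J < l < j)%N -> ~~ adm w l) ->
       adm w j = ~~ (T j w - T J w < r w (M j w))) /\
    (forall s, 0 <= s -> reject_prob (r w) s = reject_prob (rho (hist i w)) s).

Local Notation W := (waiting_kernel lambda_gt0 q_gt0 mrho).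

Let measurable_hist i : measurable_fun [set: Omega] (fun w => hist i w).
Proof.
apply/measurable_fun_tnthP => j.
rewrite (_ : _ \o _ = X (i - n + j)%N); first exact: measurable_admission_state.
by apply/funext => w /=; rewrite tnth_mktuple.
Qed.

Lemma reject_int_eq (r r' : 'I_q -> R) s :
  (forall u, 0 <= u -> reject_prob r u = reject_prob r' u) -> 0 <= s ->
  reject_int r s = reject_int r' s.
Proof.
move=> rr s0; have E r0 : (reject_int r0 s)%:E =
    (\int[lebesgue_measure]_u (reject_prob r0 u * (0 <= u <= s)%R%:R)%:E)%E.
  by rewrite integral_reject_prob// reject_int0 subr0.
apply: EFin_inj; rewrite !E; apply: eq_integral => u _.
by have [u0|u0] := leP 0 u; rewrite ?mulr0//= rr.
Qed.

Lemma transition_law i D U : (n <= i)%N ->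
  <<s \bigcup_(j < i) g_sigma_algebra_preimage (X j) >> D -> measurable U ->
  P (D `&` X i @^-1` U) = (\int[P]_(w in D) W (hist i w) U)%E.
Proof.
move=> ni sD mU.
pose G J := [set w | idx i w = J] `&` D.
have sG J : <<s past T M J >> (G J) by exact: past_history.
have mG J : measurable (G J) by exact: (past_measurable HM (sG J)).
have tG : trivIset setT G.
  apply/trivIsetP => J K _ _ /eqP JK; apply/seteqP; split=> // w [[/= iJ _] [/= iK _]].
  by apply: JK; rewrite -iJ -iK.
have DG : D = \bigcup_J G J.
  by apply/seteqP; split=> [w Dw|w [J _ []]//]; exists (idx i w).
have mD : measurable D by rewrite DG; exact: bigcupT_measurable.
have mXU : measurable (X i @^-1` U).
  by rewrite -[X in measurable X]setTI; exact: measurable_admission_state.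
have mWU : measurable_fun [set: Omega] (fun w => W (hist i w) U).
  by apply: (measurableT_comp (measurable_kernel W U mU)); exact: measurable_hist.
transitivity (\sum_(0 <= J <oo) P (G J `&` X i @^-1` U))%E.
  rewrite {1}DG setI_bigcupl measure_semi_bigcup//.
  - by move=> J; exact: measurableI.
  - exact: trivIset_setIr.
  - by apply: bigcupT_measurable => J; exact: measurableI.
transitivity (\sum_(0 <= J <oo) \int[P]_(w in G J) W (hist i w) U)%E; last first.
  rewrite [in RHS]DG ge0_integral_bigcup//; first exact: measurable_funTS.
apply: eq_eseriesr => J _.
have [r [mr rP]] := thresholds J ni.
pose A k := [set w | [/\ forall l, (l < k)%N -> rejected T M J r (J.+1 + l) w,
   ~~ rejected T M J r (J.+1 + k) w &
   (mk_state k @^-1` U) (elapsed T J (J.+1 + k) w)]].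
have idxA w k : G J w -> idx i.+1 w = (J.+1 + k)%N <->
    (forall l, (l < k)%N -> rejected T M J r (J.+1 + l) w) /\
    ~~ rejected T M J r (J.+1 + k) w.
  move=> [/= iJ _]; have [admE _] := rP w iJ.
  have rejE l : (forall m, (m < l)%N -> ~~ adm w (J.+1 + m)) ->
      adm w (J.+1 + l)%N = ~~ rejected T M J r (J.+1 + l) w.
    move=> na; rewrite admE// ?leq_addr// => m /andP[Jm ml].
    by rewrite -(subnKC Jm); apply: na; rewrite ltn_subLR.
  split.
    move=> /idxS; rewrite iJ => -[_ aJk na].
    have na' l : (l < k)%N -> ~~ adm w (J.+1 + l).
      by move=> lk; apply: na; rewrite leq_addr ltn_add2l.
    split=> [l lk|]; last by rewrite -rejE.
    have := na' _ lk; rewrite rejE ?negbK// => m ml.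
    by apply: na'; exact: ltn_trans lk.
  move=> [rej nrej].
  have na l : (l < k)%N -> ~~ adm w (J.+1 + l).
    elim/ltn_ind: l => l IH lk; rewrite rejE ?negbK ?rej// => m ml.
    by apply: IH => //; exact: ltn_trans lk.
  apply/idxS; rewrite iJ; split; first by rewrite leq_addr.
    by rewrite rejE.
  by move=> l /andP[Jl lk]; rewrite -(subnKC Jl) na// ltn_subLR.
have XU k w : G J w -> idx i.+1 w = (J.+1 + k)%N ->
    X i w = mk_state k (elapsed T J (J.+1 + k) w).
  move=> [/= iJ _] iJk; apply: state_val_inj; rewrite mk_stateE; last first.
    by rewrite subr_gt0 (arrivals_monolt HT) leq_addr.
  by rewrite /state_val /= iJk iJ addSnnS addKn.
have GA : G J `&` X i @^-1` U = \bigcup_k (G J `&` A k).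
  apply/seteqP; split=> w /=.
    move=> [Gw Uw]; have iJ : idx i w = J by case: Gw.
    have Ji : (J < idx i.+1 w)%N by rewrite -iJ idx_lt.
    exists (idx i.+1 w - J.+1)%N => //; split=> //.
    have iE : idx i.+1 w = (J.+1 + (idx i.+1 w - J.+1))%N by rewrite subnKC.
    have [rej nrej] := (idxA w _ Gw).1 iE; split=> //=.
    by rewrite -(XU _ _ Gw iE).
  move=> [k _ [Gw [rej nrej Uk]]]; split=> //.
  by rewrite /= (XU _ _ Gw ((idxA w k Gw).2 (conj rej nrej))).
have mV k : measurable (mk_state k @^-1` U : set R).
  by rewrite -[X in measurable X]setTI; exact: measurable_mk_state.
have law k := first_acceptance lambda_gt0 HT HM q_gt0 mr k (leqnn J) (sG J) (mV k).
have mA k : measurable (G J `&` A k).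
  by apply: measurableI => //; exact: (measurable_first_acceptance HM mr).
have tA : trivIset setT (fun k => G J `&` A k).
  apply/trivIsetP => k l _ _ /eqP kl; apply/seteqP; split=> // w.
  move=> [[Gw [rk nk _]] [_ [rl nl _]]]; apply: kl; apply: (@addnI J.+1).
  by rewrite -((idxA w k Gw).2 (conj rk nk)) -((idxA w l Gw).2 (conj rl nl)).
rewrite GA measure_semi_bigcup//; last exact: bigcupT_measurable.
pose f k w := accept_prob lambda (reject_prob (r w)) (reject_int (r w)) k
  (mk_state k @^-1` U) (elapsed T J J w).
have mf k : measurable_fun (G J) (f k).
  apply: measurable_funTS.
  have mF : measurable_fun [set: F J] (f k).
    by apply: measurable_threshold_accept_prob => //; exact: measurable_elapsed.
  have H := measurableT_comp mF (measurable_past_id HM (J := J)); exact: H.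
have f0 k w : G J w -> (0 <= f k w)%E.
  move=> _; apply: accept_prob_ge0 => //; [exact: reject_prob_ge0|exact: reject_prob_le1|].
  by move=> x y; exact: integral_reject_prob.
transitivity (\int[P]_(w in G J) \sum_(0 <= k <oo) f k w)%E.
  by rewrite (integral_nneseries P (mG J) mf f0); apply: eq_eseriesr => k _; exact: law.
apply: eq_integral => w /set_mem [/= iJ _]; rewrite waiting_kernelE.
have [_ rr] := rP w iJ.
apply: eq_eseriesr => k _; rewrite /f /accept_prob /elapsed subrr.
apply: eq_integral => s _; congr EFin.
rewrite /waiting_density /accept_density subr0.
(* For [s >= 0] the values of [reject_prob] on [[0, s]] determine its primitive; for [s < 0] the
   exponential density vanishes. *)
have [s0|s0] := leP 0 s; last by rewrite lt0_exponential_pdf// mulr0 !mul0r.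
by rewrite rr// !reject_int0 (reject_int_eq rr).
Qed.

End transition.
End chain.

(** * The kernels of ALOHA and CSMA *)

(** A finite set is null, and [f], which modifies [g] on it, inherits measurability. This serves
    ALOHA, where the stated density and the rejection probability may disagree at the ends of
    services. *)
Lemma eq_integral_finite (R : realType) (D N : set R) (f g : R -> \bar R) :
  measurable D -> finite_set N -> measurable_fun D g ->
  (forall s, D s -> ~ N s -> f s = g s) ->
  (\int[lebesgue_measure]_(s in D) f s = \int[lebesgue_measure]_(s in D) g s)%E.
Proof.
move=> mD fN mg fg.
have mfin (A : set R) : finite_set A -> measurable A.
  move=> fA; rewrite (_ : A = \bigcup_(a in A) [set a]).
    by apply: fin_bigcup_measurable.
  by apply/seteqP; split=> [a Aa|a [b Ab ->]//]; exists a.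
have mf : measurable_fun D f.
  move=> _ B mB.
  have -> : D `&` f @^-1` B = ((D `&` g @^-1` B) `\` N) `|` (D `&` f @^-1` B `&` N).
    apply/seteqP; split=> s /=.
      by move=> [Ds Bs]; have [Ns|Ns] := pselect (N s); [right|left; rewrite -fg].
    by move=> [[[Ds Bs] Ns]|[]//]; split=> //; rewrite fg.
  apply: measurableU; last by apply: mfin; exact: sub_finite_set fN.
  by apply: measurableD; [exact: mg|exact: mfin].
apply: ae_eq_integral => //; exists N; split; first exact: mfin.
  by apply: countable_lebesgue_measure0; exact: finite_set_countable.
by move=> s /= /not_implyP[Ds fgs]; apply: contrapT => Ns; apply: fgs; exact: fg.
Qed.

Lemma integral_positive (R : realType) (A : set R) (f : R -> R) :
  measurable A -> measurable_fun [set: R] f -> (forall s, s < 0 -> f s = 0) ->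
  (\int[lebesgue_measure]_(s in A) (f s)%:E =
   \int[lebesgue_measure]_(s in A `&` `]0%R, +oo[) (f s)%:E)%E.
Proof.
move=> mA mf fneg.
have mE (B : set R) : measurable B ->
    measurable_fun [set: R] ((fun s => (f s)%:E) \_ B).
  move=> mB; apply/(measurable_restrict _ _ _).1 => //; rewrite setTI.
  by apply: measurable_funTS; exact/measurable_EFinP.
rewrite integral_mkcond [RHS]integral_mkcond.
apply: (@eq_integral_finite _ _ [set 0]) => //.
  by apply: mE; exact: measurableI.
move=> s _ /= /eqP s0; rewrite !patchE in_setI.
have [->|s_le0] : (s \in (`]0, +oo[%classic : set R)) \/ s < 0.
- have [s_gt0|//|s_eq0] := ltgtP s 0; [by right|left|by rewrite s_eq0 eqxx in s0].
  by rewrite inE /= in_itv /= andbT.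
- by rewrite andbT.
by rewrite fneg// !if_same.
Qed.

Section uniform_waiting.
Context (R : realType) (lambda : R) (n q : nat).
Hypothesis lambda_gt0 : 0 < lambda.
Hypothesis q_gt0 : (0 < q)%N.
Local Notation X := (n.-tuple (state R)).
Variable rho : X -> 'I_q -> R.
Hypothesis mrho : forall a, measurable_fun [set: X] (fun x => rho x a).
Hypothesis rho_le1 : forall x a, rho x a <= 1.
Local Notation mu := (@lebesgue_measure R).
Local Notation W := (waiting_kernel lambda_gt0 q_gt0 mrho).

Lemma waiting_integral_gap k x (B : set R) : measurable B ->
  (\int[mu]_(s in mk_state k @^-1` (@gap R @^-1` B)) (waiting_density lambda rho k x s)%:E =
   \int[mu]_(s in B `&` `]0%R, +oo[) (waiting_density lambda rho k x s)%:E)%E.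
Proof.
move=> mB; rewrite integral_positive; first last.
- move=> s s0; rewrite /waiting_density /accept_density subr0 lt0_exponential_pdf//.
  by rewrite mulr0 !mul0r.
- exact: measurable_waiting_density.
- rewrite -[X in measurable X]setTI; apply: measurable_mk_state => //.
  by rewrite -[X in measurable X]setTI; exact: measurable_gap.
congr (integral _ _ _); apply/seteqP; split=> s [/= Bs s0]; split=> //;
  by move: Bs; rewrite gap_mk_state//; move: s0; rewrite in_itv /= andbT.
Qed.

(** Origin of the constant [expR lambda]: with thresholds at most 1, both [1 - p] and the power of
    the primitive are at most 1, which leaves the exponential density times a coefficient of the
    exponential series. *)
Lemma waiting_density_le k x s : 0 <= s ->
  waiting_density lambda rho k x s <= exp_coeff lambda k * exponential_pdf lambda s.
Proof.
move=> s0; rewrite /waiting_density /accept_density subr0 reject_int0 subr0 /exp_coeff /=.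
have pdf0 := exponential_pdf_ge0 (ltW lambda_gt0) s.
have l0 : 0 <= lambda ^+ k by rewrite exprn_ge0// ltW.
have p0 := reject_prob_ge0 (rho x) s.
have p1 := reject_prob_le1 q_gt0 (rho x) s.
have P0 : 0 <= reject_int (rho x) s.
  by rewrite mulr_ge0// sumr_ge0// => c _; rewrite le_min s0 le_max lexx orbT.
have P1 : reject_int (rho x) s <= 1.
  rewrite /reject_int ler_pdivrMl ?ltr0n// mulr1 -[in leRHS](card_ord q) -sumr_const.
  by apply: ler_sum => c _; rewrite ge_min ge_max rho_le1 ler01.
have f0 : (0 <= k`!%:R^-1 :> R) by rewrite invr_ge0.
have c0 : 0 <= lambda ^+ k * exponential_pdf lambda s * k`!%:R^-1 by rewrite !mulr_ge0.
rewrite [leRHS]mulrAC -[leRHS]mulr1.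
rewrite [leLHS](_ : _ = lambda ^+ k * exponential_pdf lambda s * k`!%:R^-1 *
  ((1 - reject_prob (rho x) s) * reject_int (rho x) s ^+ k)); last by ring.
rewrite ler_wpM2l// -[leRHS]mulr1 ler_pM ?subr_ge0 ?exprn_ge0//.
  by rewrite gerBl.
by rewrite exprn_ile1.
Qed.

Lemma waiting_kernel_le x (B : set R) : measurable B ->
  (W x (@gap R @^-1` B) <= (expR lambda)%:E * expo lambda_gt0 B)%E.
Proof.
move=> mB; rewrite waiting_kernelE.
have l0 := ltW lambda_gt0.
have pdf0 s : (0 <= (exponential_pdf lambda s)%:E)%E.
  by rewrite lee_fin exponential_pdf_ge0.
have mpdf (A : set R) : measurable_fun A (fun s => (exponential_pdf lambda s)%:E).
  by apply: measurable_funTS; apply/measurable_EFinP; exact: measurable_exponential_pdf.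
have -> : (expR lambda)%:E = (\sum_(0 <= k <oo) (exp_coeff lambda k)%:E)%E.
  rewrite /expR; apply/esym; rewrite -EFin_lim//; last exact: is_cvg_series_exp_coeff.
  by congr (limn _); apply/funext => k; rewrite /= sumEFin.
rewrite muleC -[expo _ _](@fineK R) ?fin_num_measure// -nneseriesZl; last first.
  by move=> k _; rewrite lee_fin exp_coeff_ge0.
apply: lee_nneseries => k _; first by move=> *; apply: integral_ge0 => s _; rewrite lee_fin;
  exact: waiting_density_ge0.
rewrite fineK ?fin_num_measure// waiting_integral_gap// muleC.
have mBp : measurable (B `&` `]0, +oo[) by exact: measurableI.
apply: (@le_trans _ _ (\int[mu]_(s in B `&` `]0%R, +oo[)
    ((exp_coeff lambda k)%:E * (exponential_pdf lambda s)%:E))%E).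
  apply: ge0_le_integral => //.
  - by move=> s _; rewrite lee_fin; exact: waiting_density_ge0.
  - by apply: measurable_funTS; apply/measurable_EFinP; exact: measurable_waiting_density.
  - by apply: emeasurable_funM => //; exact: mpdf.
  - move=> s [_ /=]; rewrite in_itv /= andbT => s0; rewrite -EFinM lee_fin.
    exact/waiting_density_le/ltW.
rewrite ge0_integralZl//; [|exact: mpdf|by rewrite lee_fin exp_coeff_ge0].
apply: lee_wpmul2l; first by rewrite lee_fin exp_coeff_ge0.
have H := @le_measure _ _ _ (expo lambda_gt0) (B `&` `]0, +oo[) B.
apply: H; rewrite ?inE//.
Qed.

Variable a0 : 'I_q.

(** Keeps only the term without rejections. From the elapsed time [rho x a0] on, the mark [a0] is
    accepted, so the acceptance probability is at least [1 / q]. *)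
Lemma waiting_kernel_ge x (B : set R) : measurable B ->
  ((q%:R^-1)%:E * expo lambda_gt0 (B `&` `[rho x a0, +oo[) <= W x (@gap R @^-1` B))%E.
Proof.
move=> mB; rewrite waiting_kernelE.
have d0 k s : (0 <= (waiting_density lambda rho k x s)%:E)%E.
  by rewrite lee_fin; apply: waiting_density_ge0.
apply: le_trans (@nneseries_lim_ge _ _ predT 0 1 _); last first.
  by move=> k _ _; exact: integral_ge0.
rewrite big_nat1 waiting_integral_gap//.
have q0 : (0 <= q%:R^-1 :> R) by rewrite invr_ge0.
have mg : measurable (B `&` `[rho x a0, +oo[) by exact: measurableI.
have mgp : measurable (B `&` `[rho x a0, +oo[ `&` `]0%R, +oo[) by exact: measurableI.
have pdf0 s : (0 <= (exponential_pdf lambda s)%:E)%E.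
  by rewrite lee_fin exponential_pdf_ge0// ltW.
have mpdf (A : set R) : measurable_fun A (fun s => (exponential_pdf lambda s)%:E).
  by apply: measurable_funTS; apply/measurable_EFinP; exact: measurable_exponential_pdf.
have -> : expo lambda_gt0 (B `&` `[rho x a0, +oo[) =
    (\int[mu]_(s in B `&` `[rho x a0, +oo[) (exponential_pdf lambda s)%:E)%E by [].
rewrite (integral_positive mg) //; first last.
- by move=> s s0; rewrite lt0_exponential_pdf.
- exact: measurable_exponential_pdf.
rewrite -ge0_integralZl//; last exact: mpdf.
apply: (@le_trans _ _ (\int[mu]_(s in B `&` `[rho x a0, +oo[ `&` `]0%R, +oo[)
    (waiting_density lambda rho 0 x s)%:E)%E).
  apply: ge0_le_integral => //.
  - by move=> s _; rewrite mule_ge0.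
  - by apply: emeasurable_funM => //; exact: mpdf.
  - by apply: measurable_funTS; apply/measurable_EFinP; exact: measurable_waiting_density.
  - move=> s [[_ /=]]; rewrite !in_itv /= !andbT => rs s0; rewrite -EFinM lee_fin.
    rewrite /waiting_density /accept_density subr0 expr0 fact0 divr1 mulr1 mul1r mulrC.
    rewrite ler_wpM2l//; first by rewrite exponential_pdf_ge0// ltW.
    rewrite /reject_prob -[X in X - _](mulVf (lt0r_neq0 (ltr0Sn R q.-1))) prednK//.
    rewrite -mulrBr ler_peMr// (bigD1 a0)//= ltNge ge_max rs (ltW s0) add0r.
    rewrite lerBrDr -[q in leRHS](card_ord q) -sumr_const [leRHS](bigD1 a0)//= lerD2l.
    by apply: ler_sum => b _; case: (_ < _).
apply: ge0_subset_integral => //.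
- exact: measurableI.
- by apply: measurable_funTS; apply/measurable_EFinP; exact: measurable_waiting_density.
- by move=> s [[Bs _] s0].
Qed.

Lemma condition_U_waiting :
  (forall x y, agree 0 x y -> rho x = rho y) ->
  (forall x i, (i < n)%N -> 1 <= gap (nth point (x : X) i) -> rho x a0 <= 0) ->
  condition_U (vector_kernel (waiting_pker lambda_gt0 q_gt0 mrho rho_le1)).
Proof.
move=> rho_gap rho_le0.
apply: (@condition_U_kernel _ _ _ lambda_gt0 _ q%:R^-1 (expR lambda) (fun x => rho x a0)).
- by rewrite invr_gt0 ltr0n.
- exact: expR_gt0.
- move=> x y U /rho_gap rxy _; rewrite [LHS]waiting_kernelE [RHS]waiting_kernelE; apply: eq_eseriesr => k _.
  by apply: eq_integral => s _; rewrite /waiting_density rxy.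
- exact: waiting_kernel_le.
- exact: waiting_kernel_ge.
- by move=> x; exact: rho_le1.
- exact: rho_le0.
Qed.

End uniform_waiting.

(** * Residual service times as functions of the window *)

Section thresholds.
Context (R : realType) (kappa : nat).
Hypothesis kappa_gt0 : (0 < kappa)%N.
Local Notation n := kappa.-1.
Implicit Types (x : n.-tuple (state R)) (m : nat).

(* The residual service time, at the time of the last admittance, of the message
   admitted [m] admittances earlier; negative if that message has left. *)
Definition slack x m : R := 1 - \sum_(0 <= j < m) (gaps x)`_(n - j.+1).

(** Indexed by the age of the message instead of the label of its channel, which the gaps do not
    reveal; [reject_prob] sees only the multiset of the values truncated at 0. *)
Definition aloha_thresholds x (a : 'I_kappa) : R := slack x a.

Definition csma_thresholds x (_ : 'I_1) : R := slack x n.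

Lemma gapsE x i : (i < n)%N -> (gaps x)`_i = gap (nth point x i).
Proof. by move=> i_n; rewrite /gaps (nth_map point) ?size_tuple. Qed.

Lemma slackE x m : (m <= n)%N ->
  slack x m = 1 - \sum_(0 <= j < m) gap (nth point x (n - j.+1)).
Proof.
move=> mn; congr (_ - _); apply: eq_big_nat => j /andP[_ jm].
by rewrite gapsE//; lia.
Qed.

Lemma gammaE x : gamma x = Num.max (slack x n) 0.
Proof.
congr (Num.max (_ - _) _); rewrite (big_nth 0) size_map size_tuple big_nat_rev /=.
by apply: eq_big_nat => j _; rewrite add0n.
Qed.

Lemma gaps_ge0 x i : 0 <= (gaps x)`_i.
Proof.
have [i_n|n_i] := ltnP i n; first by rewrite gapsE// ltW// gap_gt0.
by rewrite nth_default// size_map size_tuple.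
Qed.

Lemma slack_nonincreasing x m m' : (m <= m')%N -> slack x m' <= slack x m.
Proof.
move=> mm; rewrite lerD2l lerN2 [leRHS](@big_cat_nat _ _ _ m)//= lerDl.
by apply: sumr_ge0 => j _; exact: gaps_ge0.
Qed.

Lemma slack_le1 x m : slack x m <= 1.
Proof. by rewrite gerBl sumr_ge0// => j _; exact: gaps_ge0. Qed.

Lemma slack_le0 x i : (i < n)%N -> 1 <= gap (nth point x i) -> slack x n <= 0.
Proof.
move=> i_n xi; rewrite slackE// big_nat_rev big_mkord (bigD1 (Ordinal i_n))//=.
rewrite add0n subnSK// subKn; last exact: ltnW.
rewrite subr_le0 (le_trans xi)// lerDl sumr_ge0// => j _.
exact/ltW/gap_gt0.
Qed.

Lemma measurable_slack m : (m <= n)%N ->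
  measurable_fun [set: n.-tuple (state R)] (slack ^~ m).
Proof.
move=> mn; rewrite (_ : slack ^~ m = fun x => 1 - \sum_(j < m) (gap (nth point x (n - j.+1)) : R)).
  apply: measurable_funB => //; apply: measurable_sum => j.
  have jn : (n - j.+1 < n)%N by have := ltn_ord j; lia.
  rewrite (_ : (fun _ => _) = (@gap R) \o (fun x => tnth x (Ordinal jn))).
    exact: (measurableT_comp (@measurable_gap R) (@measurable_tnth _ _ _ _)).
  by apply/funext => x /=; rewrite (tnth_nth point).
by apply/funext => x; rewrite slackE// big_mkord.
Qed.

Lemma slack_agree x y m : (m <= n)%N -> agree 0 x y -> slack x m = slack y m.
Proof.
move=> mn xy; rewrite !slackE//; congr (_ - _); apply: eq_big_nat => j /andP[_ jm].
by apply: xy; lia.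
Qed.

Let ord_le (a : 'I_kappa) : (a <= n)%N.
Proof. by have := ltn_ord a; lia. Qed.

Lemma measurable_aloha_thresholds a :
  measurable_fun [set: n.-tuple (state R)] (fun x => aloha_thresholds x a).
Proof. exact: measurable_slack. Qed.

Lemma measurable_csma_thresholds a :
  measurable_fun [set: n.-tuple (state R)] (fun x => csma_thresholds x a).
Proof. exact: measurable_slack. Qed.

Lemma aloha_thresholds_le1 x a : aloha_thresholds x a <= 1.
Proof. exact: slack_le1. Qed.

Lemma csma_thresholds_le1 x a : csma_thresholds x a <= 1.
Proof. exact: slack_le1. Qed.

Lemma aloha_thresholds_agree x y : agree 0 x y -> aloha_thresholds x = aloha_thresholds y.
Proof. by move=> xy; apply/funext => a; exact: slack_agree. Qed.

Lemma csma_thresholds_agree x y : agree 0 x y -> csma_thresholds x = csma_thresholds y.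
Proof. by move=> xy; apply/funext => a; exact: slack_agree. Qed.

End thresholds.

Section density.
Context (R : realType) (lambda : R) (q : nat).
Hypothesis lambda_gt0 : 0 < lambda.
Hypothesis q_gt0 : (0 < q)%N.
Context d (X : measurableType d) (r : X -> 'I_q -> R).
Hypothesis mr : forall a, measurable_fun [set: X] (fun x => r x a).
Local Notation mu := (@lebesgue_measure R).

Lemma waiting_kernel_density x (f : nat -> R -> R) (N : set R) U : finite_set N ->
  (forall k s, 0 < s -> ~ N s -> f k.+1 s = waiting_density lambda r k x s) ->
  measurable U -> waiting_kernel lambda_gt0 q_gt0 mr x U = density_measure f U.
Proof.
move=> fN fE mU; rewrite waiting_kernelE /density_measure.
have mE k : measurable (mk_state k @^-1` U : set R).
  by rewrite -[X in measurable X]setTI; exact: measurable_mk_state.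
have UE k : [set s | (@state_val R @` U) (k.+1, s)] = mk_state k @^-1` U `&` `]0, +oo[.
  apply/seteqP; split=> s /=.
    move=> [z Uz zE]; have s0 : 0 < s by have := gap_gt0 z; rewrite /gap zE.
    rewrite in_itv /= s0; split=> //.
    by rewrite (_ : mk_state k s = z)//; apply: state_val_inj; rewrite mk_stateE.
  rewrite in_itv /= andbT => -[Us s0]; exists (mk_state k s) => //.
  by rewrite mk_stateE.
(* Shifts the index: the kernel sums over the rejections from 0, [density_measure] over the counts
   from 1. *)
pose h k : \bar R := if k is l.+1 then
  (\int[mu]_(s in mk_state l @^-1` U) (waiting_density lambda r l x s)%:E)%E else 0%E.
transitivity (\sum_(0 <= k <oo) h (k + 1)%N)%E.
  by apply: eq_eseriesr => k _; rewrite addn1.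
rewrite nneseries_addn; last first.
  by case=> //= k; apply: integral_ge0 => s _; rewrite lee_fin waiting_density_ge0.
apply: congr_lim; apply/funext => m; apply: eq_big_nat => -[//|k] _; rewrite UE /h.
rewrite integral_positive//; first last.
- move=> s s0; rewrite /waiting_density /accept_density subr0 lt0_exponential_pdf//.
  by rewrite mulr0 !mul0r.
- exact: measurable_waiting_density.
apply/esym; apply: (eq_integral_finite _ fN).
- exact: measurableI.
- by apply: measurable_funTS; apply/measurable_EFinP; exact: measurable_waiting_density.
by move=> s [_ /=]; rewrite in_itv /= andbT => s0 Ns; rewrite fE.
Qed.

End density.

(** A down-closed set of integers is an initial segment, so its largest rank is its size. This turns
    the maximum in [beta] into a number of messages in service. *)
Lemma bigmax_down_closed K (Q : pred nat) : (forall i j, (i <= j)%N -> Q j -> Q i) ->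
  (\max_(1 <= m < K.+1 | Q m.-1) m = \sum_(m < K) Q m)%N.
Proof.
move=> Qd; rewrite big_mkcond; elim: K => [|K IH]; first by rewrite big_geq// big_ord0.
rewrite big_nat_recr//= IH big_ord_recr /=; case: ifP => QK; last by rewrite maxn0 addn0.
have -> : (\sum_(m < K) Q m = K)%N.
  rewrite -[RHS](card_ord K) -sum1_card; apply: eq_bigr => m _.
  by rewrite (Qd _ K)// ltnW.
by rewrite addn1; apply/maxn_idPr.
Qed.

(** * Identification with the stated densities *)

Section densities.
Context (R : realType) (lambda : R) (kappa : nat).
Hypothesis lambda_gt0 : 0 < lambda.
Hypothesis kappa_gt0 : (0 < kappa)%N.
Local Notation n := kappa.-1.
Local Notation mu := (@lebesgue_measure R).
Implicit Types (x : n.-tuple (state R)) (s : R).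

Let ord_le (a : 'I_kappa) : (a <= n)%N.
Proof. by have := ltn_ord a; lia. Qed.

Lemma csma_reject_prob x s : reject_prob (csma_thresholds x) s = (s < gamma x)%R%:R.
Proof. by rewrite /reject_prob invr1 mul1r big_ord1 /csma_thresholds gammaE. Qed.

Lemma csma_reject_int x s : reject_int (csma_thresholds x) s = Num.min (gamma x) s.
Proof. by rewrite /reject_int invr1 mul1r big_ord1 /csma_thresholds gammaE. Qed.

Lemma csma_densityE x k s : 0 < s ->
  csma_density lambda x k.+1 s = waiting_density lambda (@csma_thresholds R kappa) k x s.
Proof.
move=> s0; rewrite /csma_density /waiting_density /accept_density /= reject_int0 !subr0.
rewrite csma_reject_prob csma_reject_int exponential_pdfE ?ltW// indicE.
have [gs|sg] := leP (gamma x) s.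
  rewrite mem_set; last by rewrite /= in_itv /= andbT.
  rewrite subr0 !mulr1 exprS; ring.
rewrite memNset ?mulr0 ?subrr ?mulr0 ?mul0r//.
by rewrite /= in_itv /= andbT leNgt sg.
Qed.

Lemma betaE x s : gamma x <= s -> beta x s = \sum_(a < kappa) (s <= slack x a)%R%:R.
Proof.
move=> gs; rewrite /beta indicE mem_set; last by rewrite /= in_itv /= andbT.
rewrite mul1r (eq_bigl (fun m => (s <= slack x m.-1)%R)); last first.
  by move=> m; rewrite /slack lerBrDr.
rewrite (@bigmax_down_closed _ (fun m => s <= slack x m)%R); last first.
  by move=> i j ij /le_trans; apply; exact: slack_nonincreasing.
by rewrite natr_sum; apply: eq_bigr => a _.
Qed.

(** Below [gamma] all channels are busy. From [gamma] on, [beta] counts the slacks that are [>= s]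
    and the rejection probability those that are [> s]; they differ only if [s] is a slack. *)
Lemma aloha_reject_probE x s : 0 <= s -> (forall a : 'I_kappa, s <> slack x a) ->
  reject_prob (aloha_thresholds x) s = (s < gamma x)%R%:R + beta x s / kappa%:R.
Proof.
move=> s0 sN.
have k0 : kappa%:R != 0 :> R by rewrite pnatr_eq0 -lt0n.
have [gs|sg] := leP (gamma x) s.
  rewrite add0r betaE// mulrC; congr (_ * _); apply: eq_bigr => a _.
  rewrite lt_max [s < 0]ltNge s0 orbF le_eqVlt /aloha_thresholds.
  by case: eqP => // /sN.
rewrite /beta indicE memNset; last by rewrite /= in_itv /= andbT leNgt sg.
rewrite !mul0r addr0; apply: (mulfI k0); rewrite mulVKf// mulr1.
rewrite -[in RHS](card_ord kappa) -sumr_const; apply: eq_bigr => a _.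
rewrite (lt_le_trans sg)// gammaE ge_max !le_max lexx orbT andbT.
by rewrite /aloha_thresholds slack_nonincreasing.
Qed.

Lemma integral_reject_prob_itv (q : nat) (r : 'I_q -> R) s : 0 <= s ->
  (\int[mu]_(u in `[0%R, s]) (reject_prob r u)%:E = (reject_int r s)%:E)%E.
Proof.
move=> s0; rewrite integral_mkcond.
have := integral_reject_prob r s0; rewrite reject_int0 subr0 => <-.
apply: eq_integral => u _; rewrite patchE mem_setE in_itv.
by case: (_ <= _ <= _); rewrite ?mulr1 ?mulr0.
Qed.

(* Almost everywhere, the ALOHA rejection probability is the CSMA one plus
   [beta x / kappa]. *)
Lemma beta_intE x s : 0 <= s ->
  beta_int x s = kappa%:R * (reject_int (aloha_thresholds x) s - Num.min (gamma x) s).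
Proof.
move=> s0.
have k0 : kappa%:R != 0 :> R by rewrite pnatr_eq0 -lt0n.
have mp q (r : 'I_q -> R) : measurable_fun [set: R] (reject_prob r).
  exact: measurable_reject_prob.
have ip q (r : 'I_q -> R) : (0 < q)%N -> mu.-integrable `[0, s] (EFin \o reject_prob r).
  move=> q0; apply: measurable_bounded_integrable => //.
  - by rewrite [X in (X < _)%E]lebesgue_measure_itv/= lte_fin; case: ifP => _; rewrite ltry.
  - by apply: measurable_funTS; exact: mp.
  - exists 1; split=> // M M1 u _ /=; apply: le_trans (ltW M1).
    by rewrite ger0_norm ?reject_prob_ge0// reject_prob_le1.
rewrite -csma_reject_int /beta_int /Rintegral.
rewrite (@eq_integral_finite _ _ [set slack x a | a in [set: 'I_kappa]] _
  (fun u => (kappa%:R)%:E * ((reject_prob (aloha_thresholds x) u)%:E -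
                             (reject_prob (csma_thresholds x) u)%:E))%E)//.
- rewrite integralZl//; last by apply: integrableB => //; exact: ip.
  rewrite integralB_EFin//; [|exact: ip|exact: ip].
  by rewrite !integral_reject_prob_itv.
- exact: finite_image.
- apply: emeasurable_funM => //; apply: emeasurable_funB;
    by apply: measurable_funTS; exact/measurable_EFinP.
- move=> u /=; rewrite in_itv /= => /andP[u0 us] Nu.
  rewrite aloha_reject_probE//; last by move=> a ua; apply: Nu; exists a.
  by rewrite csma_reject_prob -EFinB -EFinM addrAC subrr add0r mulrC mulfVK.
Qed.

Lemma aloha_densityE x k s : 0 < s -> (forall a : 'I_kappa, s <> slack x a) ->
  aloha_density lambda x k.+1 s = waiting_density lambda (@aloha_thresholds R kappa) k x s.
Proof.
move=> s0 sN.
have k0 : kappa%:R != 0 :> R by rewrite pnatr_eq0 -lt0n.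
rewrite /aloha_density /waiting_density /accept_density /= reject_int0 !subr0.
rewrite aloha_reject_probE ?ltW// exponential_pdfE ?ltW// indicE.
have [gs|sg] := leP (gamma x) s.
  rewrite mem_set; last by rewrite /= in_itv /= andbT.
  rewrite beta_intE ?ltW// min_l// add0r !mulr1 exprS [kappa%:R * _]mulrC mulfK//.
  rewrite [gamma x + _]addrC subrK; ring.
rewrite memNset ?mulr0; last by rewrite /= in_itv /= andbT leNgt sg.
rewrite /beta indicE memNset; last by rewrite /= in_itv /= andbT leNgt sg.
by rewrite !mul0r addr0 subrr mulr0 mul0r.
Qed.

End densities.

(** * The two models *)

Section model.
Context d (Omega : measurableType d) (R : realType) (P : probability Omega R).
Variables (lambda : R) (T : nat -> {RV P >-> R}).
Hypothesis lambda_gt0 : 0 < lambda.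
Hypothesis HT : poisson_arrivals lambda T.
Variables (kappa : nat) (accepts : {set 'I_kappa} -> 'I_kappa -> bool).
Hypothesis kappa_gt0 : (0 < kappa)%N.
Variable C : nat -> Omega -> 'I_kappa.

Local Notation t w := (fun j => T j w).
Local Notation c w := (fun j => C j w).
Local Notation adm w := (admitted accepts (t w) (c w)).
Local Notation idx i w := (admitted_index accepts (t w) (c w) i).
Local Notation n := kappa.-1.

Hypothesis admitted_idle : forall w j, adm w j -> C j w \in idle accepts (t w) (c w) j.
Hypothesis idle_admitted : forall w j,
  idle accepts (t w) (c w) j = [set: 'I_kappa]%SET -> adm w j.

Local Notation X := (admission_state HT idle_admitted).
Local Notation hist i w := [tuple X (i - n + j)%N w | j < n].

(** The last [m] gaps telescope to the time since the admittance [m] steps earlier. *)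
Lemma slack_history i m w : (m <= n <= i)%N ->
  slack (hist i w) m = 1 - (T (idx i w) w - T (idx (i - m) w) w).
Proof.
move=> /andP[mn ni]; rewrite slackE//; congr (_ - _).
have gapE j : (j < n)%N -> gap (nth point (hist i w) (n - j.+1)) =
    T (idx (i - j) w) w - T (idx (i - j.+1) w) w.
  move=> jn; have nj : (n - j.+1 < n)%N by clear -jn; lia.
  rewrite (_ : nth _ _ _ = X (i - n + (n - j.+1))%N w); last first.
    by rewrite -[LHS]/(nth point (hist i w) (Ordinal nj)) -tnth_nth tnth_mktuple.
  have -> : (i - n + (n - j.+1) = i - j.+1)%N by clear -jn ni; lia.
  rewrite /gap admission_stateE /admission_data /= /admission_time.
  by rewrite (_ : (i - j = (i - j.+1).+1)%N)//; clear -jn ni; lia.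
elim: m mn => [|m IH] mn; first by rewrite big_geq// subn0 subrr.
by rewrite big_nat_recr//= IH ?gapE// ?(ltnW mn)// addrA subrK.
Qed.

Lemma card_busy_slack i w s : (n <= i)%N -> 0 <= s ->
  #|[set x | T (idx i w) w + s < release accepts (t w) (c w) (idx i w).+1 x]%SET| =
  count (fun m => s < slack (hist i w) m) (iota 0 kappa).
Proof.
move=> ni s0.
rewrite (card_busy_admitted (arrival0 HT w) (arrival_lt HT w) (arrival_cvg HT w)
  (@admitted_idle w) (@idle_admitted w) ni kappa_gt0 s0).
apply: eq_in_count => m; rewrite mem_iota add0n => /andP[_ mk].
rewrite slack_history// ni andbT; clear -mk; lia.
Qed.

End model.

Section aloha.
Context d (Omega : measurableType d) (R : realType) (P : probability Omega R).
Variables (lambda : R) (T : nat -> {RV P >-> R}).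
Hypothesis lambda_gt0 : 0 < lambda.
Hypothesis HT : poisson_arrivals lambda T.
Variable kappa : nat.
Hypothesis kappa_gt0 : (0 < kappa)%N.
Variable C : nat -> Omega -> 'I_kappa.
Hypothesis HC : uniform_choices T C.

Local Notation t w := (fun j => T j w).
Local Notation c w := (fun j => C j w).
Local Notation rel w := (release (@aloha_rule kappa) (t w) (c w)).
Local Notation adm w := (admitted (@aloha_rule kappa) (t w) (c w)).
Local Notation F J := (g_sigma_algebraType (past T C J)).

Let admE w j : adm w j = (rel w j (C j w) <= T j w).
Proof. by rewrite /admitted /aloha_rule inE. Qed.

Let measurable_mark J j x : (j <= J)%N -> measurable_fun [set: F J] (fun w => C j w == x).
Proof.
move=> jJ; apply: (@measurable_fun_bool _ (F J) setT _ true).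
rewrite setTI (_ : _ @^-1` _ = [set w | C j w = x]); first exact: (past_mark (J := J)).
by apply/seteqP; split=> w /= /eqP.
Qed.

(** [release j] involves only the messages before [j], so that [j = J.+1] is still allowed. *)
Lemma past_release J j x : (j <= J.+1)%N ->
  measurable_fun [set: F J] (fun w => rel w j x).
Proof.
elim: j x => [|j IH] x jJ; first exact: measurable_cst.
have mT : measurable_fun [set: F J] (T j : Omega -> R) by exact: past_time.
have mb : measurable_fun [set: F J] (fun w => (C j w == x) && (rel w j x <= T j w)).
  apply: measurable_and; first exact: measurable_mark.
  by apply: measurable_fun_ler => //; apply: IH; exact: ltnW.
(* Tests the fixed channel [x] in place of the random channel [C j w], so that the induction
   hypothesis applies. *)
rewrite (_ : (fun w => _) = fun w =>
    if (C j w == x) && (rel w j x <= T j w) then T j w + 1 else rel w j x).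
  apply: measurable_fun_ifT => //; last by apply: IH; exact: ltnW.
  exact: measurable_funD.
apply/funext => w; rewrite releaseS admE eq_sym.
by case: eqVneq => [->|]; rewrite ?andbT ?andbF.
Qed.

Lemma past_admitted_aloha j : <<s past T C j >> [set w | adm w j].
Proof.
have -> : [set w | adm w j] =
    \bigcup_(x in [set: 'I_kappa]) ([set w | C j w = x] `&` [set w | rel w j x <= T j w]).
  apply/seteqP; split=> w /=; first by rewrite admE => h; exists (C j w).
  by move=> [x _ [/= <-]]; rewrite admE.
apply: (@fin_bigcup_measurable _ (F j)) => // x _.
apply: (@measurableI _ (F j)); first exact: past_mark.
apply: (@measurable_set_bool _ (F j)).
by apply: measurable_fun_ler; [exact: past_release|exact: past_time].
Qed.

Let admitted_idle w j : adm w j -> C j w \in idle (@aloha_rule kappa) (t w) (c w) j.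
Proof. by []. Qed.

Let idle_admitted w j :
  idle (@aloha_rule kappa) (t w) (c w) j = [set: 'I_kappa]%SET -> adm w j.
Proof. by rewrite /admitted => ->; rewrite /aloha_rule inE. Qed.

Local Notation X := (admission_state HT idle_admitted).
Local Notation idx i w := (admitted_index (@aloha_rule kappa) (t w) (c w) i).
Local Notation n := kappa.-1.

Let thresholds i J : (n <= i)%N -> exists r : Omega -> 'I_kappa -> R,
  (forall a, measurable_fun [set: F J] (fun w => r w a)) /\
  forall w, idx i w = J ->
    (forall j, (J < j)%N -> (forall l, (J < l < j)%N -> ~~ adm w l) ->
       adm w j = ~~ (T j w - T J w < r w (C j w))) /\
    (forall s, 0 <= s -> reject_prob (r w) s =
       reject_prob (aloha_thresholds [tuple X (i - n + j)%N w | j < n]) s).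
Proof.
move=> ni; exists (fun w x => rel w J.+1 x - T J w); split=> [x|w iJ].
  by apply: measurable_funB; [exact: past_release|exact: past_time].
split=> [j Jj na|s s0].
  by rewrite admE (release_between _ Jj na) ltrD2r -leNgt.
(* Here the labels of the channels are lost: both sums only count, and [card_busy_slack] equates the
   counts. *)
congr (_ * _); rewrite -!natr_sum; congr (_%:R).
transitivity #|[set x | T (idx i w) w + s < rel w (idx i w).+1 x]%SET|.
  rewrite -sum1_card [RHS]big_mkcond; apply: eq_bigr => x _.
  rewrite inE iJ lt_max [s < 0]ltNge s0 orbF ltrBrDl.
  by case: (_ < _).
rewrite (card_busy_slack HT kappa_gt0)// -sum1_count [LHS]big_mkcond /=.
have -> : iota 0 kappa = index_iota 0 kappa by rewrite /index_iota subn0.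
rewrite big_mkord; apply: eq_bigr => a _.
rewrite lt_max [s < 0]ltNge s0 orbF /aloha_thresholds.
by case: (_ < _).
Qed.

Lemma aloha_admission_chain : admission_chain (@aloha_rule kappa)
  (waiting_pker lambda_gt0 kappa_gt0 (measurable_aloha_thresholds kappa_gt0)
     (@aloha_thresholds_le1 R kappa)) T C.
Proof.
exists X; first by move=> i w; exact: admission_stateE.
split=> [i|i ni D U mD mU].
  exact: (measurable_admission_state HT HC _ past_admitted_aloha).
exact: (transition_law lambda_gt0 HC kappa_gt0 past_admitted_aloha
  (measurable_aloha_thresholds kappa_gt0) thresholds).
Qed.

End aloha.

Section csma.
Context d (Omega : measurableType d) (R : realType) (P : probability Omega R).
Variables (lambda : R) (T : nat -> {RV P >-> R}).
Hypothesis lambda_gt0 : 0 < lambda.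
Hypothesis HT : poisson_arrivals lambda T.
Variable kappa : nat.
Hypothesis kappa_gt0 : (0 < kappa)%N.
Variable C : nat -> Omega -> 'I_kappa.

Local Notation t w := (fun j => T j w).
Local Notation c w := (fun j => C j w).
Local Notation rel w := (release (@csma_rule kappa) (t w) (c w)).
Local Notation adm w := (admitted (@csma_rule kappa) (t w) (c w)).
Local Notation idx i w := (admitted_index (@csma_rule kappa) (t w) (c w) i).
Local Notation n := kappa.-1.
(* CSMA rejects deterministically: a single threshold and trivial marks. *)
Local Notation M := (fun (_ : nat) (_ : Omega) => ord0 : 'I_1).
Local Notation F J := (g_sigma_algebraType (past T M J)).

Hypothesis HC : forall w, csma_choices (t w) (c w).

Let HM : uniform_choices T M.
Proof.
have M1 (a : 'I_1) : [set _ : Omega | ord0 = a] = setT.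
  by apply/seteqP; split=> [w _|w _ /=]; rewrite ?(ord1 a).
split=> [j a|j a|E m a sE]; first by rewrite M1.
- by rewrite M1 probability_setT invr1.
- rewrite big1 ?mule1; last by move=> j _; rewrite M1 probability_setT.
  by congr (P _); apply/seteqP; split=> w; [case|split=> // j _; rewrite M1].
Qed.

Let admitted_idle w j : adm w j -> C j w \in idle (@csma_rule kappa) (t w) (c w) j.
Proof. exact: HC. Qed.

Let idle_admitted w j :
  idle (@csma_rule kappa) (t w) (c w) j = [set: 'I_kappa]%SET -> adm w j.
Proof.
rewrite /admitted => ->; apply/set0Pn; exists (Ordinal kappa_gt0); by rewrite inE.
Qed.

(** The assignment [C] is arbitrary among the idle channels and may fail to be measurable. Counting
    busy channels removes it: by [card_busy], admission becomes a function of the arrival times and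
    the earlier admissions. *)
Let admitted_card w j : adm w j = (#|[set x | (T j w < rel w j x)%R]%SET| < kappa)%N.
Proof.
rewrite /admitted; set I := idle _ _ _ _.
have -> : [set x | T j w < rel w j x]%SET = ~: I.
  by apply/setP => x; rewrite !inE ltNge.
have lt_add a b k : (a + b = k)%N -> (0 < a)%N = (b < k)%N by lia.
by rewrite /csma_rule -card_gt0; apply: lt_add; rewrite cardsC card_ord.
Qed.

Lemma past_admitted_csma j : <<s past T M j >> [set w | adm w j].
Proof.
elim/ltn_ind: j => j IH.
pose S w : R := \sum_(i < j) (adm w i && (T j w < T i w + 1))%:R.
have -> : [set w | adm w j] = [set w | S w < kappa%:R].
  apply: eq_set => w; congr is_true; rewrite admitted_card (card_busy (@admitted_idle w)); first last.
  - exact: (arrivals_ge0 HT).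
  - by move=> i ij; rewrite (arrivals_mono HT) ltnW.
  rewrite -sum1_count [X in (X < _)%N]big_mkcond /=.
  have -> : iota 0 j = index_iota 0 j by rewrite /index_iota subn0.
  rewrite big_mkord -(ltr_nat R) natr_sum.
  by congr (_ < _).
apply: (@measurable_set_bool _ (F j)); apply: measurable_fun_ltr => //.
apply: measurable_sum => i; apply: measurable_natb; apply: measurable_and.
  apply: (@measurable_fun_bool _ (F j) setT _ true); rewrite setTI.
  have ij : (i < j)%N by [].
  exact: (sub_past (ltnW ij) (IH i ij)).
apply: measurable_fun_ltr; first exact: past_time.
by apply: measurable_funD => //; apply: past_time; exact: ltnW.
Qed.

Local Notation X := (admission_state HT idle_admitted).

Let idx_le i l w : (i <= l)%N -> (idx i w <= idx l w)%N.
Proof.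
apply: (@homo_leq _ (fun i => idx i w) leq leqnn leq_trans) => k; apply: ltnW.
exact: (admitted_index_lt (arrival0 HT w) (arrival_lt HT w) (arrival_cvg HT w)
  (@idle_admitted w)).
Qed.

(* On [idx i w = J] the sum below is [T (idx (i - n) w) w]; it is written so as to
   be measurable with respect to the past of [J] everywhere. *)
Let thresholds i J : (n <= i)%N -> exists r : Omega -> 'I_1 -> R,
  (forall a, measurable_fun [set: F J] (fun w => r w a)) /\
  forall w, idx i w = J ->
    (forall j, (J < j)%N -> (forall l, (J < l < j)%N -> ~~ adm w l) ->
       adm w j = ~~ (T j w - T J w < r w (M j w))) /\
    (forall s, 0 <= s -> reject_prob (r w) s =
       reject_prob (csma_thresholds [tuple X (i - n + j)%N w | j < n]) s).
Proof.
move=> ni.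
exists (fun w _ => \sum_(a < J.+1) (idx (i - n) w == a)%:R * T a w + 1 - T J w).
split=> [_|w iJ].
  apply: measurable_funB; last exact: past_time.
  apply: measurable_funD => //; apply: measurable_sum => a.
  have aJ : (a <= J)%N by rewrite -ltnS.
  apply: measurable_funM; last exact: past_time.
  apply: measurable_natb; apply: (@measurable_fun_bool _ (F J) setT _ true); rewrite setTI.
  rewrite (_ : _ @^-1` _ = [set w | idx (i - n) w = a]).
    exact: (sub_past aJ (past_index HT idle_admitted past_admitted_csma (i - n) (J := a))).
  by apply/seteqP; split=> w /= /eqP.
set S := \sum_(a < _) _.
have SE : S = T (idx (i - n) w) w.
  have iJ' : (idx (i - n) w < J.+1)%N by rewrite ltnS -iJ idx_le// leq_subr.
  rewrite /S (bigD1 (Ordinal iJ'))//= eqxx mul1r big1 ?addr0// => a.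
  by rewrite -val_eqE /= eq_sym => /negbTE ->; rewrite mul0r.
have rE : S + 1 - T J w = slack [tuple X (i - n + j)%N w | j < n] n.
  rewrite slack_history ?leqnn// iJ SE; ring.
split=> [j Jj na|s _]; last first.
  congr (_ * _); apply: eq_bigr => a _; congr ((_ < Num.max _ _)%R%:R).
  by rewrite /csma_thresholds rE.
rewrite rE admitted_card.
have s0 : 0 <= T j w - T J w by rewrite subr_ge0 (arrivals_mono HT) ltnW.
(* No channel was assigned after message [J], so the release times are still those right after
   it. *)
have -> : [set x | T j w < rel w j x]%SET =
    [set x | T (idx i w) w + (T j w - T J w) < rel w (idx i w).+1 x]%SET.
  by apply/setP => x; rewrite !inE iJ (release_between _ Jj na) addrC subrK.
rewrite (card_busy_slack HT kappa_gt0)//.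
set p := fun m => _ < slack _ m.
have -> : (count p (iota 0 kappa) < kappa)%N = ~~ all p (iota 0 kappa).
  by rewrite all_count size_iota ltn_neqAle -[X in (_ <= X)%N](size_iota 0) count_size andbT.
congr (~~ _); apply/allP/idP => [|pn m].
  by apply; rewrite mem_iota /= add0n prednK.
rewrite mem_iota add0n => /andP[_ mk]; apply: lt_le_trans pn _.
by apply: slack_nonincreasing; rewrite -ltnS prednK.
Qed.

Lemma csma_admission_chain : admission_chain (@csma_rule kappa)
  (waiting_pker lambda_gt0 (ltn0Sn 0) (measurable_csma_thresholds kappa_gt0)
     (@csma_thresholds_le1 R kappa)) T C.
Proof.
exists X; first by move=> i w; exact: admission_stateE.
split=> [i|i ni D U mD mU].
  exact: (measurable_admission_state HT HM _ past_admitted_csma).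
exact: (transition_law lambda_gt0 HM (ltn0Sn 0) past_admitted_csma
  (measurable_csma_thresholds kappa_gt0) thresholds).
Qed.

End csma.

Theorem proposition1p2 (R : realType) (lambda : R) (kappa : nat)
    (lambda_gt0 : 0 < lambda) (kappa_gt0 : (0 < kappa)%N) :
  (exists W : R.-pker (kappa.-1.-tuple (state R)) ~> state R,
    [/\ forall x U, measurable U ->
          W x U = density_measure (aloha_density lambda x) U,
        forall (d : measure_display) (Omega : measurableType d)
            (P : probability Omega R) (T : nat -> {RV P >-> R})
            (C : nat -> Omega -> 'I_kappa),
          poisson_arrivals lambda T ->
          uniform_choices T C ->
          admission_chain (@aloha_rule kappa) W T C &
        condition_U (vector_kernel W)]) /\
  (exists W : R.-pker (kappa.-1.-tuple (state R)) ~> state R,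
    [/\ forall x U, measurable U ->
          W x U = density_measure (csma_density lambda x) U,
        forall (d : measure_display) (Omega : measurableType d)
            (P : probability Omega R) (T : nat -> {RV P >-> R})
            (C : nat -> Omega -> 'I_kappa),
          poisson_arrivals lambda T ->
          (forall w, csma_choices (fun j => T j w) (fun j => C j w)) ->
          admission_chain (@csma_rule kappa) W T C &
        condition_U (vector_kernel W)]).
Proof.
split.
- exists (waiting_pker lambda_gt0 kappa_gt0 (measurable_aloha_thresholds kappa_gt0)
     (@aloha_thresholds_le1 R kappa)); split=> [x U mU|d Omega P T C HT HC|].
  (* The exceptional set consists of the ends of services, where the two densities may disagree. *)
  + apply: (@waiting_kernel_density _ _ _ _ _ _ _ _ _ _ _ [set slack x a | a in [set: 'I_kappa]]) => //.
      exact: finite_image.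
    move=> k s s0 sN; apply: aloha_densityE => // a sa.
    by apply: sN; exists a.
  + exact: aloha_admission_chain.
  (* The last mark carries the least slack, which is at most 0 once the window contains a gap of
     length at least 1. *)
  + have last_lt : (kappa.-1 < kappa)%N by rewrite prednK.
    apply: (@condition_U_waiting _ _ _ _ _ _ _ _ _ (Ordinal last_lt)).
      by move=> x y; exact: aloha_thresholds_agree.
    by move=> x i; exact: slack_le0.
- exists (waiting_pker lambda_gt0 (ltn0Sn 0) (measurable_csma_thresholds kappa_gt0)
     (@csma_thresholds_le1 R kappa)); split=> [x U mU|d Omega P T C HT HC|].
  + apply: (@waiting_kernel_density _ _ _ _ _ _ _ _ _ _ _ set0) => //.
    by move=> k s s0 _; exact: csma_densityE.
  + exact: csma_admission_chain.
  + apply: (@condition_U_waiting _ _ _ _ _ _ _ _ _ ord0).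
      by move=> x y; exact: csma_thresholds_agree.
    by move=> x i; exact: slack_le0.
Qed.
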